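(* Consider the stochastic contextual matching market and the BARB algorithm described in the context (with $\eta = R\sqrt{d\log\left((1+TB_x^2/\lambda)T^2\right)}+\lambda^{1/2}B_\theta$). Assume that the cumulative distribution function $F$ of the minimum difference $\delta_{\min}$ satisfies: there exist constants $\Delta_0>0$ and $c>0$ such that $F(\Delta)\le c\Delta$ for all $\Delta\le\Delta_0$. Then, when $T$ is sufficiently large, the regret of BARB satisfies $Reg_i(T)=\tilde O(T^{2/3})$ for all $i\in[N]$, where $\tilde O$ hides polylogarithmic factors in $T$ and problem-dependent constants.
   Context: Market: $N$ players $p_1,\dots,p_N$ and $K\ge N$ arms $a_1,\dots,a_K$, horizon $T$. Each arm $a_j$ has a fixed, strict, known preference order $\succ_{a_j}$ over players. Each player $p_i$ has an unknown parameter $\theta_i\in\mathbb{R}^d$ with $\|\theta_i\|_2\le B_\theta$. At each round $t$, every arm $a_j$ has a context $x_j(t)\in\mathbb{R}^d$ with $\|x_j(t)\|_2\le B_x$ a.s., revealed before matching; utility $U_{i,j}(t)=\theta_i^\top x_j(t)$; $B_y:=2B_\theta B_x\le 1$. Stochastic contexts: the tuple $(x_1(t),\dots,x_K(t))$ is drawn independently across rounds from a fixed unknown distribution. In each round a matching $\mu_t$ is chosen; if $p_i$ is matched to $a_j$ one observes $y_i(t)=U_{i,j}(t)+\epsilon_{i,j}(t)$ with i.i.d. mean-zero noise, conditionally $R$-subgaussian given the past; unmatched players get $y_i(t)=0$. A matching $\mu$ is stable at time $t$ if there is no pair $(p_i,a_j)$ with $p_i\succ_{a_j}\mu(a_j)$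 and $U_{i,j}(t)>U_{i,\mu(p_i)}(t)$; $\mathcal{S}_t$ is the set of stable matchings and $U_i^*(t)=\max_{\mu\in\mathcal{S}_t}U_{i,\mu(i)}(t)$. Regret: $Reg_i(T)=\sum_{t=1}^T U_i^*(t)-\mathbb{E}[\sum_{t=1}^T y_i(t)]$. Minimum difference of a context realization: $\delta_{\min}=\min_{i}\min_{j\ne j'}|\theta_i^\top(x_j-x_{j'})|$. BARB algorithm (inputs $T$, arm preferences, $d$, $\eta$, initial candidate gap $\Delta_1>0$, ridge parameter $\lambda>0$): global round counter $t$ starts at $1$. For batches $k=1,2,\dots$: $\xi_k=\Delta_k/\eta$, reset $V_i=\lambda I_d$, $\hat\theta_i=0$, counter $N_k=0$. Each round: observe contexts. If some $(i,j)$ has $\|x_j\|_{V_i^{-1}}>\xi_k$, compute a maximum cardinality matching on the bipartite graph of all such pairs, match covered players accordingly (others unmatched), and update for matched players $V_i=\lambda I+\sum_s x_{i_s}x_{i_s}^\top$, $\hat\theta_i=V_i^{-1}\sum_s x_{i_s}y_{i,i_s}$ over that player's exploration rounds in the current batch. Otherwise set $\hat U_{i,j}=\hat\theta_i^\top x_j$, play the output of player-proposing Gale–Shapley on $\hat U$ and the arms' preferences, and increment $N_k$ if some player's minimal gap between consecutive values among its top $N+1$ sorted estimated utilities is $\le 2\Delta_k$. After each round increment $t$ and stop if $t>T$; if $N_k>\frac{3\log T}{16\Delta_k^2}$, set $\Delta_{k+1}=\Delta_k/\sqrt2$ and start the next batch. *)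

(* Defs.v *)
From HB Require Import structures.
From mathcomp Require Import all_boot all_order all_algebra.
From mathcomp Require Import all_classical all_reals all_analysis.
Set Implicit Arguments. Unset Strict Implicit. Unset Printing Implicit Defensive.
Import Order.TTheory GRing.Theory Num.Theory.
Local Open Scope ring_scope.
Local Open Scope classical_set_scope.

Section Market.
Variable R : realType.
Variables N K d : nat.

Definition ip (u v : 'rV[R]_d) : R := (u *m v^T) ord0 ord0.
Definition vnorm (u : 'rV[R]_d) : R := Num.sqrt (ip u u).

Definition matching := {ffun 'I_N -> option 'I_K}.
Definition is_matching (m : matching) : bool :=
  [forall i, forall i', forall j,
     ((m i == Some j) && (m i' == Some j)) ==> (i == i')].

Definition partner (m : matching) (j : 'I_K) : option 'I_N :=
  [pick i | m i == Some j].

(* Arm preferences: rk j i = rank of player i in arm j's list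
   (smaller = more preferred); strictness = injectivity of rk j. *)
Variable rk : 'I_K -> 'I_N -> nat.

Definition arm_prefers (j : 'I_K) (i : 'I_N) (o : option 'I_N) : bool :=
  if o is Some i' then (rk j i < rk j i')%N else true.
Definition player_prefers (U : 'I_N -> 'I_K -> R) (i : 'I_N) (j : 'I_K)
    (o : option 'I_K) : bool :=
  if o is Some j' then U i j' < U i j else true.

Definition stable (U : 'I_N -> 'I_K -> R) (m : matching) : bool :=
  is_matching m &&
  [forall i, forall j,
     ~~ (arm_prefers j i (partner m j) && player_prefers U i j (m i))].

Definition mval (U : 'I_N -> 'I_K -> R) (i : 'I_N) (m : matching) : R :=
  if m i is Some j then U i j else 0.

Definition Ustar (U : 'I_N -> 'I_K -> R) (i : 'I_N) : R :=
  if [pick m | stable U m] is Some m0 then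
    \big[Num.max/mval U i m0]_(m | stable U m) mval U i m
  else 0.

Definition pbetter (Uh : 'I_N -> 'I_K -> R) i (j j' : 'I_K) : bool :=
  (Uh i j' < Uh i j) || ((Uh i j == Uh i j') && (j < j')%N).

Definition proposal Uh (rej : {set 'I_N * 'I_K}) (i : 'I_N) : option 'I_K :=
  [pick j | ((i, j) \notin rej) &&
            [forall j', ((i, j') \notin rej) ==> (j' == j) || pbetter Uh i j j']].

Definition held Uh rej (j : 'I_K) : option 'I_N :=
  [pick i | (proposal Uh rej i == Some j) &&
            [forall i', (proposal Uh rej i' == Some j) ==> (rk j i <= rk j i')%N]].

Definition ga_step Uh (rej : {set 'I_N * 'I_K}) : {set 'I_N * 'I_K} :=
  rej :|: [set ij | (proposal Uh rej ij.1 == Some ij.2) &&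
                    (held Uh rej ij.2 != Some ij.1)].

(* each non-final round adds a rejection, so N*K rounds suffice *)
Definition GS (Uh : 'I_N -> 'I_K -> R) : matching :=
  let rej := iter (N * K) (ga_step Uh) finset.set0 in
  [ffun i => if proposal Uh rej i is Some j then
               (if held Uh rej j == Some i then Some j else None)
             else None].

Record bstate := BState {
  bDelta : R;
  bData  : 'I_N -> seq ('rV[R]_d * R);
  bNk    : nat }.

Definition gram (lam : R) (D : seq ('rV[R]_d * R)) : 'M[R]_d :=
  lam%:M + \sum_(p <- D) (p.1^T *m p.1).
Definition thetahat lam D : 'rV[R]_d :=
  (\sum_(p <- D) p.2 *: p.1) *m invmx (gram lam D).
Definition wnorm lam D (x : 'rV[R]_d) : R :=
  Num.sqrt ((x *m invmx (gram lam D) *m x^T) ord0 ord0).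

Variables (T : nat) (lam eta : R)
          (mcm : {set 'I_N * 'I_K} -> matching).

Definition Uhat (s : bstate) (xs : 'I_K -> 'rV[R]_d) i j : R :=
  ip (thetahat lam (bData s i)) (xs j).

Definition explore_edges (s : bstate) xs : {set 'I_N * 'I_K} :=
  [set ij | bDelta s / eta < wnorm lam (bData s ij.1) (xs ij.2)].

Definition choose (s : bstate) xs : matching :=
  if explore_edges s xs != finset.set0 then mcm (explore_edges s xs)
  else GS (Uhat s xs).

Definition gapcond (s : bstate) xs : bool :=
  [exists i : 'I_N,
     let srt := take N.+1 (sort (fun a b : R => b <= a)
                                [seq Uhat s xs i j | j <- enum 'I_K]) in
     [exists l : 'I_N, (l.+1 < size srt)%N &&
                       (srt`_l - srt`_l.+1 <= 2 * bDelta s)]].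

Definition update (s : bstate) xs (y : 'I_N -> R) : bstate :=
  let E := explore_edges s xs in
  let s1 :=
    if E != finset.set0 then
      BState (bDelta s)
             (fun i => if mcm E i is Some j then rcons (bData s i) (xs j, y i)
                       else bData s i)
             (bNk s)
    else BState (bDelta s) (bData s)
                (if gapcond s xs then (bNk s).+1 else bNk s) in
  if 3 * ln (T%:R) / (16 * bDelta s1 ^+ 2) < (bNk s1)%:R
  then BState (bDelta s1 / Num.sqrt 2) (fun _ => [::]) 0%N
  else s1.

Definition obs (theta : 'I_N -> 'rV[R]_d) (xs : 'I_K -> 'rV[R]_d)
    (e : 'I_N -> 'I_K -> R) (m : matching) (i : 'I_N) : R :=
  if m i is Some j then ip (theta i) (xs j) + e i j else 0.

Variables (Delta1 : R) (theta : 'I_N -> 'rV[R]_d)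
          (xs : nat -> 'I_K -> 'rV[R]_d) (eps : nat -> 'I_N -> 'I_K -> R).

(* state at the beginning of round t (rounds are numbered 0,1,...) *)
Fixpoint bstate_at (t : nat) : bstate :=
  if t is t'.+1 then
    let s := bstate_at t' in
    update s (xs t') (obs theta (xs t') (eps t') (choose s (xs t')))
  else BState Delta1 (fun _ => [::]) 0%N.

Definition barb_match (t : nat) : matching := choose (bstate_at t) (xs t).
Definition barb_y (t : nat) (i : 'I_N) : R :=
  obs theta (xs t) (eps t) (barb_match t) i.

End Market.

Definition is_mcm (N K : nat) (mcm : {set 'I_N * 'I_K} -> matching N K) :=
  forall E : {set 'I_N * 'I_K},
    [/\ is_matching (mcm E),
        (forall i j, mcm E i = Some j -> (i, j) \in E) &
        forall m : matching N K, is_matching m ->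
          (forall i j, m i = Some j -> (i, j) \in E) ->
          (#|[set i | m i != None]| <= #|[set i | mcm E i != None]|)%N].

Definition Utrue (R : realType) N K d (theta : 'I_N -> 'rV[R]_d)
   (xs : 'I_K -> 'rV[R]_d) (i : 'I_N) (j : 'I_K) : R := ip (theta i) (xs j).

Section Prob.
Variables (R : realType) (dO : measure_display) (O : measurableType dO).
Variable P : probability O R.

Definition sig_gen (I : Type) (Q : set I) (f : I -> O -> R) : set (set O) :=
  <<s [set A | exists2 i, Q i & exists2 B : set R, measurable B &
                A = f i @^-1` B] >>.

Definition indep2 (F G : set (set O)) :=
  forall A B, F A -> G B -> P (A `&` B) = (P A * P B)%E.

Definition mutindep (I : eqType) (F : I -> set (set O)) :=
  forall (S : seq I) (A : I -> set O), uniq S ->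
    (forall i, i \in S -> F i (A i)) ->
    P (\big[setI/setT]_(i <- S) A i) = (\prod_(i <- S) P (A i))%E.
End Prob.

Definition allc (R : realType) (O : Type) N K d
   (X : nat -> O -> 'I_K -> 'rV[R]_d) (E : nat -> O -> 'I_N -> 'I_K -> R)
   (q : (nat * 'I_K * 'I_d) + (nat * 'I_N * 'I_K)) (w : O) : R :=
  match q with
  | inl c => X c.1.1 w c.1.2 ord0 c.2
  | inr e => E e.1.1 w e.1.2 e.2
  end.

Definition idx_ctx_lt N K d (a : nat) : set ((nat * 'I_K * 'I_d) + (nat * 'I_N * 'I_K)) :=
  [set q | match q with inl c => (c.1.1 < a)%N | inr e => (e.1.1 < a)%N end].
Definition idx_hist N K d (t : nat) : set ((nat * 'I_K * 'I_d) + (nat * 'I_N * 'I_K)) :=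
  [set q | match q with inl c => (c.1.1 <= t)%N | inr e => (e.1.1 < t)%N end].
Definition idx_ctx_at N K d (t : nat) : set ((nat * 'I_K * 'I_d) + (nat * 'I_N * 'I_K)) :=
  [set q | match q with inl c => c.1.1 = t | inr _ => False end].

(* Main.v *)
Require Import Defs.
From HB Require Import structures.
From mathcomp Require Import all_boot all_order all_algebra.
From mathcomp Require Import all_classical all_reals all_analysis.
From mathcomp Require Import measurable_realfun ring lra.
Import Order.TTheory GRing.Theory Num.Theory.
Local Open Scope ring_scope.
Local Open Scope classical_set_scope.
Set Implicit Arguments.
Unset Strict Implicit.
Unset Printing Implicit Defensive.

(** Pathwise, a round has positive regret only if it explores, if it is counted
    towards [bNk], or if some confidence ellipsoid fails: otherwise the first [N]
    estimated positions of every player are correctly ordered, and Gale-Shapley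
    only looks at those.  With [q = 1 / Delta ^ 2] for the current gap, the first
    two kinds number at most polylog * [q]: the elliptical potential bounds the
    exploration of a batch, and the sums over batches are geometric.  Once
    [Delta <= tau], a counted round is one where two true utilities are
    [4 * tau]-close or where a confidence ellipsoid fails, and a batch ends only
    after about [q] counted rounds, so [q] is at most of the order of [1 / tau ^ 2]
    plus the number of such exceptional rounds.  For [tau = T ^ (- 1 / 3)] their
    expected number is of order [T ^ (2 / 3)] by linearity, so no concentration
    of [delta_min] is needed.

    Confidence ellipsoids fail with probability of order [ln T / T] per round: the
    normalized exponential of the self-normalized residual is a supermartingale
    within a batch and returns to [1] at each of the [O (ln T)] resets.  The
    one-step inequality reduces to a one-dimensional Gaussian average of
    sub-Gaussian bounds. *)

(** * Regularized Gram matrices *)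

(** The gap at which a round is counted is itself random, so the cap on [q] is proved path by path
    and kept affine in the number of exceptional rounds; one expectation then suffices. The value of
    [tau] balances the cap [1 / tau ^ 2] against the expected number of near ties, of order
    [T * tau]. Resets are logarithmically many on every path: each one doubles [q] and demands more
    than [3 * ln T / 16 * q] counted rounds, of which there are at most [T]. This deterministic
    bound lets the supermartingale be restarted at data-dependent times without stopping-time
    arguments. Markov's inequality then closes, because the factor [T ^ 2] inside the logarithm of
    [eta] makes the self-normalized exponential at least [T] wherever a confidence ellipsoid fails.
    Two degenerate cases need care: [sig = 0], reached as a limit of larger noise levels, and
    [eta = 0], where every parameter vanishes. *)

Section LinearAlgebra.
Variables (R : realType) (d : nat).
Implicit Types (u v x : 'rV[R]_d) (V : 'M[R]_d).

Definition bform V u v : R := (u *m V *m v^T) ord0 ord0.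

Lemma mx11_tr (A : 'M[R]_1) : A^T = A.
Proof. by apply/matrixP => i j; rewrite mxE !ord1. Qed.

Lemma ipE u v : ip u v = \sum_k u ord0 k * v ord0 k.
Proof. by rewrite /ip mxE; apply: eq_bigr => k _; rewrite mxE. Qed.

Lemma ipE_sq u : \sum_k u ord0 k ^+ 2 = ip u u.
Proof. by rewrite ipE; apply: eq_bigr => k _; rewrite expr2. Qed.

Lemma ipC u v : ip u v = ip v u.
Proof. by rewrite !ipE; apply: eq_bigr => k _; rewrite mulrC. Qed.

Lemma ip_ge0 u : 0 <= ip u u.
Proof. by rewrite ipE; apply: sumr_ge0 => k _; rewrite -expr2 sqr_ge0. Qed.

Lemma ip_gt0 u : u != 0 -> 0 < ip u u.
Proof.
move=> u0; rewrite lt_neqAle ip_ge0 andbT; apply: contra u0 => /eqP/esym.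
rewrite ipE => /eqP; rewrite psumr_eq0 => [/allP h|k _]; last by rewrite -expr2 sqr_ge0.
apply/eqP/rowP => k; rewrite mxE; apply/eqP.
by have := h k (mem_index_enum k); rewrite mulf_eq0 orbb.
Qed.

Lemma ipBl u v x : ip (u - v) x = ip u x - ip v x.
Proof. by rewrite /ip mulmxBl !mxE. Qed.

Lemma ipBr u v x : ip x (u - v) = ip x u - ip x v.
Proof. by rewrite ipC ipBl ![ip _ x]ipC. Qed.

Lemma ip0l v : ip 0 v = 0. Proof. by rewrite /ip mul0mx mxE. Qed.

Lemma bformC V u v : V^T = V -> bform V u v = bform V v u.
Proof. by move=> hV; rewrite /bform -{1}(mx11_tr (u *m V *m v^T)) !trmx_mul trmxK hV mulmxA. Qed.

Lemma bformDl V u v x : bform V (u + v) x = bform V u x + bform V v x.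
Proof. by rewrite /bform !mulmxDl mxE. Qed.

Lemma bformDr V u v x : bform V x (u + v) = bform V x u + bform V x v.
Proof. by rewrite /bform linearD /= mulmxDr mxE. Qed.

Lemma bformZl V a u v : bform V (a *: u) v = a * bform V u v.
Proof. by rewrite /bform -!scalemxAl mxE. Qed.

Lemma bformZr V a u v : bform V u (a *: v) = a * bform V u v.
Proof. by rewrite /bform linearZ /= -!scalemxAr mxE. Qed.

Lemma bform1 u v : bform 1%:M u v = ip u v.
Proof. by rewrite /bform mulmx1. Qed.

(** The discriminant of the nonnegative quadratic [q]. Since [V] is only semidefinite, the leading
    coefficient [c] may vanish and is treated apart. *)
Lemma bform_CS V u v : V^T = V -> (forall x, 0 <= bform V x x) ->
  bform V u v ^+ 2 <= bform V u u * bform V v v.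
Proof.
move=> hV h.
set a := bform V u u; set b := bform V u v; set c := bform V v v.
have q t : 0 <= a + 2 * t * b + t ^+ 2 * c.
  have := h (u + t *: v).
  rewrite bformDl !bformDr !(bformZl, bformZr) [bform V v u]bformC // -/a -/b -/c.
  by move=> hh; lra.
have a0 : 0 <= a by apply: h.
have c0 : 0 <= c by apply: h.
have [c00|cn0] := eqVneq c 0.
  have [->|b0] := eqVneq b 0; first by rewrite expr0n /= c00 mulr0.
  (* With [c = 0] the polynomial is affine in [t]; this [t] gives it the value [-1]. *)
  have := q (- (a + 1) / (2 * b)).
  rewrite c00 mulr0 addr0.
  have -> : a + 2 * (- (a + 1) / (2 * b)) * b = -1 by field.
  by lra.
have cp : 0 < c by rewrite lt_neqAle eq_sym cn0.
have := q (- b / c).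
have -> : a + 2 * (- b / c) * b + (- b / c) ^+ 2 * c = (a * c - b ^+ 2) / c by field.
by rewrite pmulr_lge0 ?invr_gt0// subr_ge0.
Qed.


(** * Inverse Gram form, rank-one updates and the ridge estimation error *)

Section Gram.
Variables (lam : R) (hlam : 0 < lam).
Implicit Type D : seq ('rV[R]_d * R).

Definition iform D u v := bform (invmx (gram lam D)) u v.

Lemma gram_rcons D p : gram lam (rcons D p) = gram lam D + p.1^T *m p.1.
Proof. by rewrite /gram -cats1 big_cat big_seq1 /= addrA. Qed.

Lemma gram_nil : gram lam [::] = lam%:M :> 'M[R]_d.
Proof. by rewrite /gram big_nil addr0. Qed.

Lemma bformMZ a V u v : bform (a *: V) u v = a * bform V u v.
Proof. by rewrite /bform -scalemxAr -scalemxAl mxE. Qed.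

Lemma outer_bform x u : bform (x^T *m x) u u = ip u x ^+ 2.
Proof.
rewrite /bform mulmxA -[_ *m x *m _]mulmxA mxE big_ord1 expr2.
by rewrite -!/(ip _ _) (ipC x u).
Qed.

Lemma bformMD V V' u v : bform (V + V') u v = bform V u v + bform V' u v.
Proof. by rewrite /bform mulmxDr mulmxDl mxE. Qed.

Lemma gram_bform_ge D u : lam * ip u u <= bform (gram lam D) u u.
Proof.
elim/last_ind: D => [|D p IH].
  by rewrite gram_nil /bform mul_mx_scalar -scalemxAl mxE.
by rewrite gram_rcons bformMD outer_bform (le_trans IH)// lerDl sqr_ge0.
Qed.

Lemma gram_sym D : (gram lam D)^T = gram lam D.
Proof.
elim/last_ind: D => [|D p IH]; first by rewrite gram_nil tr_scalar_mx.
by rewrite gram_rcons linearD /= IH trmx_mul trmxK.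
Qed.

Lemma gram_unit D : gram lam D \in unitmx.
Proof.
rewrite -row_free_unit -kermx_eq0; apply/negPn/negP => /rowV0Pn [v /sub_kermxP hv v0].
have := gram_bform_ge D v; rewrite /bform hv mul0mx mxE.
by rewrite leNgt mulr_gt0// ip_gt0.
Qed.

Lemma gramV_sym D : (invmx (gram lam D))^T = invmx (gram lam D).
Proof. by rewrite trmx_inv gram_sym. Qed.

Lemma iform_gram D u : iform D u u = bform (gram lam D) (u *m invmx (gram lam D)) (u *m invmx (gram lam D)).
Proof.
by rewrite /iform /bform trmx_mul gramV_sym mulmxKV ?gram_unit// mulmxA.
Qed.

Lemma iform_ge0 D u : 0 <= iform D u u.
Proof.
rewrite iform_gram (le_trans _ (gram_bform_ge _ _))//.
by rewrite mulr_ge0 ?ip_ge0// ltW.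
Qed.

Lemma iformC D u v : iform D u v = iform D v u.
Proof. by apply: bformC; exact: gramV_sym. Qed.

Lemma iform_CS D u v : iform D u v ^+ 2 <= iform D u u * iform D v v.
Proof. by apply: bform_CS; [exact: gramV_sym|exact: iform_ge0]. Qed.

(** In effect the inverse Gram matrix is at most [lam^-1] times the identity: for [z] the image of
    [u] under the inverse, [lam * ip z z <= ip z u], and Cauchy-Schwarz between [z] and [u]
    finishes. *)
Lemma iform_le D u : iform D u u <= ip u u / lam.
Proof.
set z := u *m invmx (gram lam D).
have h1 : iform D u u = ip z u by [].
have h2 : lam * ip z z <= iform D u u.
  by rewrite iform_gram; exact: gram_bform_ge.
have h3 : iform D u u ^+ 2 <= ip z z * ip u u.
  rewrite h1 -!bform1; apply: bform_CS => [|x]; first exact: trmx1.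
  by rewrite bform1 ip_ge0.
have h0 := iform_ge0 D u.
have hu := ip_ge0 u.
rewrite ler_pdivlMr//.
have [->|n0] := eqVneq (iform D u u) 0; first by rewrite mul0r.
have p0 : 0 < iform D u u by rewrite lt_neqAle eq_sym n0.
rewrite -(ler_pM2l p0) mulrA -expr2.
apply: (@le_trans _ _ (lam * (ip z z * ip u u))).
  by rewrite mulrC ler_pM2l.
by rewrite mulrA ler_wpM2r.
Qed.

Lemma wnormE D x : wnorm lam D x = Num.sqrt (iform D x x).
Proof. by []. Qed.

(** The matrix determinant lemma: the block matrix with rows [1, x] and [- x^T, V] is factored in
    two ways, through either Schur complement. *)
Lemma det_rank1 V x : V \in unitmx ->
  \det (V + x^T *m x) = \det V * (1 + bform (invmx V) x x).
Proof.
move=> hV.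
have e1 : block_mx 1%:M x (- x^T) V = block_mx (1%:M : 'M[R]_1) 0 (- x^T) 1%:M *m block_mx 1%:M x 0 (V + x^T *m x).
  rewrite mulmx_block !mul1mx !mulmx1 !mul0mx !addr0 mulNmx.
  by rewrite addrC addrK.
have e2 : block_mx 1%:M x (- x^T) V =
    block_mx (1%:M + x *m invmx V *m x^T) (x *m invmx V) 0 1%:M *m block_mx (1%:M : 'M[R]_1) 0 (- x^T) V.
  rewrite mulmx_block !mul1mx !mulmx1 !mul0mx !mulmx0 !add0r mulmxN addrK.
  by rewrite mulmxKV.
move: e1; rewrite e2 => /(congr1 determinant).
rewrite !det_mulmx !det_lblock !det_ublock !det1 !mul1r !mulr1 => <-.
rewrite mulrC; congr (_ * _); rewrite det_mx11 [LHS]mxE; congr (_ + _).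
by rewrite mxE eqxx.
Qed.

Lemma sherman_morrison V x w : V \in unitmx -> bform (invmx V) x x = w -> 1 + w != 0 ->
  invmx (V + x^T *m x) = invmx V - (1 + w)^-1 *: (invmx V *m x^T *m x *m invmx V).
Proof.
move=> hV hw w1.
have hW : V *m invmx V = 1%:M by rewrite mulmxV.
have {}hw : x *m invmx V *m x^T = w%:M by rewrite -hw [LHS]mx11_scalar.
set Z : 'M[R]_d := (X in _ = X); set W : 'M[R]_d := invmx V in hW hw Z *.
have h : (V + x^T *m x) *m Z = 1%:M.
  rewrite /Z mulmxBr !mulmxDl hW -!scalemxAr !mulmxA hW mul1mx.
  rewrite -(mulmxA x^T x W) -(mulmxA x^T (x *m W)) hw mul_mx_scalar -!scalemxAl.
  by rewrite -scalerDr -mulmxA -[X in _ *: (X + _)]scale1r -scalerDl scalerA mulVf// scale1r addrK.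
have hu : V + x^T *m x \in unitmx by case: (mulmx1_unit h).
by rewrite -[RHS]mul1mx -(mulVmx hu) -mulmxA h mulmx1.
Qed.

Lemma gram_det_rcons D p :
  \det (gram lam (rcons D p)) = \det (gram lam D) * (1 + iform D p.1 p.1).
Proof. by rewrite gram_rcons det_rank1 ?gram_unit. Qed.

Lemma gram_det_gt0 D : 0 < \det (gram lam D).
Proof.
elim/last_ind: D => [|D p IH]; first by rewrite gram_nil det_scalar exprn_gt0.
by rewrite gram_det_rcons mulr_gt0// ltr_pwDl// iform_ge0.
Qed.

Lemma iform_rcons D p u v :
  iform (rcons D p) u v = iform D u v - iform D u p.1 * iform D p.1 v / (1 + iform D p.1 p.1).
Proof.
set w := iform D p.1 p.1.
have w1 : 1 + w != 0 by rewrite gt_eqF// ltr_pwDl// iform_ge0.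
have hw : bform (invmx (gram lam D)) p.1 p.1 = w by [].
rewrite /iform (gram_rcons D p) (sherman_morrison (gram_unit _) hw w1).
rewrite bformMD -scaleNr bformMZ mulNr; congr (_ - _).
rewrite [RHS]mulrC; congr (_ * _).
rewrite /bform !mulmxA -mulmxA -[_ *m p.1 *m _]mulmxA -mulmxA !mulmxA.
by rewrite -[X in (X *m _ *m _) _ _]mulmxA -!mulmxA 2!mulmxA mxE big_ord1 !mulmxA.
Qed.

(** For observations [ip th x + e] this is the noise-weighted sum of contexts in the self-normalized
    bound. Writing it through the data makes it a function of the state of the algorithm. *)
Definition resid (th : 'rV[R]_d) D : 'rV[R]_d :=
  \sum_(p <- D) (p.2 - ip th p.1) *: p.1.

Lemma resid_rcons th D p : resid th (rcons D p) = resid th D + (p.2 - ip th p.1) *: p.1.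
Proof. by rewrite /resid -cats1 big_cat big_seq1. Qed.

(** Only the Gram matrix and the weighted sum of contexts enter on the right; this yields both the
    error formula for [thetahat] and the measurability of [resid]. *)
Lemma resid_eq th D : resid th D = \sum_(p <- D) p.2 *: p.1 - th *m (gram lam D - lam%:M).
Proof.
elim/last_ind: D => [|D p IH].
  by rewrite /resid gram_nil !big_nil subrr mulmx0 subrr.
rewrite resid_rcons IH -cats1 big_cat big_seq1 /= cats1 gram_rcons.
have -> : th *m (gram lam D + p.1^T *m p.1 - lam%:M) = th *m (gram lam D - lam%:M) + ip th p.1 *: p.1.
  by rewrite addrAC mulmxDr mulmxA [th *m p.1^T]mx11_scalar mul_scalar_mx.
by rewrite scalerBl opprD addrACA.
Qed.

(** The error vector is [resid th D - lam *: th] times the inverse Gram matrix: a noise part and the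
    ridge bias. *)
Lemma thetahat_err th D x : ip (thetahat lam D - th) x =
  iform D (resid th D) x - lam * iform D th x.
Proof.
rewrite /iform -bformZl -mulN1r -bformZl -bformDl scaleN1r /bform /ip.
congr ((_ *m _) _ _); rewrite /thetahat resid_eq.
have -> : \sum_(p <- D) p.2 *: p.1 - th *m (gram lam D - lam%:M) - lam *: th =
  \sum_(p <- D) p.2 *: p.1 - th *m gram lam D.
  by rewrite mulmxBr mul_mx_scalar opprB addrA [X in X - _]addrAC addrK.
by rewrite mulmxBl mulmxK ?gram_unit.
Qed.

Lemma ler_sqrt_abs (a b : R) : a ^+ 2 <= b -> `|a| <= Num.sqrt b.
Proof. by move=> h; rewrite -sqrtr_sqr ler_wsqrtr. Qed.

(** Cauchy-Schwarz in the inverse Gram form for both parts of the error. For the bias, [iform_le]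
    turns [lam] times the inverse-Gram norm of [th] into at most [sqrt lam * Bth]. *)
Lemma thetahat_conf th D x Bth : vnorm th <= Bth ->
  `| ip (thetahat lam D - th) x | <=
  (Num.sqrt (iform D (resid th D) (resid th D)) + Num.sqrt lam * Bth) * wnorm lam D x.
Proof.
move=> hB; rewrite thetahat_err (le_trans (ler_normB _ _))// mulrDl lerD//.
  by rewrite wnormE -sqrtrM ?iform_ge0// ler_sqrt_abs// iform_CS.
rewrite normrM (ger0_norm (ltW hlam)) wnormE.
apply: (@le_trans _ _ (lam * (Num.sqrt (ip th th / lam) * Num.sqrt (iform D x x)))).
  rewrite ler_pM2l// -sqrtrM ?divr_ge0 ?ip_ge0 ?(ltW hlam)// ler_sqrt_abs//.
  by rewrite (le_trans (iform_CS _ _ _))// ler_wpM2r ?iform_ge0// iform_le.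
have e : lam * (Num.sqrt lam)^-1 = Num.sqrt lam.
  by rewrite -{1}(sqr_sqrtr (ltW hlam)) expr2 mulfK// gt_eqF// sqrtr_gt0.
rewrite mulrA ler_wpM2r ?sqrtr_ge0// sqrtrM ?ip_ge0// sqrtrV ?(ltW hlam)//.
by rewrite mulrCA e mulrC ler_wpM2l ?sqrtr_ge0.
Qed.

(** * Determinant growth and the self-normalized exponential *)

Definition dataB (B : R) D := forall p, p \in D -> vnorm p.1 <= B.

Lemma gram_det_cat D D' : \det (gram lam D) <= \det (gram lam (D ++ D')).
Proof.
elim/last_ind: D' => [|D' p IH]; first by rewrite cats0.
rewrite -rcons_cat gram_det_rcons (le_trans IH)//.
by rewrite ler_peMr ?(ltW (gram_det_gt0 _))// lerDl iform_ge0.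
Qed.

Let evec (a : 'I_d) : 'rV[R]_d := delta_mx ord0 a.

(* Lagrange's identity: [|x|^2 I - x^T x] is the sum of the squares of the
   vectors [x_a e_b - x_b e_a], so [x^T x] is completed to [B^2 I] by rank-one terms. *)
Definition completion (B : R) x : seq ('rV[R]_d * R) :=
  [seq (Num.sqrt (B ^+ 2 - ip x x) *: evec a, 0) | a <- index_enum 'I_d] ++
  [seq (Num.sqrt 2^-1 *: (x ord0 ab.1 *: evec ab.2 - x ord0 ab.2 *: evec ab.1), 0)
     | ab <- index_enum ('I_d * 'I_d)%type].

Lemma completionP B x : vnorm x <= B ->
  x^T *m x + \sum_(p <- completion B x) (p.1^T *m p.1) = (B ^+ 2)%:M.
Proof.
move=> hx.
have hB : ip x x <= B ^+ 2.
  by rewrite -(sqr_sqrtr (ip_ge0 x)) ler_sqr ?nnegrE ?sqrtr_ge0// (le_trans _ hx)// sqrtr_ge0.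
have scaled_outer (c : R) u a b : ((c *: u)^T *m (c *: u)) a b = c ^+ 2 * (u ord0 a * u ord0 b).
  by rewrite mxE big_ord1 !mxE mulrACA.
have evecE a b : evec a ord0 b = (b == a)%:R by rewrite mxE eqxx.
have sumE (f : 'I_d -> R) a : \sum_k f k * (a == k)%:R = f a.
  rewrite (bigD1 a)//= eqxx mulr1 big1 ?addr0// => k; rewrite eq_sym => /negbTE ->.
  by rewrite mulr0.
apply/matrixP => a b.
rewrite big_cat !big_map /= !mxE !summxE big_ord1 !mxE.
under eq_bigr => k _ do rewrite scaled_outer sqr_sqrtr ?subr_ge0// !evecE.
rewrite -mulr_sumr [X in _ + (_ * X + _)](sumE (fun k => (a == k)%:R)).
under [X in _ + (_ + X)]eq_bigr => k _ do
  rewrite scaled_outer sqr_sqrtr ?invr_ge0//.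
rewrite -mulr_sumr.
rewrite -(pair_big xpredT xpredT (fun k l => (x ord0 k *: evec l - x ord0 l *: evec k) ord0 a * (x ord0 k *: evec l - x ord0 l *: evec k) ord0 b)) /=.
(* The sum runs over ordered pairs, so every square occurs twice; the factor [2] cancels the weight
   [sqrt 2^-1] in [completion]. *)
have -> : \sum_k \sum_l (x ord0 k *: evec l - x ord0 l *: evec k) ord0 a * (x ord0 k *: evec l - x ord0 l *: evec k) ord0 b =
  2 * (ip x x * (a == b)%:R - x ord0 a * x ord0 b).
  transitivity (\sum_k \sum_l (x ord0 k ^+ 2 * ((b == l)%:R * (a == l)%:R)
     - x ord0 k * (a == k)%:R * (x ord0 l * (b == l)%:R)
     - x ord0 k * (b == k)%:R * (x ord0 l * (a == l)%:R) + (b == k)%:R * (a == k)%:R * x ord0 l ^+ 2)).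
     apply: eq_bigr => k _; apply: eq_bigr => l _; rewrite !mxE eqxx /=; ring.
  under eq_bigr => k _ do rewrite !big_split /= !sumrN -!mulr_sumr !sumE ipE_sq.
  rewrite !big_split /= !sumrN -!mulr_suml !sumE.
  by rewrite ipE_sq (eq_sym b a); ring.
by rewrite mulrA mulVf ?pnatr_eq0// mul1r -[RHS]mulr_natr; ring.
Qed.

Lemma lamD_ge0 (B : R) (m : nat) : 0 <= lam + m%:R * B ^+ 2.
Proof. by rewrite addr_ge0 ?(ltW hlam)// mulr_ge0 ?ler0n// exprn_even_ge0. Qed.

Lemma lamR_gt0 (B : R) (m : nat) : 0 < 1 + m%:R * B ^+ 2 / lam.
Proof.
by rewrite ltr_pwDl// divr_ge0 ?(ltW hlam)// mulr_ge0 ?ler0n// exprn_even_ge0.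
Qed.

(** Appending the completion of every datum can only increase the determinant, and the Gram matrix
    obtained is scalar. This takes the place of the trace-determinant inequality. *)
Lemma gram_det_le B D : dataB B D ->
  \det (gram lam D) <= (lam + (size D)%:R * B ^+ 2) ^+ d.
Proof.
move=> hD; set D' := flatten [seq completion B p.1 | p <- D].
apply: (le_trans (gram_det_cat D D')); rewrite /gram big_cat /= /D' big_flatten big_map -big_split /=.
rewrite (eq_big_seq (fun _ => (B ^+ 2)%:M)) => [|p pD]; last first.
  by rewrite completionP// hD.
rewrite big_const_seq count_predT iter_addr addr0 -scaler_nat scale_scalar_mx.
by rewrite -raddfD /= det_scalar.
Qed.

(* Elliptical potential: each exploration multiplies the determinant by at least [1 + xi^2]. *)
Definition dataX (xi : R) D := (1 + xi ^+ 2) ^+ size D * lam ^+ d <= \det (gram lam D).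

Lemma dataX_nil xi : dataX xi [::].
Proof. by rewrite /dataX expr0 mul1r gram_nil det_scalar. Qed.

Lemma dataX_rcons xi D p : 0 <= xi -> xi < wnorm lam D p.1 -> dataX xi D -> dataX xi (rcons D p).
Proof.
move=> xi0 hx hD; rewrite /dataX size_rcons exprSr gram_det_rcons mulrAC.
have h0 : 0 <= 1 + xi ^+ 2 by rewrite addr_ge0 ?sqr_ge0.
apply: ler_pM => //; first by rewrite mulr_ge0 ?exprn_ge0// ltW.
rewrite lerD2l -(sqr_sqrtr (iform_ge0 D p.1)) ler_sqr ?nnegrE ?sqrtr_ge0//.
exact: ltW.
Qed.

Lemma ln_le_sub1 (y : R) : 0 < y -> ln y <= y - 1.
Proof.
move=> y0; have := @le_ln1Dx R (y - 1); rewrite [1 + _]addrC subrK; apply; lra.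
Qed.

(** Comparing the two determinant bounds gives [size D * ln (1 + xi ^ 2) <= d * ln (1 + T * B ^ 2 /
    lam)]. The inequality [y / (1 + y) <= ln (1 + y)] holds for every [xi], small or large, and its
    reciprocal is the factor [1 + 1 / xi ^ 2]. *)
Lemma data_size_le B xi D (T : nat) : 0 < xi -> dataB B D -> dataX xi D -> (size D <= T)%N ->
  (size D)%:R <= d%:R * ln (1 + T%:R * B ^+ 2 / lam) * (1 + (xi ^+ 2)^-1).
Proof.
move=> xi0 hB hX hT; have xi2 : 0 < xi ^+ 2 by rewrite exprn_gt0.
set n := size D in hX hT *.
have h1 : (1 + xi ^+ 2) ^+ n <= (1 + T%:R * B ^+ 2 / lam) ^+ d.
  rewrite -(ler_pM2r (exprn_gt0 d hlam)) -exprMn mulrDl mul1r mulfVK ?gt_eqF//.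
  apply: (le_trans hX); apply: (le_trans (gram_det_le hB)).
  apply: lerXn2r; rewrite ?nnegrE ?lamD_ge0//.
  by rewrite lerD2l ler_wpM2r ?sqr_ge0// ler_nat.
have p1 : 0 < 1 + xi ^+ 2 by rewrite addr_gt0.
have p2 := lamR_gt0 B T.
have h2 : n%:R * ln (1 + xi ^+ 2) <= d%:R * ln (1 + T%:R * B ^+ 2 / lam).
  by rewrite ![_%:R * ln _]mulr_natl -!lnXn// ler_ln ?posrE ?exprn_gt0.
have h3 : xi ^+ 2 / (1 + xi ^+ 2) <= ln (1 + xi ^+ 2).
  have := @ln_le_sub1 (1 + xi ^+ 2)^-1; rewrite invr_gt0 => /(_ p1).
  rewrite lnV ?posrE// lerNl; apply: le_trans.
  by rewrite le_eqVlt; apply/orP; left; apply/eqP; field; rewrite gt_eqF.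
have h4 : n%:R * (xi ^+ 2 / (1 + xi ^+ 2)) <= d%:R * ln (1 + T%:R * B ^+ 2 / lam).
  by apply: le_trans h2; rewrite ler_wpM2l.
have -> : 1 + (xi ^+ 2)^-1 = (xi ^+ 2 / (1 + xi ^+ 2))^-1 by field; rewrite ?gt_eqF.
by rewrite ler_pdivlMr// divr_gt0.
Qed.

(* The mixture supermartingale of the self-normalized bound. *)
Definition selfnorm (sg : R) th D : R :=
  Num.sqrt (lam ^+ d / \det (gram lam D)) * expR (iform D (resid th D) (resid th D) / (2 * sg ^+ 2)).

Lemma selfnorm_ge0 sg th D : 0 <= selfnorm sg th D.
Proof. by rewrite mulr_ge0 ?sqrtr_ge0 ?expR_ge0. Qed.

Lemma selfnorm_nil sg th : selfnorm sg th [::] = 1.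
Proof.
rewrite /selfnorm gram_nil det_scalar mulfV ?sqrtr1 ?mul1r ?gt_eqF ?exprn_gt0//.
by rewrite /resid big_nil /iform /bform mul0mx mul0mx mxE mul0r expR0.
Qed.

(** The determinant contributes [1 + w], and the rank-one update of the inverse combines the
    quadratic terms over [1 + w]. The resulting ratio is the exponential of a quadratic in [e], in
    the form averaged by [quadratic_subgaussian]. *)
Lemma selfnorm_rcons sg th D x e : 0 < sg ->
  let w := iform D x x in let m := iform D (resid th D) x in
  selfnorm sg th (rcons D (x, ip th x + e)) =
  selfnorm sg th D * (expR ((2 * e * m + e ^+ 2 * w - m ^+ 2) / (2 * sg ^+ 2 * (1 + w))) / Num.sqrt (1 + w)).
Proof.
move=> sg0 w m; have w0 : 0 <= w by apply: iform_ge0.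
have w1 : 0 < 1 + w by rewrite ltr_pwDl.
rewrite /selfnorm gram_det_rcons /= -/w.
have -> : Num.sqrt (lam ^+ d / (\det (gram lam D) * (1 + w))) =
   Num.sqrt (lam ^+ d / \det (gram lam D)) / Num.sqrt (1 + w).
  rewrite invfM mulrA [LHS]sqrtrM ?(sqrtrV (ltW w1))//.
  by rewrite divr_ge0 ?exprn_ge0 ?(ltW hlam) ?(ltW (gram_det_gt0 _)).
rewrite resid_rcons /= [ip th x + e]addrC addrK.
have -> : iform (rcons D (x, e + ip th x)) (resid th D + e *: x) (resid th D + e *: x) / (2 * sg ^+ 2) =
  iform D (resid th D) (resid th D) / (2 * sg ^+ 2) +
   (2 * e * m + e ^+ 2 * w - m ^+ 2) / (2 * sg ^+ 2 * (1 + w)).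
  rewrite iform_rcons /= -/w.
  rewrite {1 2 3}/iform !bformDl !bformDr !(bformZl, bformZr) -!/(iform _ _ _).
  rewrite (iformC D x (resid th D)) -/m -/w.
  field; rewrite ?gt_eqF//.
rewrite expRD; ring.
Qed.

(** With [a = 1 + T * B ^ 2 / lam], the determinant factor is at least [a ^ (- d / 2)] and the
    exponential at least [(a * T ^ 2) ^ (d / 2)]. Their product is [T ^ d], which dominates [T] as
    [d > 0]. *)
Lemma selfnorm_large sg th D B (T : nat) : 0 < sg -> (0 < T)%N -> (0 < d)%N ->
  dataB B D -> (size D <= T)%N ->
  sg ^+ 2 * (d%:R * ln ((1 + T%:R * B ^+ 2 / lam) * T%:R ^+ 2)) < iform D (resid th D) (resid th D) ->
  T%:R <= selfnorm sg th D.
Proof.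
move=> sg0 T0 d0 hB hT hlt; set Q := iform D _ _ in hlt *.
have TR : 0 < T%:R :> R by rewrite ltr0n.
have p2 := lamR_gt0 B T.
set a := 1 + T%:R * B ^+ 2 / lam in hlt p2 *.
have h1 : \det (gram lam D) <= (lam * a) ^+ d.
  apply: (le_trans (gram_det_le hB)).
  have -> : lam * a = lam + T%:R * B ^+ 2 by rewrite /a; field; rewrite gt_eqF.
  by apply: lerXn2r; rewrite ?nnegrE ?lamD_ge0// lerD2l ler_wpM2r ?sqr_ge0// ler_nat.
have h2 : (a ^+ d)^-1 <= lam ^+ d / \det (gram lam D).
  rewrite ler_pdivlMr ?gram_det_gt0// mulrC ler_pdivrMr ?exprn_gt0//.
  by rewrite -exprMn.
have h3 : d%:R / 2 * ln (a * T%:R ^+ 2) <= Q / (2 * sg ^+ 2).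
  rewrite ler_pdivlMr ?mulr_gt0 ?exprn_gt0//; apply: le_trans (ltW hlt).
  by rewrite le_eqVlt; apply/orP; left; apply/eqP; field.
have h4 : Num.sqrt (a ^+ d) * T%:R ^+ d <= expR (Q / (2 * sg ^+ 2)).
  apply: le_trans (_ : expR (d%:R / 2 * ln (a * T%:R ^+ 2)) <= _); last by rewrite ler_expR.
  have -> : Num.sqrt (a ^+ d) * T%:R ^+ d = Num.sqrt ((a * T%:R ^+ 2) ^+ d).
    by rewrite exprMn sqrtrM ?exprn_ge0 ?ltW// exprAC sqrtr_sqr ger0_norm// exprn_ge0.
  have aT : 0 < a * T%:R ^+ 2 by rewrite mulr_gt0// exprn_gt0.
  rewrite le_eqVlt; apply/orP; left; apply/eqP.
  rewrite -[LHS](ger0_norm (sqrtr_ge0 _)) -sqrtr_sqr sqr_sqrtr ?exprn_ge0 ?(ltW aT)//.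
  rewrite -[RHS](ger0_norm (expR_ge0 _)) -sqrtr_sqr; congr Num.sqrt.
  rewrite -expRM_natl -{1}(lnK (aT : _ \is Num.pos)) -expRM_natl; congr expR.
  by field.
apply: (@le_trans _ _ (T%:R ^+ d)).
  by rewrite ler_eXnr// ler1n.
rewrite /selfnorm -/Q; apply: le_trans (_ : Num.sqrt (a ^+ d)^-1 * (Num.sqrt (a ^+ d) * T%:R ^+ d) <= _).
  rewrite mulrA sqrtrV ?exprn_ge0 ?(ltW p2)// mulVf ?mul1r//.
  by rewrite gt_eqF// sqrtr_gt0 exprn_gt0.
by apply: ler_pM => //; rewrite ?sqrtr_ge0 ?mulr_ge0 ?sqrtr_ge0 ?exprn_ge0 ?ler0n// ler_wsqrtr.
Qed.

End Gram.
End LinearAlgebra.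

(** * Gale-Shapley with estimated utilities *)

Section GaleShapley.
Variables (R : realType) (N K : nat) (rk : 'I_K -> 'I_N -> nat).
Hypothesis hrk : forall j, injective (rk j).
Variable (Uh : 'I_N -> 'I_K -> R).
Local Notation better := (pbetter Uh).
Local Notation prop := (proposal Uh).
Local Notation hold := (held rk Uh).
Local Notation step := (ga_step rk Uh).
Implicit Type rej : {set 'I_N * 'I_K}.

Lemma better_irr i j : better i j j = false.
Proof. by rewrite /pbetter ltxx ltnn andbF. Qed.

Lemma better_total i j j' : j != j' -> better i j j' || better i j' j.
Proof.
rewrite /pbetter => jj; case: (ltgtP (Uh i j) (Uh i j')) => //= _.
by rewrite -neq_ltn.
Qed.

Lemma better_trans i j2 j1 j3 : better i j1 j2 -> better i j2 j3 -> better i j1 j3.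
Proof.
rewrite /pbetter => /orP[h1|/andP[/eqP e1 h1]] /orP[h2|/andP[/eqP e2 h2]].
- by rewrite (lt_trans h2 h1).
- by rewrite -e2 h1.
- by rewrite e1 h2.
- by rewrite e1 e2 eqxx (ltn_trans h1 h2) orbT.
Qed.

(** The position of [j], from zero, in the estimated list of [i], ties broken by index. *)
Definition nbetter i j := #|[pred j' | better i j' j]|.

Lemma nbetter_lt i j j' : better i j' j -> (nbetter i j' < nbetter i j)%N.
Proof.
move=> h; apply: proper_card; apply/properP; split.
  by apply/fintype.subsetP => k; rewrite !inE => hk; exact: better_trans hk h.
by exists j'; rewrite !inE ?h ?better_irr.
Qed.

Lemma propP rej i j : prop rej i = Some j ->
  (i, j) \notin rej /\ forall j', (i, j') \notin rej -> j' = j \/ better i j j'.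
Proof.
rewrite /proposal; case: pickP => // k /andP[h1 /forallP h2] [<-]; split=> // j' hj'.
by have := h2 j'; rewrite hj' /= => /orP[/eqP ->|]; [left|right].
Qed.

Lemma prop_uniq rej i j : (i, j) \notin rej ->
  (forall j', (i, j') \notin rej -> j' = j \/ better i j j') -> prop rej i = Some j.
Proof.
move=> h1 h2; rewrite /proposal; case: pickP => [k /andP[k1 /forallP k2]|/(_ j)].
  have [->//|bjk] := h2 _ k1.
  have := k2 j; rewrite h1 /= => /orP[/eqP ->//|bkj].
  by have := better_trans bjk bkj; rewrite better_irr.
move=> /negP[]; rewrite h1 /=; apply/forallP => j'; apply/implyP => /h2 [->|->].
  by rewrite eqxx.
by rewrite orbT.
Qed.

Lemma prop_ex rej i j : (i, j) \notin rej -> exists k, prop rej i = Some k.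
Proof.
move=> h; pose k := [arg min_(k < j | (i, k) \notin rej) nbetter i k].
exists k; rewrite /k; case: arg_minnP => // {}k hk kmin; apply: prop_uniq => // j' hj'.
have [->|/(better_total i)/orP[//|b]] := eqVneq k j'; [by left|by right|].
by have := kmin _ hj'; rewrite leqNgt nbetter_lt.
Qed.

Lemma holdP rej i j : hold rej j = Some i ->
  prop rej i = Some j /\ forall i', prop rej i' = Some j -> (rk j i <= rk j i')%N.
Proof.
rewrite /held; case: pickP => // k /andP[/eqP h1 /forallP h2] [<-]; split=> // i' hi'.
by have := h2 i'; rewrite hi' eqxx.
Qed.

Lemma hold_ex rej i j : prop rej i = Some j ->
  exists i', hold rej j = Some i' /\ (rk j i' <= rk j i)%N.
Proof.
move=> h; have [k hk kmin] : exists2 k, prop rej k == Some j & forall i', prop rej i' == Some j -> (rk j k <= rk j i')%N.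
  have h' : prop rej i == Some j by apply/eqP.
  by case: (@arg_minnP _ i (fun k => prop rej k == Some j) (rk j) h') => k ? ?; exists k.
rewrite /held; case: pickP => [k' /andP[_ /forallP k2]|/(_ k)].
  by exists k'; split=> //; have := k2 i; rewrite h eqxx.
move=> /negP[]; rewrite hk; apply/forallP => i'; apply/implyP; exact: kmin.
Qed.

Definition rejinv rej := forall i j, (i, j) \in rej ->
  exists i', hold rej j = Some i' /\ (rk j i' < rk j i)%N.

Lemma in_step rej i j : (i, j) \in step rej =
  ((i, j) \in rej) || (prop rej i == Some j) && (hold rej j != Some i).
Proof. by rewrite !inE. Qed.

Lemma rejinv_step rej : rejinv rej -> rejinv (step rej).
Proof.
move=> h.
(* An arm never trades down: the player it holds is not rejected, hence proposes to it again in the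
   next round. *)
have keep i' j : hold rej j = Some i' -> exists i2, hold (step rej) j = Some i2 /\ (rk j i2 <= rk j i')%N.
  move=> hj; have [pj hmin] := holdP hj; have [nr best] := propP pj.
  apply: hold_ex; apply: prop_uniq.
    by rewrite in_step negb_or nr hj eqxx andbF.
  by move=> j'; rewrite in_step negb_or => /andP[/best].
move=> i j; rewrite in_step => /orP[/h [i' [hi' lt]]|/andP[/eqP pi hn]].
  have [i2 [? le2]] := keep _ _ hi'; exists i2; split=> //; exact: leq_ltn_trans lt.
have [i' [hi' le']] := hold_ex pi.
have [i2 [? le2]] := keep _ _ hi'; exists i2; split=> //; apply: (leq_ltn_trans le2).
rewrite ltn_neqAle le' andbT; apply: contra hn => /eqP/hrk <-.
by rewrite hi'.
Qed.

Lemma rejinv_iter n : rejinv (iter n step finset.set0).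
Proof. by elim: n => [|n IH] /=; [move=> i j; rewrite inE|exact: rejinv_step]. Qed.

Arguments rejinv_iter : clear implicits.

(** Each arm that rejected [i] holds some other player, and distinct arms hold distinct players
    because a player proposes to one arm only. This injects the rejecting arms into the other
    [N - 1] players. *)
Lemma rejinv_card rej i : rejinv rej -> (#|[pred j | (i, j) \in rej]| < N)%N.
Proof.
move=> h; pose f j := odflt i (hold rej j).
have hf j : (i, j) \in rej -> hold rej j = Some (f j) /\ f j != i.
  move=> /h [i' [e lt]]; rewrite /f e /=; split=> //.
  by apply: contraTneq lt => ->; rewrite ltnn.
have inj : {in [pred j | (i, j) \in rej] &, injective f}.
  move=> j1 j2; rewrite !inE => /hf [e1 _] /hf [e2 _] e.
  by have [p1 _] := holdP e1; have [p2 _] := holdP e2; move: p1; rewrite e p2 => -[].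
rewrite -(card_in_imset inj); apply: (@leq_ltn_trans #|predC1 i|).
  by apply: subset_leq_card; apply/fintype.subsetP => k /imsetP [j]; rewrite !inE => /hf [_ ?] ->.
by rewrite cardC1 card_ord prednK// (leq_trans _ (ltn_ord i)).
Qed.

(** Every arm ranked above the current proposal has already rejected [i]. This is why comparing the
    top [N + 1] estimates is enough in [gapcond]. *)
Lemma nbetter_prop rej i j : rejinv rej -> prop rej i = Some j -> (nbetter i j < N)%N.
Proof.
move=> h /propP [_ best]; apply: leq_ltn_trans (rejinv_card i h).
apply: subset_leq_card; apply/fintype.subsetP => k; rewrite !inE => bk.
apply/negPn/negP => /best [ekj|bjk]; first by rewrite ekj better_irr in bk.
by have := better_trans bk bjk; rewrite better_irr.
Qed.

(** Until the rejection set is stationary each step adds a pair; after [N * K] steps it is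
    stationary or contains all pairs, and is then stationary too. *)
Lemma iter_step_fix : step (iter (N * K) step finset.set0) = iter (N * K) step finset.set0.
Proof.
have sub rej : rej \subset step rej by apply: finset.subsetUl.
have h n : (n <= #|iter n step finset.set0|)%N \/ step (iter n step finset.set0) = iter n step finset.set0.
  elim: n => [|n [IH|IH]] /=; [by left| |by right; rewrite !IH].
  set A := iter n step _ in IH *.
  have [e|ne] := eqVneq (step A) A; first by right; rewrite !e.
  left; apply: (leq_ltn_trans IH); apply: proper_card.
  by rewrite finset.properEneq eq_sym ne sub.
have [h1|//] := h (N * K)%N; set A := iter _ _ _ in h1 *.
have -> : A = finset.setT.
  by apply/eqP; rewrite eqEcard finset.subsetT cardsT card_prod !card_ord.
by apply/eqP; rewrite finset.eqEsubset finset.subsetT sub.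
Qed.

Hypothesis hKN : (N <= K)%N.

Let rej0 := iter (N * K) step finset.set0.

(** Fewer than [N <= K] rejections leave [i] an arm to propose to, and at the fixed point an unheld
    proposal would already be a rejection. *)
Lemma GS_prop i : exists j, GS rk Uh i = Some j /\ prop rej0 i = Some j /\ hold rej0 j = Some i.
Proof.
have [j0 hj0] : exists j0, (i, j0) \notin rej0.
  apply/existsP; apply: contraT; rewrite negb_exists => /forallP h.
  have := rejinv_card i (rejinv_iter (N * K)%N); rewrite -/rej0.
  rewrite (@eq_card _ _ predT) => [|j]; last by rewrite !inE; exact: (negPn (h j)).
  by rewrite card_ord ltnNge hKN.
have [j hj] := prop_ex hj0; exists j; rewrite ffunE -/rej0 hj.
have -> : hold rej0 j = Some i; last by rewrite eqxx.
apply/eqP; apply: contraT => hn; have [+ _] := propP hj.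
by rewrite -{1}[rej0]iter_step_fix -/rej0 in_step hj eqxx hn orbT.
Qed.

Lemma GS_matching : is_matching (GS rk Uh).
Proof.
apply/forallP => i; apply/forallP => i'; apply/forallP => j; apply/implyP => /andP[/eqP h /eqP h'].
have [j1 [e1 [_ p1]]] := GS_prop i; have [j2 [e2 [_ p2]]] := GS_prop i'.
move: h h'; rewrite e1 e2 => -[ej1] [ej2]; move: p1 p2; rewrite ej1 ej2 => -> [->].
by [].
Qed.

(* Only the comparisons at the first [N] positions of each estimated list matter, since a
   player is rejected by at most [N - 1] arms. *)
Variable U : 'I_N -> 'I_K -> R.
Hypothesis agree : forall i j j', better i j j' -> (nbetter i j < N)%N -> U i j' < U i j.

Lemma prop_best rej i j j' : rejinv rej -> prop rej i = Some j -> better i j j' -> U i j' < U i j.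
Proof. by move=> h1 h2 h3; apply: agree => //; exact: nbetter_prop h2. Qed.

Lemma partnerP (m : matching N K) i j : is_matching m -> m i = Some j -> partner m j = Some i.
Proof.
move=> /forallP hm e; rewrite /partner; case: pickP => [k /eqP ek|/(_ i)]; last by rewrite e eqxx.
by have /forallP/(_ i)/forallP/(_ j) := hm k; rewrite ek e eqxx /= => /eqP ->.
Qed.

(** An unmatched player leaves, by pigeonhole and [N <= K], an unmatched arm, and the two block.
    Needed because an unmatched player has value [0], which can exceed its utilities. *)
Lemma stable_full (m : matching N K) i : stable rk U m -> m i != None.
Proof.
move=> /andP[hm /forallP hb]; apply/eqP => e.
have [j hj] : exists j, partner m j = None.
  apply: contrapT => /forallNP h.
  have h1 j : exists i', partner m j = Some i'.
    by move: (h j); case: (partner m j) => // i' _; exists i'.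
  have hp j i' : partner m j = Some i' -> m i' = Some j.
    by rewrite /partner; case: pickP => // k /eqP ek [<-].
  pose f j := odflt i (partner m j).
  have hf j : m (f j) = Some j.
    by have [i' hi'] := h1 j; rewrite /f hi' /=; exact: hp.
  have finj : injective f by move=> j1 j2 ee; have := hf j1; rewrite ee hf => -[].
  have : (#|codom f| <= #|predC1 i|)%N.
    apply: subset_leq_card; apply/fintype.subsetP => k /codomP [j ->]; rewrite !inE.
    by apply/eqP => efi; have := hf j; rewrite efi e.
  rewrite card_codom// card_ord cardC1 card_ord => hle.
  have N0 : (0 < N)%N by apply: leq_trans (ltn_ord i).
  by have := leq_trans hKN hle; rewrite -{1}(prednK N0) ltnn.
by have /forallP/(_ j) := hb i; rewrite hj /arm_prefers /player_prefers e.
Qed.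

(** Induction on the rounds: if [i] is rejected by its stable partner [j] in favour of [i'], then
    [i'] has not yet been rejected by its own stable partner, so it prefers [j] and blocks. True and
    estimated orders are compared only at a current proposal, where [agree] applies. *)
Lemma stable_not_rej (m : matching N K) n i j : stable rk U m ->
  (i, j) \in iter n step finset.set0 -> m i != Some j.
Proof.
move=> hs; elim: n i j => [|n IH] i j; first by rewrite inE.
have hI := rejinv_iter n; rewrite /= in_step; set rej := iter n step _ in IH hI *.
move=> /orP[/IH//|/andP[/eqP hp hn]]; apply/eqP => mi.
have [i' [hi' le']] := hold_ex hp.
have ii' : i' != i by apply: contra hn => /eqP <-; rewrite hi'.
have lt' : (rk j i' < rk j i)%N by rewrite ltn_neqAle le' (inj_eq (@hrk j)) ii'.
have [hp' _] := holdP hi'; have [_ best] := propP hp'.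
have /negP := stable_full i' hs; case em : (m i') => [j'|//] _.
have hj' : (i', j') \notin rej by apply/negP => /IH; rewrite em eqxx.
have /andP[hm /forallP/(_ i')/forallP/(_ j)] := hs.
rewrite (partnerP hm mi) /= lt' em /= => /negP; apply.
case: (best _ hj') => [ejj|/(prop_best hI hp')//].
have /forallP/(_ i)/forallP/(_ i')/forallP/(_ j) := hm.
by rewrite mi em ejj eqxx /= => /eqP e; rewrite e eqxx in ii'.
Qed.

Lemma GS_opt (m : matching N K) i : stable rk U m -> mval U i m <= mval U i (GS rk Uh).
Proof.
move=> hs; have [j [e [hp _]]] := GS_prop i; rewrite /mval e.
have := stable_full i hs; case em : (m i) => [j'|//] _.
have [_ best] := propP hp.
have /best [-> //|/(prop_best (rejinv_iter _) hp)/ltW//] : (i, j') \notin rej0.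
by apply/negP => /(stable_not_rej hs); rewrite em eqxx.
Qed.

Lemma GS_stable : stable rk U (GS rk Uh).
Proof.
rewrite /stable GS_matching; apply/forallP => i; apply/forallP => j; apply/negP => /andP[ha hb].
have [j0 [e [hp _]]] := GS_prop i; move: hb; rewrite e /= => hb.
have [_ best] := propP hp.
have : (i, j) \in rej0.
  apply/negPn/negP => /best [ej|/(prop_best (rejinv_iter _) hp) hlt].
    by move: hb; rewrite ej ltxx.
  by move: (lt_trans hb hlt); rewrite ltxx.
move=> /(rejinv_iter (N * K)%N) [i' [hi' lt']].
have [j1 [e1 [hp1 _]]] := GS_prop i'; have [hp2 _] := holdP hi'.
have ej : GS rk Uh i' = Some j.
  by rewrite e1; move: hp2; rewrite -/rej0 hp1.
by move: ha; rewrite (partnerP GS_matching ej) /= ltnNge ltnW.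
Qed.

(** Optimality bounds the maximum over stable matchings; stability of the output rules out the
    default value [0] of [Ustar]. *)
Lemma Ustar_GS i : Ustar rk U i <= mval U i (GS rk Uh).
Proof.
rewrite /Ustar; case: pickP => [m0 hm0|/(_ (GS rk Uh))]; last by rewrite GS_stable.
by apply: bigmax_le => [|m hm]; exact: GS_opt.
Qed.

End GaleShapley.

(** * Gaps between sorted estimates *)

Section SortedGaps.
Variable R : realType.
Local Notation ge := (fun a b : R => b <= a).

(** In a nonincreasing list the elements of an upward closed predicate form a prefix. Sorted values
    are thereby located by counting arms, without tracking the sorting permutation. *)
Lemma sorted_nth_up (p : pred R) (s : seq R) k : (forall a b, p b -> b <= a -> p a) ->
  sorted ge s -> (k < size s)%N -> p (nth 0 s k) = (k < count p s)%N.
Proof.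
move=> hp; elim: s k => [//|a s IH] k /= hs hk.
have ge_tr : transitive ge by move=> y x z h1 h2; exact: le_trans h2 h1.
have [pa|npa] := boolP (p a).
  case: k hk => [|k] hk //=; rewrite add1n ltnS; apply: IH => //; exact: path_sorted hs.
have hn b : b \in a :: s -> ~~ p b.
  rewrite in_cons => /orP[/eqP -> //|bs]; apply: contra npa => pb; apply: hp pb _.
  by have /allP := order_path_min ge_tr hs; apply.
have -> : count p s = 0%N.
  by apply/eqP; rewrite -leqn0 leqNgt -has_count; apply/hasPn => b bs; apply: hn; rewrite in_cons bs orbT.
by rewrite ltn0; apply/negbTE/hn; apply: mem_nth.
Qed.

Variables (N K d : nat) (lam : R) (s : bstate R N d) (xs : 'I_K -> 'rV[R]_d).
Let Uh := Uhat lam s xs.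
Let srt i := sort ge [seq Uh i j | j <- enum 'I_K].

Lemma srt_sorted i : sorted ge (srt i).
Proof. by apply: sort_sorted => a b; exact: le_total. Qed.

Lemma size_srt i : size (srt i) = K.
Proof. by rewrite size_sort size_map size_enum_ord. Qed.

Lemma count_srt i p : count p (srt i) = #|[pred j | p (Uh i j)]|.
Proof.
rewrite count_sort count_map -size_filter cardE; congr size.
by rewrite enumT; apply: eq_filter.
Qed.

Lemma Ngapcond_gap i j j' : ~~ gapcond lam s xs -> pbetter Uh i j j' -> (nbetter Uh i j < N)%N ->
  2 * bDelta s < Uh i j - Uh i j'.
Proof.
move=> hg hb hn; set v := Uh i j; set v' := Uh i j'.
have le' : v' <= v.
  by move: hb => /orP[/ltW//|/andP[/eqP e _]]; rewrite /v e.
have jj' : j != j' by apply: contraTneq hb => ->; rewrite better_irr.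
pose l := #|[pred k | v < Uh i k]|.
have lN : (l < N)%N.
  apply: leq_ltn_trans hn; apply: subset_leq_card; apply/fintype.subsetP => k.
  by rewrite !inE /pbetter => ->.
have l2 : (l.+2 <= #|[pred k | (v' <= Uh i k)%R]|)%N.
  have <- : #|[predU1 j & [predU1 j' & [pred k | v < Uh i k]]]| = l.+2.
    rewrite !cardU1 !inE negb_or jj' /= -/v ltxx /= -/v'.
    by rewrite ltNge le'.
  apply: subset_leq_card; apply/fintype.subsetP => k; rewrite !inE.
  move=> /orP[/eqP -> //|/orP[/eqP -> //|/ltW h]].
  exact: le_trans h.
have l1K : (l.+1 < K)%N.
  by apply: leq_trans l2 _; apply: (leq_trans (max_card _)); rewrite card_ord.
have h1 : nth 0 (srt i) l <= v.
  have := @sorted_nth_up (fun b => v < b) (srt i) l (fun a b h1 h2 => lt_le_trans h1 h2) (srt_sorted i).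
  by rewrite size_srt => /(_ (ltnW l1K)); rewrite count_srt ltnn => /negbT; rewrite -leNgt.
have h2 : v' <= nth 0 (srt i) l.+1.
  have := @sorted_nth_up (fun b => v' <= b) (srt i) l.+1 (fun a b h1 h2 => le_trans h1 h2) (srt_sorted i).
  by rewrite size_srt => /(_ l1K); rewrite count_srt l2.
have : 2 * bDelta s < nth 0 (srt i) l - nth 0 (srt i) l.+1.
  move: hg; rewrite negb_exists => /forallP/(_ i); rewrite negb_exists => /forallP/(_ (Ordinal lN)).
  rewrite /= -/(srt i) !nth_take ?ltnS ?(ltnW lN)// negb_and -ltNge => /orP[|//].
  rewrite size_take size_srt -leqNgt; case: ltnP => // _ h.
    by move: lN; rewrite ltnNge -ltnS h.
  by move: l1K; rewrite ltnNge h.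
lra.
Qed.

Lemma Ngapcond_agree (U : 'I_N -> 'I_K -> R) : ~~ gapcond lam s xs ->
  (forall i j, `|Uh i j - U i j| <= bDelta s) ->
  forall i j j', pbetter Uh i j j' -> (nbetter Uh i j < N)%N -> U i j' < U i j.
Proof.
move=> hg hU i j j' hb hn; have := Ngapcond_gap hg hb hn.
have := hU i j; have := hU i j'; rewrite !ler_norml => /andP[? ?] /andP[? ?] ?; lra.
Qed.

(** The sort is moved from the values to the arms, so that two consecutive values come from two
    different arms even when they are equal. *)
Lemma gapcond_close : gapcond lam s xs ->
  exists i j j', j != j' /\ `|Uh i j - Uh i j'| <= 2 * bDelta s.
Proof.
move=> /existsP [i /existsP [l /andP[hl hle]]]; exists i.
have l1 : (l.+1 < K)%N.
  by apply: leq_trans hl _; rewrite size_take -/(srt i) size_srt; case: ltnP => // /ltnW.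
have [j0 _] : exists j0 : 'I_K, true by exists (Ordinal l1).
move: hle; rewrite !nth_take ?ltnS ?ltn_ord// ?(ltnW (ltn_ord _))// sort_map.
set s' := sort _ _ => hle.
have sz : size s' = K by rewrite size_sort size_enum_ord.
exists (nth j0 s' l), (nth j0 s' l.+1); split.
  by rewrite nth_uniq ?sz ?(ltnW l1)// ?neq_ltn ?ltnS ?leqnn// sort_uniq enum_uniq.
have := srt_sorted i; rewrite /srt sort_map -/s' => hs.
move: hle; rewrite !(nth_map j0) ?sz ?(ltnW l1)// => hle.
rewrite ger0_norm// subr_ge0.
have := @sorted_leq_nth _ ge _ _ 0 _ hs l l.+1.
rewrite !inE size_map sz !(nth_map j0) ?sz ?(ltnW l1)//; apply => //.
by move=> y x z h1 h2; exact: le_trans h2 h1.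
Qed.

Lemma gapcond_close_true (U : 'I_N -> 'I_K -> R) : gapcond lam s xs ->
  (forall i j, `|Uh i j - U i j| <= bDelta s) ->
  exists i j j', j != j' /\ `|U i j - U i j'| <= 4 * bDelta s.
Proof.
move=> /gapcond_close [i [j [j' [jj' h]]]] hU; exists i, j, j'; split=> //.
move: h (hU i j) (hU i j'); rewrite !ler_norml => /andP[? ?] /andP[? ?] /andP[? ?].
by apply/andP; split; lra.
Qed.

End SortedGaps.

(** * Measurability of the algorithm *)

Section Selection.
Context {dO : measure_display} {O : measurableType dO}.

(** Fibrewise measurability: maps into matchings, sets of pairs or booleans are handled without a
    sigma-algebra on the codomain. *)
Definition mdisc (A : Type) (f : O -> A) := forall v, measurable [set w | f w = v].

Lemma measurable_sel (F : finType) (g : O -> F) (S : F -> set O) :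
  mdisc g -> (forall v, measurable (S v)) -> measurable [set w | S (g w) w].
Proof.
move=> mg mS.
have -> : [set w | S (g w) w] = \bigcup_(v in [set: F]) ([set w | g w = v] `&` S v).
  apply/seteqP; split=> w /=; first by move=> h; exists (g w).
  by move=> [v _ /= [-> ]].
apply: fin_bigcup_measurable; first exact: finite_finset.
by move=> v _; apply: measurableI.
Qed.

(** The basic device for the algorithm: a decision with finitely many values is frozen, and what
    follows is shown measurable for each value. *)
Lemma mdisc_sel (F : finType) (A : Type) (g : O -> F) (h : F -> O -> A) :
  mdisc g -> (forall v, mdisc (h v)) -> mdisc (fun w => h (g w) w).
Proof. by move=> mg mh a; apply: (measurable_sel (S := fun v => [set w | h v w = a])) => // v; exact: mh. Qed.

Lemma measurable_fun_sel (F : finType) d' (Z : measurableType d') (g : O -> F) (h : F -> O -> Z) :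
  mdisc g -> (forall v, measurable_fun setT (h v)) -> measurable_fun setT (fun w => h (g w) w).
Proof.
move=> mg mh _ B mB; rewrite setTI.
apply: (measurable_sel (S := fun v => h v @^-1` B)) => // v.
by rewrite -[X in measurable X]setTI; exact: mh.
Qed.

Lemma mdisc_cst (A : Type) (a : A) : mdisc (fun _ => a).
Proof.
move=> v; have [->|ne] := pselect (a = v).
  by rewrite (_ : [set _ | _] = setT)//; apply/seteqP; split.
by rewrite (_ : [set _ | _] = set0)//; apply/seteqP; split.
Qed.

Lemma mdisc_fun (F : finType) (A : Type) (g : O -> F) (phi : F -> A) :
  mdisc g -> mdisc (fun w => phi (g w)).
Proof. by move=> mg; apply: (@mdisc_sel _ _ g (fun v _ => phi v)) => // v; exact: mdisc_cst. Qed.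

Lemma mdisc_ext (A : Type) (f g : O -> A) : f =1 g -> mdisc f -> mdisc g.
Proof. by move=> /funext ->. Qed.

Lemma mdisc_ffun (I A : finType) (f : I -> O -> A) :
  (forall i, mdisc (f i)) -> mdisc (fun w => [ffun i => f i w]).
Proof.
move=> mf v.
have -> : [set w | [ffun i => f i w] = v] = \bigcap_(i in [set: I]) [set w | f i w = v i].
  apply/seteqP; split=> w /=; first by move=> <- i _ /=; rewrite ffunE.
  by move=> h; apply/ffunP => i; rewrite ffunE; exact: h.
apply: fin_bigcap_measurable; first exact: finite_finset.
by move=> i _; apply: mf.
Qed.

Lemma mdisc_pair (A B : finType) (f : O -> A) (g : O -> B) :
  mdisc f -> mdisc g -> mdisc (fun w => (f w, g w)).
Proof.
move=> mf mg; apply: (@mdisc_sel _ _ f (fun v w => (v, g w))) => // v.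
exact: (@mdisc_fun _ _ g (fun u => (v, u))).
Qed.

Lemma mdisc_fun2 (A B : finType) (C : Type) (f : O -> A) (g : O -> B) (phi : A -> B -> C) :
  mdisc f -> mdisc g -> mdisc (fun w => phi (f w) (g w)).
Proof. by move=> mf mg; exact: (@mdisc_fun _ _ _ (fun p => phi p.1 p.2) (mdisc_pair mf mg)). Qed.

Lemma mdisc_forall (I : finType) (b : I -> O -> bool) :
  (forall i, mdisc (b i)) -> mdisc (fun w => [forall i, b i w]).
Proof.
move=> mb; have := @mdisc_fun _ _ _ (fun f : {ffun I -> bool} => [forall i, f i]) (mdisc_ffun mb).
by apply: mdisc_ext => w; apply: eq_forallb => i; rewrite ffunE.
Qed.

Lemma mdisc_exists (I : finType) (b : I -> O -> bool) :
  (forall i, mdisc (b i)) -> mdisc (fun w => [exists i, b i w]).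
Proof.
move=> mb; have := @mdisc_fun _ _ _ (fun f : {ffun I -> bool} => [exists i, f i]) (mdisc_ffun mb).
by apply: mdisc_ext => w; apply: eq_existsb => i; rewrite ffunE.
Qed.

Lemma mdisc_pick (I : finType) (b : I -> O -> bool) :
  (forall i, mdisc (b i)) -> mdisc (fun w => [pick i | b i w]).
Proof.
move=> mb; have := @mdisc_fun _ _ _ (fun f : {ffun I -> bool} => [pick i | f i]) (mdisc_ffun mb).
by apply: mdisc_ext => w; apply: eq_pick => i; rewrite ffunE.
Qed.

Lemma mdisc_set (I : finType) (b : I -> O -> bool) :
  (forall i, mdisc (b i)) -> mdisc (fun w => [set i | b i w]%SET).
Proof.
move=> mb; have := @mdisc_fun _ _ _ (fun f : {ffun I -> bool} => [set i | f i]%SET) (mdisc_ffun mb).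
by apply: mdisc_ext => w; apply/setP => i; rewrite !inE ffunE.
Qed.

Lemma mdisc_and (a b : O -> bool) : mdisc a -> mdisc b -> mdisc (fun w => a w && b w).
Proof. exact: mdisc_fun2. Qed.

Lemma mdisc_or (a b : O -> bool) : mdisc a -> mdisc b -> mdisc (fun w => a w || b w).
Proof. exact: mdisc_fun2. Qed.

Lemma mdisc_imp (a b : O -> bool) : mdisc a -> mdisc b -> mdisc (fun w => a w ==> b w).
Proof. exact: mdisc_fun2. Qed.

Lemma mdisc_neg (a : O -> bool) : mdisc a -> mdisc (fun w => ~~ a w).
Proof. exact: mdisc_fun. Qed.

Lemma mdisc_bool (b : O -> bool) : measurable_fun setT b -> mdisc b.
Proof. by move=> mb v; have := mb measurableT [set v]; rewrite setTI; apply. Qed.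

Lemma measurable_bool (b : O -> bool) : mdisc b -> measurable [set w | b w].
Proof. by move=> /(_ true). Qed.

Lemma measurable_fun_mdisc_if d' (Z : measurableType d') (b : O -> bool) (f g : O -> Z) :
  mdisc b -> measurable_fun setT f -> measurable_fun setT g ->
  measurable_fun setT (fun w => if b w then f w else g w).
Proof.
by move=> mb mf mg; apply: (@measurable_fun_sel _ _ _ b (fun v w => if v then f w else g w)) => // -[].
Qed.

Lemma mdisc_if (A : Type) (b : O -> bool) (f g : O -> A) :
  mdisc b -> mdisc f -> mdisc g -> mdisc (fun w => if b w then f w else g w).
Proof.
by move=> mb mf mg; apply: (@mdisc_sel _ _ b (fun v w => if v then f w else g w)) => // -[].
Qed.

End Selection.

(** * Measurable reals, matrices and inverses *)

Section RealMeasurability.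
Context {R : realType} {dO : measure_display} {O : measurableType dO}.
Implicit Types f g : O -> R.

Lemma mdisc_lt f g : measurable_fun setT f -> measurable_fun setT g -> mdisc (fun w => f w < g w).
Proof. by move=> mf mg; apply: mdisc_bool; exact: measurable_fun_ltr. Qed.

Lemma mdisc_le f g : measurable_fun setT f -> measurable_fun setT g -> mdisc (fun w => f w <= g w).
Proof. by move=> mf mg; apply: mdisc_bool; exact: measurable_fun_ler. Qed.

Lemma mdisc_eqr f g : measurable_fun setT f -> measurable_fun setT g -> mdisc (fun w => f w == g w).
Proof. by move=> mf mg; apply: mdisc_bool; exact: measurable_fun_eqr. Qed.

Lemma measurable_inv : measurable_fun setT (@GRing.inv R).
Proof.
have -> : [set: R] = [set 0] `|` ~` [set 0].
  by apply/seteqP; split=> // x _; exact: EM.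
apply/measurable_funU; [exact: measurable_set1|apply: measurableC; exact: measurable_set1|split].
  exact: measurable_fun_set1.
apply: open_continuous_measurable_fun.
  by apply: closed_openC; exact: closed_eq.
by move=> x /set_mem /= /eqP; exact: inv_continuous.
Qed.

Lemma measurable_funV f : measurable_fun setT f -> measurable_fun setT (fun w => (f w)^-1).
Proof. by move=> mf; apply: measurableT_comp => //; exact: measurable_inv. Qed.

Lemma measurable_fun_sqrt f : measurable_fun setT f -> measurable_fun setT (fun w => Num.sqrt (f w)).
Proof.
move=> mf; apply: (measurableT_comp (f := @Num.sqrt R)) => //.
by apply: continuous_measurable_fun; exact: sqrt_continuous.
Qed.

Definition mmx (m n : nat) (A : O -> 'M[R]_(m, n)) :=
  forall i j, measurable_fun setT (fun w => A w i j).

Lemma mmx_cst m n (A : 'M[R]_(m, n)) : mmx (fun _ => A).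
Proof. by move=> i j; exact: measurable_cst. Qed.

Lemma mmx_add m n (A B : O -> 'M[R]_(m, n)) : mmx A -> mmx B -> mmx (fun w => A w + B w).
Proof.
move=> mA mB i j; rewrite (_ : (fun w => _) = (fun w => A w i j + B w i j)).
  exact: measurable_funD.
by apply/funext => w; rewrite mxE.
Qed.

Lemma mmx_opp m n (A : O -> 'M[R]_(m, n)) : mmx A -> mmx (fun w => - A w).
Proof.
move=> mA i j; rewrite (_ : (fun w => _) = (fun w => - A w i j)).
  exact: measurable_funN.
by apply/funext => w; rewrite mxE.
Qed.

Lemma mmx_mul m n p (A : O -> 'M[R]_(m, n)) (B : O -> 'M[R]_(n, p)) :
  mmx A -> mmx B -> mmx (fun w => A w *m B w).
Proof.
move=> mA mB i j; rewrite (_ : (fun w => _) = (fun w => \sum_k A w i k * B w k j)).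
  by apply: measurable_sum => k; exact: measurable_funM.
by apply/funext => w; rewrite mxE.
Qed.

Lemma mmx_tr m n (A : O -> 'M[R]_(m, n)) : mmx A -> mmx (fun w => (A w)^T).
Proof.
move=> mA i j; rewrite (_ : (fun w => _) = (fun w => A w j i))//.
by apply/funext => w; rewrite mxE.
Qed.

Lemma mmx_scale m n (f : O -> R) (A : O -> 'M[R]_(m, n)) :
  measurable_fun setT f -> mmx A -> mmx (fun w => f w *: A w).
Proof.
move=> mf mA i j; rewrite (_ : (fun w => _) = (fun w => f w * A w i j)).
  exact: measurable_funM.
by apply/funext => w; rewrite mxE.
Qed.

Lemma measurable_det n (A : O -> 'M[R]_n) : mmx A -> measurable_fun setT (fun w => \det (A w)).
Proof.
move=> mA; apply: measurable_sum => s; apply: measurable_funM => //.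
by apply: measurable_prod => i _; exact: mA.
Qed.

(** By the adjugate formula the entries of the inverse are rational in those of [A]. *)
Lemma mmx_inv n (A : O -> 'M[R]_n) : (forall w, A w \in unitmx) -> mmx A -> mmx (fun w => invmx (A w)).
Proof.
move=> uA mA; rewrite (_ : (fun w => _) = (fun w => (\det (A w))^-1 *: \adj (A w))).
  apply: mmx_scale; first by apply: measurable_funV; exact: measurable_det.
  move=> i j; rewrite (_ : (fun w => _) = (fun w => cofactor (A w) j i)); last first.
    by apply/funext => w; rewrite mxE.
  apply: measurable_funM => //; apply: measurable_det => k l.
  rewrite (_ : (fun w => _) = (fun w => A w (lift j k) (lift i l)))//.
  by apply/funext => w; rewrite !mxE.
by apply/funext => w; rewrite /invmx uA.
Qed.

Lemma measurable_ip d (u v : O -> 'rV[R]_d) : mmx u -> mmx v -> measurable_fun setT (fun w => ip (u w) (v w)).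
Proof. by move=> mu mv; apply: mmx_mul => //; exact: mmx_tr. Qed.

Lemma measurable_bform d (V : O -> 'M[R]_d) (u v : O -> 'rV[R]_d) :
  mmx V -> mmx u -> mmx v -> measurable_fun setT (fun w => bform (V w) (u w) (v w)).
Proof. by move=> mV mu mv; apply: mmx_mul; [exact: mmx_mul|exact: mmx_tr]. Qed.

Lemma mmx_sel (F : finType) m n (g : O -> F) (A : F -> O -> 'M[R]_(m, n)) :
  mdisc g -> (forall v, mmx (A v)) -> mmx (fun w => A (g w) w).
Proof.
by move=> mg mA i j; apply: (measurable_fun_sel (h := fun v w => A v w i j)) => // v; exact: mA.
Qed.

End RealMeasurability.

(** * Measurability of Gale-Shapley and of one round of the algorithm *)

Section AlgorithmMeasurability.
Context {R : realType} {dO : measure_display} {O : measurableType dO}.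
Variables (N K d : nat) (rk : 'I_K -> 'I_N -> nat).

Lemma mdisc_GS (Uh : O -> 'I_N -> 'I_K -> R) :
  (forall i j, measurable_fun setT (fun w => Uh w i j)) -> mdisc (fun w => GS rk (Uh w)).
Proof.
move=> mU.
have mb i j j' : mdisc (fun w => pbetter (Uh w) i j j').
  apply: mdisc_or; first exact: mdisc_lt.
  by apply: mdisc_and; [exact: mdisc_eqr|exact: mdisc_cst].
have mp rej i : mdisc (fun w => proposal (Uh w) rej i).
  apply: mdisc_pick => j; apply: mdisc_and; first exact: mdisc_cst.
  apply: mdisc_forall => j'; apply: mdisc_imp; first exact: mdisc_cst.
  by apply: mdisc_or; [exact: mdisc_cst|exact: mb].
have mpe rej i j : mdisc (fun w => proposal (Uh w) rej i == Some j).
  exact: (@mdisc_fun _ _ _ _ _ (fun o => o == Some j) (mp rej i)).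
have mh rej j : mdisc (fun w => held rk (Uh w) rej j).
  apply: mdisc_pick => i; apply: mdisc_and; first exact: mpe.
  by apply: mdisc_forall => i'; apply: mdisc_imp; [exact: mpe|exact: mdisc_cst].
have ms rej : mdisc (fun w => ga_step rk (Uh w) rej).
  apply: (@mdisc_fun _ _ _ _ _ (fun A => rej :|: A)%SET).
  apply: mdisc_set => ij; apply: mdisc_and; first exact: mpe.
  exact: (@mdisc_fun _ _ _ _ _ (fun o => o != Some ij.1) (mh rej ij.2)).
have mi n : mdisc (fun w => iter n (ga_step rk (Uh w)) finset.set0).
  elim: n => [|n IH] /=; first exact: mdisc_cst.
  exact: (mdisc_sel (h := fun rej w => ga_step rk (Uh w) rej) IH ms).
pose h rej w : matching N K := [ffun i => if proposal (Uh w) rej i is Some j then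
               (if held rk (Uh w) rej j == Some i then Some j else None) else None].
apply: (mdisc_sel (h := h) (mi (N * K)%N)) => rej; apply: mdisc_ffun => i.
pose h' (o : option 'I_K) w := if o is Some j then
               (if held rk (Uh w) rej j == Some i then Some j else None) else None.
apply: (mdisc_sel (h := h') (mp rej i)) => -[j|]; last exact: mdisc_cst.
exact: (@mdisc_fun _ _ _ _ _ (fun o => if o == Some i then Some j else None) (mh rej j)).
Qed.

Lemma measurable_mval (U : O -> 'I_N -> 'I_K -> R) (m : O -> matching N K) i :
  (forall i j, measurable_fun setT (fun w => U w i j)) -> mdisc m ->
  measurable_fun setT (fun w => mval (U w) i (m w)).
Proof.
move=> mU mm; apply: (measurable_fun_sel (h := fun v w => mval (U w) i v)) => // v.
by rewrite /mval; case: (v i) => [j|]; [exact: mU|exact: measurable_cst].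
Qed.

Lemma measurable_Ustar (U : O -> 'I_N -> 'I_K -> R) i :
  (forall i j, measurable_fun setT (fun w => U w i j)) ->
  measurable_fun setT (fun w => Ustar rk (U w) i).
Proof.
move=> mU.
have ms m : mdisc (fun w => stable rk (U w) m).
  apply: mdisc_and; first exact: mdisc_cst.
  apply: mdisc_forall => i1; apply: mdisc_forall => j; apply: mdisc_neg.
  apply: mdisc_and; first exact: mdisc_cst.
  by rewrite /player_prefers; case: (m i1) => [j'|]; [exact: mdisc_lt|exact: mdisc_cst].
(* The set of stable matchings is frozen as a boolean table [S], so that the maximum ranges over a
   fixed index set. *)
pose h (S : {ffun matching N K -> bool}) w := if [pick m | S m] is Some m0 then
  \big[Num.max/mval (U w) i m0]_(m | S m) mval (U w) i m else 0.
have mv m : measurable_fun setT (fun w => mval (U w) i m).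
  by apply: measurable_mval => //; exact: mdisc_cst.
rewrite (_ : (fun w => _) = (fun w => h [ffun m => stable rk (U w) m] w)).
  apply: (measurable_fun_sel (h := h)); first exact: mdisc_ffun.
  move=> S; rewrite /h; case: pickP => // m0 _.
  elim: (index_enum _) => [|m s IH].
    by under eq_fun do rewrite big_nil; exact: mv.
  under eq_fun do rewrite big_cons.
  by case: (S m) => //; exact: measurable_maxr.
apply/funext => w; rewrite /h /Ustar.
under eq_pick => m do rewrite -(ffunE (stable rk (U w)) m).
by case: pickP => // m0 _; apply: eq_bigl => m; rewrite ffunE.
Qed.

Variables (lam : R) (hlam : 0 < lam).
Implicit Type D : O -> seq ('rV[R]_d * R).

(** The list of data has random length and carries no sigma-algebra; the algorithm and the residual
    read it only through these two matrices. *)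
Definition mdata D := mmx (fun w => gram lam (D w)) /\ mmx (fun w => \sum_(p <- D w) p.2 *: p.1).

Lemma mdata_nil : mdata (fun _ => [::]).
Proof. by split; exact: mmx_cst. Qed.

Lemma mdata_rcons D (x : O -> 'rV[R]_d) (y : O -> R) : mdata D -> mmx x -> measurable_fun setT y ->
  mdata (fun w => rcons (D w) (x w, y w)).
Proof.
move=> [mG mS] mx my; split.
  under eq_fun do rewrite gram_rcons.
  by apply: mmx_add => //; apply: mmx_mul => //; exact: mmx_tr.
under eq_fun do rewrite -cats1 big_cat big_seq1.
by apply: mmx_add => //; exact: mmx_scale.
Qed.

Lemma mdata_sel (F : finType) (g : O -> F) (D : F -> O -> seq ('rV[R]_d * R)) :
  mdisc g -> (forall v, mdata (D v)) -> mdata (fun w => D (g w) w).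
Proof.
move=> mg mD; split.
  by apply: (mmx_sel (A := fun v w => gram lam (D v w))) => // v; case: (mD v).
apply: (mmx_sel (A := fun v w => \sum_(p <- D v w) p.2 *: p.1)) => // v; by case: (mD v).
Qed.

Lemma mdata_if (b : O -> bool) D D' : mdisc b -> mdata D -> mdata D' ->
  mdata (fun w => if b w then D w else D' w).
Proof.
by move=> mb mD mD'; apply: (mdata_sel (D := fun v w => if v then D w else D' w)) => // -[].
Qed.

Lemma mmx_gramV D : mdata D -> mmx (fun w => invmx (gram lam (D w))).
Proof. by move=> [mG _]; apply: mmx_inv => // w; exact: gram_unit. Qed.

Lemma measurable_iform D (u v : O -> 'rV[R]_d) : mdata D -> mmx u -> mmx v ->
  measurable_fun setT (fun w => iform lam (D w) (u w) (v w)).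
Proof. by move=> mD mu mv; apply: measurable_bform => //; exact: mmx_gramV. Qed.

Lemma measurable_wnorm D (x : O -> 'rV[R]_d) : mdata D -> mmx x ->
  measurable_fun setT (fun w => wnorm lam (D w) (x w)).
Proof. by move=> mD mx; apply: measurable_fun_sqrt; exact: measurable_iform. Qed.

Lemma mmx_resid th D : mdata D -> mmx (fun w => resid th (D w)).
Proof.
move=> [mG mS]; under eq_fun do rewrite (resid_eq lam th).
apply: mmx_add => //; apply: mmx_opp; apply: mmx_mul; first exact: mmx_cst.
by apply: mmx_add => //; exact: mmx_cst.
Qed.

Lemma mmx_thetahat D : mdata D -> mmx (fun w => thetahat lam (D w)).
Proof. by move=> mD; apply: mmx_mul; [case: mD|exact: mmx_gramV]. Qed.

Record mstate (s : O -> bstate R N d) : Prop := MState {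
  ms_Delta : measurable_fun setT (fun w => bDelta (s w));
  ms_data : forall i, mdata (fun w => bData (s w) i);
  ms_Nk : measurable_fun setT (fun w => (bNk (s w))%:R : R) }.

Variables (s : O -> bstate R N d) (xs : O -> 'I_K -> 'rV[R]_d).
Hypotheses (ms : mstate s) (mx : forall j, mmx (fun w => xs w j)).
Variables (T : nat) (eta : R) (mcm : {set 'I_N * 'I_K} -> matching N K).

Lemma measurable_Uhat i j : measurable_fun setT (fun w => Uhat lam (s w) (xs w) i j).
Proof. by apply: measurable_ip => //; apply: mmx_thetahat; exact: ms_data. Qed.

Lemma mdisc_explore_edges : mdisc (fun w => explore_edges lam eta (s w) (xs w)).
Proof.
apply: mdisc_set => -[i j] /=; apply: mdisc_lt.
  by apply: measurable_funM => //; exact: ms_Delta.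
by apply: measurable_wnorm => //; exact: ms_data.
Qed.

Lemma mdisc_explores : mdisc (fun w => explore_edges lam eta (s w) (xs w) != finset.set0).
Proof. exact: (@mdisc_fun _ _ _ _ _ (fun E => E != finset.set0) mdisc_explore_edges). Qed.

Lemma mdisc_choose : mdisc (fun w => Defs.choose rk lam eta mcm (s w) (xs w)).
Proof.
apply: mdisc_if; first exact: mdisc_explores.
  exact: (@mdisc_fun _ _ _ _ _ mcm mdisc_explore_edges).
by apply: mdisc_GS; exact: measurable_Uhat.
Qed.

Lemma mdisc_gapcond : mdisc (fun w => gapcond lam (s w) (xs w)).
Proof.
apply: mdisc_exists => i.
(* All comparisons between estimates form a finite table; once it is frozen, the sorted order of the
   arms is fixed. *)
pose tab w := [ffun p : 'I_K * 'I_K => Uhat lam (s w) (xs w) i p.2 <= Uhat lam (s w) (xs w) i p.1].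
have mtab : mdisc tab by apply: mdisc_ffun => p; apply: mdisc_le; exact: measurable_Uhat.
pose idx (t : {ffun 'I_K * 'I_K -> bool}) := sort (fun a b => t (a, b)) (enum 'I_K).
have e w : sort (fun a b : R => b <= a) [seq Uhat lam (s w) (xs w) i j | j <- enum 'I_K] =
   [seq Uhat lam (s w) (xs w) i j | j <- idx (tab w)].
  rewrite sort_map /idx; congr map; congr (path.sort _ _).
  by apply/funext => a; apply/funext => b; rewrite ffunE.
have mnth (q : seq 'I_K) k : measurable_fun setT (fun w => [seq Uhat lam (s w) (xs w) i j | j <- q]`_k).
  have [hk|hk] := ltnP k (size q).
    case: q hk => // j0 q hk; under eq_fun do rewrite (nth_map j0)//.
    exact: measurable_Uhat.
  rewrite (_ : (fun w => _) = cst 0); first exact: measurable_cst.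
  by apply/funext => w; rewrite nth_default ?size_map.
pose h t w := let srt := take N.+1 [seq Uhat lam (s w) (xs w) i j | j <- idx t] in
  [exists l : 'I_N, (l.+1 < size srt)%N && (srt`_l - srt`_l.+1 <= 2 * bDelta (s w))].
apply: (@mdisc_ext _ _ _ (fun w => h (tab w) w)); first by move=> w; rewrite /h -e.
apply: mdisc_sel => // t; apply: mdisc_exists => l; apply: mdisc_and.
  apply: (@mdisc_ext _ _ _ (fun _ => (l.+1 < size (take N.+1 (idx t)))%N)).
    by move=> w; rewrite -map_take size_map.
  exact: mdisc_cst.
apply: mdisc_le; last by apply: measurable_funM => //; exact: ms_Delta.
by under eq_fun do rewrite -map_take; apply: measurable_funB; exact: mnth.
Qed.

(** The state after the observation is recorded and before a possible reset: the supermartingale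
    step compares it with the state before the round, and the batch test reads it. *)
Definition midstate (s : bstate R N d) (xs : 'I_K -> 'rV[R]_d) (y : 'I_N -> R) : bstate R N d :=
  let E := explore_edges lam eta s xs in
  if E != finset.set0 then
      BState (bDelta s)
             (fun i => if mcm E i is Some j then rcons (bData s i) (xs j, y i)
                       else bData s i)
             (bNk s)
    else BState (bDelta s) (bData s)
                (if gapcond lam s xs then (bNk s).+1 else bNk s).

Definition newbatch (s1 : bstate R N d) : bool :=
  3 * ln (T%:R) / (16 * bDelta s1 ^+ 2) < (bNk s1)%:R.

Lemma updateE (s0 : bstate R N d) xs0 y : update T lam eta mcm s0 xs0 y =
  let s1 := midstate s0 xs0 y in
  if newbatch s1 then BState (bDelta s1 / Num.sqrt 2) (fun _ => [::]) 0%N else s1.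
Proof. by []. Qed.

Lemma mstate_if (b : O -> bool) s1 s2 : mdisc b -> mstate s1 -> mstate s2 ->
  mstate (fun w => if b w then s1 w else s2 w).
Proof.
move=> mb m1 m2; split=> [|i|].
- rewrite (_ : (fun w => _) = (fun w => if b w then bDelta (s1 w) else bDelta (s2 w))).
    by apply: measurable_fun_mdisc_if => //; exact: ms_Delta.
  by apply/funext => w; case: ifP.
- rewrite (_ : (fun w => _) = (fun w => if b w then bData (s1 w) i else bData (s2 w) i)).
    by apply: mdata_if => //; exact: ms_data.
  by apply/funext => w; case: ifP.
- rewrite (_ : (fun w => _) = (fun w => if b w then (bNk (s1 w))%:R else (bNk (s2 w))%:R)).
    by apply: measurable_fun_mdisc_if => //; exact: ms_Nk.
  by apply/funext => w; case: ifP.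
Qed.

Variables (theta : 'I_N -> 'rV[R]_d) (e : O -> 'I_N -> 'I_K -> R).
Hypothesis me : forall i j, measurable_fun setT (fun w => e w i j).
Let y w := obs theta (xs w) (e w) (Defs.choose rk lam eta mcm (s w) (xs w)).

Lemma measurable_obs i : measurable_fun setT (fun w => y w i).
Proof.
apply: (measurable_fun_sel (h := fun m w => obs theta (xs w) (e w) m i)); first exact: mdisc_choose.
move=> m; rewrite /obs; case: (m i) => [j|]; last exact: measurable_cst.
by apply: measurable_funD => //; apply: measurable_ip => //; exact: mmx_cst.
Qed.

Lemma mstate_mid : mstate (fun w => midstate (s w) (xs w) (y w)).
Proof.
apply: mstate_if; first exact: mdisc_explores.
  split=> /= [|i|]; [exact: ms_Delta| |exact: ms_Nk].
  apply: (mdata_sel (D := fun E w => if mcm E i is Some j then rcons (bData (s w) i) (xs w j, y w i)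
                       else bData (s w) i)); first exact: mdisc_explore_edges.
  move=> E; case: (mcm E i) => [j|]; last exact: ms_data.
  by apply: mdata_rcons => //; [exact: ms_data|exact: measurable_obs].
split=> /= [|i|]; [exact: ms_Delta|exact: ms_data|].
rewrite (_ : (fun w => _) = (fun w => (bNk (s w))%:R + if gapcond lam (s w) (xs w) then 1 else 0)).
  apply: measurable_funD; first exact: ms_Nk.
  by apply: measurable_fun_mdisc_if => //; exact: mdisc_gapcond.
by apply/funext => w; case: ifP; rewrite ?addr0// -natr1.
Qed.

Lemma mdisc_newbatch (s1 : O -> bstate R N d) : mstate s1 -> mdisc (fun w => newbatch (s1 w)).
Proof.
move=> m1; apply: mdisc_lt; last exact: ms_Nk.
apply: measurable_funM => //; apply: measurable_funV; apply: measurable_funM => //.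
by apply: measurable_funX; exact: ms_Delta.
Qed.

Lemma mstate_update : mstate (fun w => update T lam eta mcm (s w) (xs w) (y w)).
Proof.
under eq_fun do rewrite updateE /=.
apply: mstate_if; [exact: (mdisc_newbatch mstate_mid)| |exact: mstate_mid].
split=> /= [|i|]; [|exact: mdata_nil|exact: measurable_cst].
by apply: measurable_funM => //; exact: (ms_Delta mstate_mid).
Qed.

End AlgorithmMeasurability.

Section HistoryMeasurability.
Context {R : realType} {dO : measure_display} {O : measurableType dO}.
Variables (N K d : nat) (rk : 'I_K -> 'I_N -> nat) (T : nat) (lam eta : R) (hlam : 0 < lam).
Variables (mcm : {set 'I_N * 'I_K} -> matching N K) (Delta1 : R) (theta : 'I_N -> 'rV[R]_d).
Variables (X : nat -> O -> 'I_K -> 'rV[R]_d) (E : nat -> O -> 'I_N -> 'I_K -> R).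

(** Only rounds before [t] are assumed measurable. Applied on the sigma-algebra of the history
    instead of the full one, this says that the state is adapted. *)
Lemma mstate_at t : (forall r j, (r < t)%N -> mmx (fun w => X r w j)) ->
  (forall r i j, (r < t)%N -> measurable_fun setT (fun w => E r w i j)) ->
  mstate lam (fun w => bstate_at rk T lam eta mcm Delta1 theta (X^~ w) (E^~ w) t).
Proof.
elim: t => [|t IH] mX mE.
  by split=> /= [|i|]; [exact: measurable_cst|exact: mdata_nil|exact: measurable_cst].
apply: mstate_update => //.
- by apply: IH => *; [apply: mX|apply: mE]; rewrite ltnS ltnW.
- by move=> j; apply: mX.
- by move=> i j; apply: mE.
Qed.

End HistoryMeasurability.

(** * Sub-Gaussian averages *)

Section Domination.
Context {R : realType} {dO : measure_display} {O : measurableType dO} (P : {measure set O -> \bar R}).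
Variable G : set (set O).
Hypothesis Gsub : <<s G>> `<=` measurable.
Local Notation Om := (g_sigma_algebraType G).

Lemma sub_measurable_fun d' (Z : measurableType d') (f : O -> Z) :
  measurable_fun [set: Om] (f : Om -> Z) -> measurable_fun [set: O] f.
Proof.
move=> mf _ B mB; apply: Gsub.
by have := mf measurableT B mB.
Qed.

Import HBNNSimple.

Let integral_simple_mul (h : {nnsfun Om >-> R}) (g : O -> R) :
  measurable_fun setT g -> (forall x, 0 <= g x) ->
  (\int[P]_x ((h : Om -> R) x * g x)%:E =
   \sum_(y \in range h) (y%:E * \int[P]_(x in (h : Om -> R) @^-1` [set y]) (g x)%:E))%E.
Proof.
move=> mg g0.
have mA y : measurable ((h : Om -> R) @^-1` [set y] : set O).
  by apply: Gsub; apply: (measurable_funPTI h).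
transitivity (\int[P]_x (\sum_(y \in range h) (y * \1_((h : Om -> R) @^-1` [set y]) x * g x)%:E))%E.
  apply: eq_integral => x _; rewrite {1}(fimfunE h x) mulr_fsuml fsumEFin//.
have hy y (x : O) : (0 <= y * \1_((h : Om -> R) @^-1` [set y]) x).
  rewrite indicE; case: (boolP (x \in _)) => [/set_mem /= <-|_]; last by rewrite mulr0.
  by rewrite mulr1 fun_ge0.
rewrite ge0_integral_fsum//; first last.

- by move=> y x _; rewrite lee_fin mulr_ge0.
- move=> y; apply/measurable_EFinP; apply: measurable_funM => //.
  by apply: measurable_funM => //; exact: measurable_indic.
apply: eq_fsbigr => y /set_mem [z _ /= hz].
under eq_integral do rewrite -mulrA EFinM.
rewrite ge0_integralZl_EFin//; first last.
- by rewrite -hz fun_ge0.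
- by apply/measurable_EFinP; apply: measurable_funM => //; exact: measurable_indic.
- by move=> x _; rewrite lee_fin mulr_ge0// indicE.
congr (_ * _)%E; rewrite [RHS]integral_mkcond; apply: eq_integral => x _.
by rewrite patchE indicE; case: ifP => _; rewrite ?mul1r ?mul0r.
Qed.

(** The bound over sets of [<<s G>>] is a conditional expectation bound in weak form; simple
    functions and monotone convergence extend it from indicators to nonnegative weights measurable
    for [G]. *)
Lemma integral_sub_dominated (f g : O -> R) (c : R) :
  measurable_fun [set: Om] (f : Om -> R) -> (forall x, 0 <= f x) ->
  measurable_fun setT g -> (forall x, 0 <= g x) -> 0 <= c ->
  (forall A, <<s G>> A -> \int[P]_(x in A) (g x)%:E <= c%:E * P A)%E ->
  (\int[P]_x (f x * g x)%:E <= c%:E * \int[P]_x (f x)%:E)%E.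
Proof.
move=> mf f0 mg g0 c0 hA.
have mf' : measurable_fun [set: Om] (EFin \o f : Om -> \bar R) by apply/measurable_EFinP.
(* The approximants are simple on [Om], so their level sets lie in [<<s G>>], where [hA] applies. *)
pose h n : {nnsfun Om >-> R} := nnsfun_approx measurableT mf' n.
pose H n : O -> R := (h n : Om -> R).
have mH n : measurable_fun setT (H n) by apply: sub_measurable_fun; exact: measurable_funPT.
have H0 n x : 0 <= H n x by apply: fun_ge0.
have Hnd x n m : (n <= m)%N -> H n x <= H m x.
  by move=> nm; have /lefP := nd_nnsfun_approx measurableT mf' nm; apply.
have Hcvg x : (H n x)%:E @[n --> \oo] --> (f x)%:E.
  have f0' x0 : setT x0 -> (0 <= (EFin \o f) x0)%E by rewrite /= lee_fin.
  have := @cvg_nnsfun_approx _ Om R setT measurableT _ mf' f0' x I; exact.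
have Hle n x : H n x <= f x.
  have nd : {homo (fun n => (H n x)%:E) : n m / (n <= m)%N >-> (n <= m)%E}.
    by move=> n' m nm; rewrite lee_fin Hnd.
  rewrite -lee_fin (cvg_unique _ (Hcvg x) (ereal_nondecreasing_cvgn nd)).
    by apply: ereal_sup_ubound; exists n.
  exact: ereal_hausdorff.
have step n : (\int[P]_x (H n x * g x)%:E <= c%:E * \int[P]_x (f x)%:E)%E.
  apply: (@le_trans _ _ (c%:E * \int[P]_x (H n x)%:E)%E); last first.
    rewrite lee_wpmul2l ?lee_fin// ge0_le_integral//.
    - by move=> x _; rewrite lee_fin.
    - exact/measurable_EFinP.
    - by apply/measurable_EFinP; exact: sub_measurable_fun.
    - by move=> x _; rewrite lee_fin.
  rewrite /H integral_simple_mul//.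
  rewrite (_ : (\int[P]_x (H n x)%:E = \int[P]_x (H n x * cst 1 x)%:E)%E); last first.
    by apply: eq_integral => x _; rewrite mulr1.
  rewrite /H integral_simple_mul//.
  rewrite ge0_mule_fsumr; last first.
    move=> y; have [y0|y0] := leP 0 y.
      by rewrite mule_ge0 ?lee_fin// integral_ge0// => x _; rewrite lee_fin.
    rewrite [X in (\int[_]_(_ in X) _)%E](_ : _ = set0) ?integral_set0 ?mule0//.
    by apply/seteqP; split=> // x /= hx; have := H0 n x; rewrite /H hx leNgt y0.
  apply: lee_fsum => // y [z _ <-].
  rewrite muleCA; apply: lee_wpmul2l; first by rewrite lee_fin fun_ge0.
  have mA : <<s G>> ((h n : Om -> R) @^-1` [set h n z]) by apply: (measurable_funPTI (h n)).
  apply: (le_trans (hA _ mA)).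
  by have := integral_cst P (Gsub mA) 1%E; rewrite mul1e => <-.
have ndg x : {homo (fun n => (H n x * g x)%:E) : n m / (n <= m)%N >-> (n <= m)%E}.
  by move=> k m nm; rewrite lee_fin ler_wpM2r// Hnd.
rewrite (_ : (\int[P]_x (f x * g x)%:E = \int[P]_x limn (fun n => (H n x * g x)%:E))%E); last first.
  apply: eq_integral => x _; apply/esym/cvg_lim; first exact: ereal_hausdorff.
  by under eq_fun do rewrite EFinM; rewrite EFinM; apply: cvgeZr.
have mHg n : measurable_fun [set: O] (fun x => (H n x * g x)%:E).
  by apply/measurable_EFinP; exact: measurable_funM.
rewrite monotone_convergence//; last by move=> n x _; rewrite lee_fin mulr_ge0.
apply: lime_le; last by apply: nearW => n; exact: step.
apply: ereal_nondecreasing_is_cvgn => n m nm; apply: ge0_le_integral => //.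
- by move=> x _; rewrite lee_fin mulr_ge0.
- by move=> x _; exact: ndg.
Qed.

End Domination.

(** * Gaussian averages of exponential bounds *)

Section GaussianMixture.
Context {R : realType}.
Local Notation leb := (@lebesgue_measure R).

(** The normal density in terms of its variance [v], so that completing the square stays rational in
    the parameters. *)
Definition gpdf (b v x : R) : R := (Num.sqrt (v * pi *+ 2))^-1 * expR (- (x - b) ^+ 2 / (v *+ 2)).

Lemma gpdfE b v x : 0 < v -> gpdf b v x = normal_pdf b (Num.sqrt v) x.
Proof.
move=> v0; rewrite normal_pdfE ?gt_eqF ?sqrtr_gt0//.
by rewrite /= /normal_peak /normal_fun /gpdf sqr_sqrtr ?ltW.
Qed.

Lemma gpdf_ge0 b v x : 0 <= gpdf b v x.
Proof. by rewrite mulr_ge0 ?invr_ge0 ?sqrtr_ge0 ?expR_ge0. Qed.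

Lemma measurable_gpdf b v : 0 < v -> measurable_fun setT (gpdf b v).
Proof.
move=> v0; rewrite (_ : gpdf b v = normal_pdf b (Num.sqrt v)); first exact: measurable_normal_pdf.
by apply/funext => x; exact: gpdfE.
Qed.

Lemma integral_gpdf b v : 0 < v -> (\int[leb]_x (gpdf b v x)%:E = 1)%E.
Proof.
move=> v0; rewrite -(integral_normal_pdf b (Num.sqrt v)); apply: eq_integral => x _.
by rewrite gpdfE.
Qed.

Lemma integral_gpdfZ (c : R) b v : 0 <= c -> 0 < v -> (\int[leb]_x (c * gpdf b v x)%:E = c%:E)%E.
Proof.
move=> c0 v0; under eq_integral do rewrite EFinM.
rewrite ge0_integralZl_EFin//; last 2 first.
- by move=> x _; rewrite lee_fin gpdf_ge0.
- by apply/measurable_EFinP; exact: measurable_gpdf.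
by rewrite integral_gpdf// mule1.
Qed.

Lemma gpdf_expR b v e x : 0 < v ->
  gpdf b v x * expR (x * e) = expR (b * e + v * e ^+ 2 / 2) * gpdf (b + v * e) v x.
Proof.
move=> v0; rewrite /gpdf -[LHS]mulrA -expRD [RHS]mulrCA -expRD; congr (_ * expR _).
by field; rewrite gt_eqF.
Qed.

Lemma gpdf_expR_sq b v k x : 0 < v -> 0 < 1 - v * k ->
  gpdf b v x * expR (x ^+ 2 * k / 2) =
  (Num.sqrt (1 - v * k))^-1 * expR (b ^+ 2 * k / (2 * (1 - v * k))) *
    gpdf (b / (1 - v * k)) (v / (1 - v * k)) x.
Proof.
move=> v0 r0; set r := 1 - v * k in r0 *.
have ek : k = (1 - r) / v by rewrite /r; field; rewrite gt_eqF.
rewrite /gpdf -[LHS]mulrA -expRD.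
have -> : Num.sqrt (v * pi *+ 2) = Num.sqrt r * Num.sqrt (v / r * pi *+ 2).
  rewrite -sqrtrM ?ltW//; congr Num.sqrt.
  by field; rewrite gt_eqF.
rewrite invfM [RHS]mulrACA; congr (_ * _).
rewrite -expRD; congr expR; rewrite ek.
by field; rewrite !gt_eqF.
Qed.

Context {dO : measure_display} {O : measurableType dO} (P : probability O R).
Variable G : set (set O).
Hypothesis Gsub : <<s G>> `<=` measurable.
Local Notation Om := (g_sigma_algebraType G).
Variables (sg : R) (eps : O -> R).
Hypotheses (sg0 : 0 < sg) (meps : measurable_fun setT eps).
Hypothesis hsub : forall (s : R) A, <<s G>> A ->
  (\int[P]_(w in A) (expR (s * eps w))%:E <= (expR (s ^+ 2 * sg ^+ 2 / 2))%:E * P A)%E.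

(* [exp] of a quadratic in [eps] is a Gaussian average over [s] of [exp (s * eps)], and the
   weights are chosen so that averaging the sub-Gaussian bounds gives exactly [sqrt (1 + w)]. *)
Lemma quadratic_subgaussian (Z m w : O -> R) :
  measurable_fun [set: Om] (Z : Om -> R) -> measurable_fun [set: Om] (m : Om -> R) ->
  measurable_fun [set: Om] (w : Om -> R) ->
  (forall x, 0 <= Z x) -> (forall x, 0 < w x) ->
  (\int[P]_x (Z x * (expR ((2 * eps x * m x + eps x ^+ 2 * w x - m x ^+ 2) / (2 * sg ^+ 2 * (1 + w x)))
     / Num.sqrt (1 + w x)))%:E <= \int[P]_x (Z x)%:E)%E.
Proof.
move=> mZ mm mw Z0 w0.
have w1 x : 0 < 1 + w x by rewrite addr_gt0.
(* Averaging [expR (s * eps)] over [s] normal with mean [b] and variance [v] gives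
   [expR (b * eps + v * eps ^ 2 / 2)]. Matching the coefficients of [eps] and [eps ^ 2] in the
   target forces these values; [w > 0] keeps the variance positive. *)
pose b x := m x / (sg ^+ 2 * (1 + w x)).
pose v x := w x / (sg ^+ 2 * (1 + w x)).
have v0 x : 0 < v x by rewrite divr_gt0// mulr_gt0// exprn_gt0.
have vsg x : 1 - v x * sg ^+ 2 = (1 + w x)^-1.
  by rewrite /v; field; rewrite !gt_eqF// exprn_gt0.
(* The factor free of [eps]. It cancels exactly against the average of [expR (s ^ 2 * sg ^ 2 / 2)],
   since [1 - v * sg ^ 2 = 1 / (1 + w)]. *)
pose Y x := Z x * (expR (- m x ^+ 2 / (2 * sg ^+ 2 * (1 + w x))) / Num.sqrt (1 + w x)).
have Y0 x : 0 <= Y x by rewrite mulr_ge0// divr_ge0 ?expR_ge0 ?sqrtr_ge0.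
have mw1 : measurable_fun [set: Om] (fun x : Om => 1 + w x) by apply: measurable_funD.
have mi : measurable_fun [set: Om] (fun x : Om => (sg ^+ 2 * (1 + w x))^-1).
  by apply: measurable_funV; exact: measurable_funM.
have mb : measurable_fun [set: Om] (b : Om -> R) by apply: measurable_funM.
have mv : measurable_fun [set: Om] (v : Om -> R) by apply: measurable_funM.
have mY : measurable_fun [set: Om] (Y : Om -> R).
  apply: measurable_funM => //; apply: measurable_funM.
    apply: measurableT_comp => //; apply: measurable_funM.
      by apply: measurable_funN; exact: measurable_funX.
    by apply: measurable_funV; exact: measurable_funM.
  by apply: measurable_funV; exact: measurable_fun_sqrt.
have mg s : measurable_fun [set: Om] (fun x : Om => gpdf (b x) (v x) s).
  apply: measurable_funM.
    apply: measurable_funV; apply: measurable_fun_sqrt.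
    under eq_fun do rewrite -mulr_natr.
    by apply: measurable_funM => //; exact: measurable_funM.
  apply: measurableT_comp => //; apply: measurable_funM.
    by apply: measurable_funN; apply: measurable_funX; apply: measurable_funB.
  by apply: measurable_funV; under eq_fun do rewrite -mulr_natr; exact: measurable_funM.
have mg2 : measurable_fun setT (fun p : O * R => Y p.1 * gpdf (b p.1) (v p.1) p.2).
  have m1 (f : O -> R) : measurable_fun [set: Om] (f : Om -> R) -> measurable_fun setT (fun p : O * R => f p.1).
    by move=> mf; apply: (measurableT_comp (sub_measurable_fun Gsub mf)).
  apply: measurable_funM; first exact: m1.
  apply: measurable_funM.
    apply: measurable_funV; apply: measurable_fun_sqrt.
    under eq_fun do rewrite -mulr_natr.
    by apply: measurable_funM => //; apply: measurable_funM => //; exact: m1.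
  apply: measurableT_comp => //; apply: measurable_funM.
    apply: measurable_funN; apply: measurable_funX; apply: measurable_funB => //; exact: m1.
  by apply: measurable_funV; under eq_fun do rewrite -mulr_natr; apply: measurable_funM => //; exact: m1.
pose F1 (p : O * R) := (Y p.1 * gpdf (b p.1) (v p.1) p.2 * expR (p.2 * eps p.1))%:E.
pose F2 (p : O * R) := (Y p.1 * gpdf (b p.1) (v p.1) p.2 * expR (p.2 ^+ 2 * sg ^+ 2 / 2))%:E.
have mF1 : measurable_fun setT F1.
  apply/measurable_EFinP; apply: measurable_funM => //; apply: measurableT_comp => //.
  by apply: measurable_funM => //; exact: (measurableT_comp meps).
have mF2 : measurable_fun setT F2.
  apply/measurable_EFinP; apply: measurable_funM => //; apply: measurableT_comp => //.
  by apply: measurable_funM => //; apply: measurable_funM => //; exact: measurable_funX.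
have F10 p : (0 <= F1 p)%E by rewrite lee_fin !mulr_ge0 ?gpdf_ge0 ?expR_ge0.
have F20 p : (0 <= F2 p)%E by rewrite lee_fin !mulr_ge0 ?gpdf_ge0 ?expR_ge0.
have -> : (\int[P]_x (Z x * (expR ((2 * eps x * m x + eps x ^+ 2 * w x - m x ^+ 2) / (2 * sg ^+ 2 * (1 + w x)))
     / Num.sqrt (1 + w x)))%:E = \int[P]_x \int[leb]_s F1 (x, s))%E.
  apply: eq_integral => x _; rewrite /F1 /=.
  under eq_integral => s _ do rewrite -mulrA gpdf_expR// mulrA.
  rewrite integral_gpdfZ ?mulr_ge0 ?expR_ge0//; congr EFin.
  have -> : (2 * eps x * m x + eps x ^+ 2 * w x - m x ^+ 2) / (2 * sg ^+ 2 * (1 + w x)) =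
    - m x ^+ 2 / (2 * sg ^+ 2 * (1 + w x)) + (b x * eps x + v x * eps x ^+ 2 / 2).
    by rewrite /b /v; field; rewrite !gt_eqF// exprn_gt0.
  by rewrite expRD /Y; ring.
have -> : (\int[P]_x (Z x)%:E = \int[P]_x \int[leb]_s F2 (x, s))%E.
  apply: eq_integral => x _; rewrite /F2 /=.
  have r0 : 0 < 1 - v x * sg ^+ 2 by rewrite vsg invr_gt0.
  under eq_integral => s _ do rewrite -mulrA gpdf_expR_sq// mulrA.
  rewrite integral_gpdfZ ?(divr_gt0 (v0 x) r0)// ?mulr_ge0 ?expR_ge0 ?invr_ge0 ?sqrtr_ge0//; congr EFin.
  rewrite /Y vsg sqrtrV ?ltW// invrK.
  have -> : b x ^+ 2 * sg ^+ 2 / (2 * (1 + w x)^-1) = - (- m x ^+ 2 / (2 * sg ^+ 2 * (1 + w x))).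
    by rewrite /b; field; rewrite !gt_eqF// exprn_gt0.
  rewrite expRN; field.
  by rewrite !gt_eqF ?expR_gt0 ?sqrtr_gt0.
have e1 := @fubini_tonelli _ _ _ _ R P leb F1 mF1 F10.
have e2 := @fubini_tonelli _ _ _ _ R P leb F2 mF2 F20.
(* With the order of integration exchanged, the sub-Gaussian hypothesis applies for each fixed [s],
   with a weight measurable for [G]. *)
suff h : (\int[leb]_s \int[P]_x F1 (x, s) <= \int[leb]_s \int[P]_x F2 (x, s))%E.
  by move: h; rewrite -e1 -e2.
apply: ge0_le_integral => //.
- by move=> s _; apply: integral_ge0 => x _; exact: F10.
- exact: (@measurable_fun_fubini_tonelli_G _ _ _ _ R P F1).
- exact: (@measurable_fun_fubini_tonelli_G _ _ _ _ R P F2).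
move=> s _; rewrite /F1 /F2 /=.
have mYg : measurable_fun [set: Om] (fun x : Om => Y x * gpdf (b x) (v x) s).
  exact: measurable_funM.
apply: (le_trans (@integral_sub_dominated _ _ _ P G Gsub (fun x => Y x * gpdf (b x) (v x) s)
   (fun x => expR (s * eps x)) (expR (s ^+ 2 * sg ^+ 2 / 2)) _ _ _ _ _ _)) => //.
- by move=> x; rewrite mulr_ge0 ?gpdf_ge0.
- by apply: measurableT_comp => //; exact: measurable_funM.
- exact: hsub.
rewrite -ge0_integralZl_EFin//.
- rewrite le_eqVlt; apply/orP; left; apply/eqP; apply: eq_integral => x _.
  by rewrite -EFinM mulrC.
- by move=> x _; rewrite lee_fin mulr_ge0 ?gpdf_ge0.
- by apply/measurable_EFinP; exact: (sub_measurable_fun Gsub mYg).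
Qed.

End GaussianMixture.

(** * Identically distributed contexts *)

Section RectangleLaw.
Import numFieldNormedType.Exports.
Variables (R : realType) (K d : nat) (dO : measure_display) (O : measurableType dO).
Variable P : probability O R.

Local Notation T := 'M[R]_(K, d).
Let rect : set (set T) := [set A | exists B : 'I_K -> 'I_d -> set R,
  (forall j k, measurable (B j k)) /\ A = [set f : T | forall j k, B j k (f j k)]].
Local Notation Tm := (g_sigma_algebraType rect).

Let rect_setT : rect setT.
Proof.
exists (fun _ _ => setT); split; first by move=> *; exact: measurableT.
by apply/seteqP; split.
Qed.

Let rect_setI : setI_closed rect.
Proof.
move=> _ _ [B1 [m1 ->]] [B2 [m2 ->]]; exists (fun j k => B1 j k `&` B2 j k); split.
  by move=> j k; exact: measurableI.
by apply/seteqP; split=> [f [h1 h2] j k //|f h]; split=> j k; case: (h j k).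
Qed.

Let measurable_coord j k : measurable_fun setT (fun f : Tm => f j k).
Proof.
move=> _ B mB; rewrite setTI; apply: sub_sigma_algebra.
exists (fun j' k' => if (j' == j) && (k' == k) then B else setT); split.
  by move=> j' k'; case: ifP => _ //; exact: measurableT.
apply/seteqP; split=> f /= h; first by move=> j' k'; case: ifP => // /andP[/eqP -> /eqP ->].
by have := h j k; rewrite !eqxx.
Qed.

(** Rectangles are stable under intersection, so two laws that agree on them agree on the
    sigma-algebra they generate. The last hypothesis ranges over all measurable spaces because the
    set cut out by [Q] must be measurable in the space of matrices carrying that sigma-algebra. *)
Lemma rectangle_law (X Y : O -> 'I_K -> 'rV[R]_d) (Q : ('I_K -> 'rV[R]_d) -> bool) :
  (forall j, mmx (fun w => X w j)) -> (forall j, mmx (fun w => Y w j)) ->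
  (forall B : 'I_K -> 'I_d -> set R, (forall j k, measurable (B j k)) ->
     P [set w | forall j k, B j k (X w j ord0 k)] = P [set w | forall j k, B j k (Y w j ord0 k)]) ->
  (forall d' (Z : measurableType d') (V : Z -> 'I_K -> 'rV[R]_d),
     (forall j, mmx (fun z => V z j)) -> mdisc (fun z => Q (V z))) ->
  P [set w | Q (X w)] = P [set w | Q (Y w)].
Proof.
move=> mX mY hXY hQ.
have mphi (V : O -> 'I_K -> 'rV[R]_d) : (forall j, mmx (fun w => V w j)) ->
  measurable_fun [set: O] (fun w => (\matrix_(j, k) V w j ord0 k) : Tm).
  move=> mV; apply: (@measurability _ _ O Tm setT _ rect) => //.
  move=> _ [_ [B [mB ->]] <-]; rewrite setTI.
  rewrite (_ : _ @^-1` _ = \bigcap_(p in [set: 'I_K * 'I_d]) [set w | B p.1 p.2 (V w p.1 ord0 p.2)]).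
    apply: fin_bigcap_measurable; first exact: finite_finset.
    by move=> p _; have := mV p.1 ord0 p.2 measurableT _ (mB p.1 p.2); rewrite setTI.
  apply/seteqP; split=> w /= h; first by move=> p _; have := h p.1 p.2; rewrite mxE.
  by move=> j k; rewrite mxE; exact: (h (j, k)).
have vecE (V : O -> 'I_K -> 'rV[R]_d) w : V w = (fun j => row j (\matrix_(j, k) V w j ord0 k)).
  by apply/funext => j; apply/rowP => k; rewrite !mxE.
pose S : set Tm := [set f | Q (fun j => row j f)].
have mS : measurable S.
  apply: measurable_bool; apply: hQ => j i k; rewrite (_ : (fun w => _) = (fun f : Tm => f j k)).
    exact: measurable_coord.
  by apply/funext => f; rewrite [i]ord1 mxE.
have e (V : O -> 'I_K -> 'rV[R]_d) : P [set w | Q (V w)] =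
   pushforward P (fun w => (\matrix_(j, k) V w j ord0 k) : Tm) S.
  rewrite /pushforward; congr (P _); apply/funext => w /=; congr (is_true (Q _)); exact: vecE.
rewrite !e.
apply: (@g_sigma_algebra_measure_unique _ R Tm rect _ (fun _ => setT)) => //.
- by move=> A rA; exact: sub_sigma_algebra.
- by apply/seteqP; split=> // f _; exists 0%N.
- exact: mphi.
- exact: mphi.
- move=> hX hY _ [B [mB ->]]; rewrite /= /pushforward.
  rewrite (_ : _ @^-1` _ = [set w | forall j k, B j k (X w j ord0 k)]); last first.
    by apply/seteqP; split=> w /= h j k; have := h j k; rewrite mxE.
  rewrite hXY//; congr (P _).
  by apply/seteqP; split=> w /= h j k; have := h j k; rewrite mxE.
- by move=> hX _; rewrite /= /pushforward preimage_setT probability_setT ltry.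
Qed.

Definition close_pair N (theta : 'I_N -> 'rV[R]_d) (D : R) (xs : 'I_K -> 'rV[R]_d) : bool :=
  [exists i, exists j, exists j', (j != j') && (`|ip (theta i) (xs j - xs j')| <= D)].

Lemma close_pairP N (theta : 'I_N -> 'rV[R]_d) (D : R) (xs : 'I_K -> 'rV[R]_d) :
  close_pair theta D xs <-> exists i j j', j != j' /\ `|ip (theta i) (xs j - xs j')| <= D.
Proof.
split=> [/existsP[i /existsP[j /existsP[j' /andP[h1 h2]]]]|[i [j [j' [h1 h2]]]]].
  by exists i, j, j'.
by apply/existsP; exists i; apply/existsP; exists j; apply/existsP; exists j'; rewrite h1.
Qed.

Lemma mdisc_close_pair d' (Z : measurableType d') (V : Z -> 'I_K -> 'rV[R]_d)
    N (theta : 'I_N -> 'rV[R]_d) (D : R) :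
  (forall j, mmx (fun z => V z j)) -> mdisc (fun z => close_pair theta D (V z)).
Proof.
move=> mV; apply: mdisc_exists => i; apply: mdisc_exists => j; apply: mdisc_exists => j'.
apply: mdisc_and; first exact: mdisc_cst.
apply: mdisc_le => //; apply: measurableT_comp => //; apply: measurable_ip; first exact: mmx_cst.
by apply: mmx_add => //; exact: mmx_opp.
Qed.

End RectangleLaw.

(** * Pathwise regret *)

Lemma ip_vnorm (R : realType) d (u v : 'rV[R]_d) : `|ip u v| <= vnorm u * vnorm v.
Proof.
rewrite /vnorm -sqrtrM ?ip_ge0// ler_sqrt_abs// -!bform1.
by apply: bform_CS => [|x]; [exact: trmx1|rewrite bform1 ip_ge0].
Qed.

Lemma sum_ordS (f : nat -> nat) t : (\sum_(r < t.+1) f r = \sum_(r < t) f r + f t)%N.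
Proof. by rewrite big_ord_recr. Qed.

(** For [z = 2 ^ n] after [n] resets and [D = Delta1 ^ 2], the current [q] is [z / D]. The condition
    [l >= 32 * D / 3] makes the threshold at least [2 * z], so a reset needs at least that many
    rounds. *)
Lemma batch_doubling (R : realFieldType) (z D l T : R) :
  0 <= z -> 0 < D -> 3 * l / 16 * (z * D^-1) < T -> 32 * D / 3 <= l -> 2 * z <= T.
Proof.
move=> z0 D0; rewrite mulrA ltr_pdivrMr// => h1 h2.
have h3 : 32 * D / 3 * z <= l * z by rewrite ler_wpM2r.
rewrite -(ler_pM2r D0); lra.
Qed.

Lemma ln2_ge_half (R : realType) : 2^-1 <= ln (2 : R).
Proof.
have : ln (2^-1 : R) <= 2^-1 - 1 by apply: ln_le_sub1; rewrite invr_gt0.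
rewrite lnV ?posrE//; lra.
Qed.

Section Path.
Variables (R : realType) (N K d : nat) (rk : 'I_K -> 'I_N -> nat).
Hypotheses (hKN : (N <= K)%N) (hrk : forall j, injective (rk j)).
Variables (T : nat) (lam eta : R) (mcm : {set 'I_N * 'I_K} -> matching N K).
Hypotheses (hlam : 0 < lam) (heta : 0 < eta) (hmcm : is_mcm mcm).
Variables (Delta1 : R) (theta : 'I_N -> 'rV[R]_d) (Btheta Bx sg : R).
Hypotheses (hDelta1 : 0 < Delta1) (htheta : forall i, vnorm (theta i) <= Btheta).
Hypotheses (hBy : 2 * Btheta * Bx <= 1) (hsg : 0 <= sg).
Variables (xs : nat -> 'I_K -> 'rV[R]_d) (eps : nat -> 'I_N -> 'I_K -> R).
Hypothesis hxs : forall t j, vnorm (xs t j) <= Bx.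
Hypothesis hlnT : 1 <= ln (T%:R : R).
Variable tau : R.
Hypothesis htau : 0 < tau.

Local Notation s := (bstate_at rk T lam eta mcm Delta1 theta xs eps).
Local Notation ch := (barb_match rk T lam eta mcm Delta1 theta xs eps).
Definition midstate_at t := midstate lam eta mcm (s t) (xs t) (barb_y rk T lam eta mcm Delta1 theta xs eps t).
Local Notation mid := midstate_at.
Definition reset_at t := newbatch T (mid t).
Local Notation res := reset_at.
Let expl t := explore_edges lam eta (s t) (xs t) != finset.set0.
Let cnt t := ~~ expl t && gapcond lam (s t) (xs t).
Local Notation U t := (Utrue theta (xs t)).
(** The threshold is the square of the noise part of [eta]; the ridge part is deterministic. *)
Definition conf_fail (D : seq ('rV[R]_d * R)) i :=
  sg ^+ 2 * (d%:R * ln ((1 + T%:R * Bx ^+ 2 / lam) * T%:R ^+ 2)) < iform lam D (resid (theta i) D) (resid (theta i) D).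
Definition bad_round t := [exists i, conf_fail (bData (s t) i) i].
Local Notation bad := bad_round.
Definition near_tie t := close_pair theta (4 * tau) (xs t).
Local Notation near := near_tie.
Let q t := (bDelta (s t) ^+ 2)^-1.
Definition nresets t := (\sum_(r < t) res r)%N.

Local Notation nres := nresets.

Let sS t : s t.+1 = if res t then BState (bDelta (mid t) / Num.sqrt 2) (fun _ => [::]) 0%N else mid t.
Proof. by []. Qed.

Let midD t : bDelta (mid t) = bDelta (s t).
Proof. by rewrite /midstate_at /midstate; case: ifP. Qed.

Let Delta_gt0 t : 0 < bDelta (s t).
Proof.
elim: t => [//|t IH]; rewrite sS; case: ifP => _; rewrite /= midD//.
by rewrite divr_gt0// sqrtr_gt0.
Qed.

Lemma state_Delta_gt0 t : 0 < bDelta (s t).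
Proof. exact: Delta_gt0. Qed.

Let q_gt0 t : 0 < q t.
Proof. by rewrite invr_gt0 exprn_gt0. Qed.

Let qS t : q t.+1 = if res t then 2 * q t else q t.
Proof.
rewrite /q sS; case: ifP => _; rewrite /= midD//.
by rewrite expr_div_n sqr_sqrtr// invfM invrK mulrC.
Qed.

Let nresS t : nres t.+1 = (nres t + res t)%N.
Proof. by rewrite /nresets big_ord_recr. Qed.

Let q_nres t : q t = 2 ^+ nres t * q 0.
Proof.
elim: t => [|t IH]; first by rewrite /nresets big_ord0 mul1r.
by rewrite qS nresS IH; case: (res t); rewrite ?addn0// addn1 exprS mulrA.
Qed.

Definition data_ok (xi : R) (D : seq ('rV[R]_d * R)) := dataB Bx D /\ dataX lam xi D.

Let mid_data t i : data_ok (bDelta (s t) / eta) (bData (s t) i) ->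
  data_ok (bDelta (s t) / eta) (bData (mid t) i).
Proof.
move=> [hB hX]; rewrite /midstate_at /midstate; case: ifP => _ //=.
case e : (mcm _ i) => [j|//]; have [_ /(_ i j e) + _] := hmcm (explore_edges lam eta (s t) (xs t)).
rewrite inE /= => hw; split.
  by move=> p; rewrite mem_rcons inE => /orP[/eqP -> //=|/hB].
by apply: dataX_rcons => //; rewrite divr_ge0 ?ltW.
Qed.

Lemma state_data t i : data_ok (bDelta (s t) / eta) (bData (s t) i).
Proof.
elim: t => [|t IH].
  by split=> //; exact: dataX_nil.
rewrite sS; case: ifP => _ /=; first by split=> //; exact: dataX_nil.
by rewrite midD; exact: mid_data.
Qed.

Let mid_size t i : (size (bData (mid t) i) <= (size (bData (s t) i)).+1)%N.
Proof.
rewrite /midstate_at /midstate; case: ifP => _ //=.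
by case: (mcm _ i) => [j|//]; rewrite size_rcons.
Qed.

Lemma state_size t i : (size (bData (s t) i) <= t)%N.
Proof.
elim: t => [//|t IH]; rewrite sS; case: ifP => _ //=.
by apply: (leq_trans (mid_size t i)).
Qed.

Let mid_Nk t : bNk (mid t) = (bNk (s t) + cnt t)%N.
Proof.
rewrite /midstate_at /midstate /cnt -/(expl t); case: (expl t) => /=; first by rewrite addn0.
by case: ifP => _; rewrite ?addn1 ?addn0.
Qed.

Let s_Nk t : (bNk (s t) <= t)%N.
Proof.
elim: t => [//|t IH]; rewrite sS; case: ifP => _ //=; rewrite mid_Nk.
by case: (cnt t); rewrite ?addn1 ?addn0 ?ltnS// (leq_trans IH).
Qed.

Let lnT0 : 0 < ln (T%:R : R).
Proof. exact: lt_le_trans hlnT. Qed.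

Let resE t : res t = (3 * ln (T%:R : R) / 16 * q t < (bNk (mid t))%:R).
Proof. by rewrite /reset_at /newbatch midD /q invfM mulrA. Qed.

(** Either the last round failed the batch test, or it reset the counter to zero. *)
Let s_NkR t : (bNk (s t))%:R <= 3 * ln (T%:R : R) / 16 * q t.
Proof.
case: t => [|t]; first by rewrite /= !mulr_ge0 ?ltW.
have := resE t; rewrite sS qS; case: (res t) => /= [_|/esym/negbT].
  by rewrite !mulr_ge0 ?ltW.
by rewrite -leNgt.
Qed.

Let L := d%:R * ln (1 + T%:R * Bx ^+ 2 / lam).

Let mid_sizeR t i : (t < T)%N -> (size (bData (mid t) i))%:R <= L * (1 + eta ^+ 2 * q t).
Proof.
move=> tT; have [hB hX] := mid_data (state_data t i).
have := data_size_le hlam (divr_gt0 (Delta_gt0 t) heta) hB hX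
  (leq_trans (mid_size t i) (leq_trans (state_size t i : (_ < t.+1)%N) tT)).
by rewrite expr_div_n invf_div /q.
Qed.

Let L0 : 0 <= L.
Proof.
rewrite mulr_ge0// ln_ge0// lerDl divr_ge0 ?(ltW hlam)//.
by rewrite mulr_ge0 ?ler0n// exprn_even_ge0.
Qed.

(** A single available edge is a matching, so a maximum one is nonempty and every exploring round
    records at least one datum. *)
Let expl_size t : (\sum_i size (bData (s t) i) + expl t <= \sum_i size (bData (mid t) i))%N.
Proof.
rewrite /midstate_at /midstate -/(expl t); case: (boolP (expl t)) => he; rewrite /= ?addn0//.
set E := explore_edges lam eta (s t) (xs t) in he *.
have [i0 hi0] : exists i, mcm E i != None.
  have [_ _ hmax] := hmcm E.
  have /set0Pn [[i j] ij] := he.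
  pose m : matching N K := [ffun i' => if i' == i then Some j else None].
  have mE i' j' : m i' = Some j' -> i' = i /\ j' = j.
    by rewrite ffunE; case: (eqVneq i' i) => // -> [->].
  have hm : is_matching m.
    apply/forallP => i1; apply/forallP => i2; apply/forallP => j'; apply/implyP.
    by move=> /andP[/eqP/mE [-> _] /eqP/mE [-> _]].
  have hmE i' j' : m i' = Some j' -> (i', j') \in E by move=> /mE [-> ->].
  have m0 : (0 < #|[set i' | m i' != None]|)%N.
    by apply/card_gt0P; exists i; apply/mem_set; rewrite /= ffunE eqxx.
  by have /card_gt0P [i' /set_mem] := leq_trans m0 (hmax m hm hmE); exists i'.
rewrite (bigD1 i0)//= [X in (_ <= X)%N](bigD1 i0)//=.
rewrite addnAC; apply: leq_add.
  by move: hi0; case: (mcm E i0) => [j|//] _; rewrite size_rcons addn1.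
by apply: leq_sum => i _; case: (mcm E i) => [j|//]; rewrite size_rcons.
Qed.

Let Q := L *+ N.

(** A completed batch with value [q] costs at most [Q * (1 + eta ^ 2 * q)]; as [q] doubles, these
    values sum to [q t - q 0]. The current batch is measured by the data it holds. *)
Let expl_count t : (t <= T)%N -> (\sum_(r < t) expl r)%:R <=
  Q * ((nres t)%:R + eta ^+ 2 * (q t - q 0)) + (\sum_i size (bData (s t) i))%:R.
Proof.
elim: t => [_|t IH tT]; first by rewrite !big_ord0 /nresets big_ord0 subrr mulr0 addr0 mulr0 add0r ler0n.
have {}IH := IH (ltnW tT); rewrite (sum_ordS (fun r => expl r)) natrD.
have h1 : (\sum_i size (bData (s t) i))%:R + (expl t)%:R <= (\sum_i size (bData (mid t) i))%:R :> R.
  by rewrite -natrD ler_nat expl_size.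
rewrite nresS qS sS; case: (res t) => /=; last by rewrite addn0; lra.
have h2 : (\sum_i size (bData (mid t) i))%:R <= Q * (1 + eta ^+ 2 * q t).
  rewrite natr_sum /Q mulrnAl -[in X in _ *+ X](card_ord N) -sumr_const.
  by apply: ler_sum => i _; exact: mid_sizeR.
rewrite sum_nat_const muln0 natrD.
by lra.
Qed.

(** The same geometric sum. The term [nres t] pays for the one counted round by which each completed
    batch exceeds its threshold. *)
Let cnt_count t : (\sum_(r < t) cnt r)%:R <=
  (nres t)%:R + 3 * ln (T%:R : R) / 16 * (q t - q 0) + (bNk (s t))%:R.
Proof.
elim: t => [|t IH]; first by rewrite !big_ord0 /nresets big_ord0 subrr mulr0 !add0r.
rewrite (sum_ordS (fun r => cnt r)) natrD nresS qS sS.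
have h1 := s_NkR t; have h2 : (cnt t)%:R <= 1 :> R by case: (cnt t).
case: (res t) => /=; last by rewrite mid_Nk !natrD; lra.
by rewrite addn1 -natr1; lra.
Qed.

Hypothesis hT32 : 32 * Delta1 ^+ 2 / 3 <= ln (T%:R : R).

Let nres_T t : (t <= T)%N -> 2 ^+ nres t <= T%:R :> R.
Proof.
have T1 : 1 <= T%:R :> R.
  by rewrite ler1n lt0n; apply/eqP => T0; move: hlnT; rewrite T0 ln0// ler10.
elim: t => [_|t IH tT]; first by rewrite /nresets big_ord0.
have {}IH := IH (ltnW tT); rewrite nresS.
have := resE t; case: (res t) => [/esym|_]; last by rewrite addn0.
rewrite addn1 exprS q_nres => h.
have hN : (bNk (mid t))%:R <= T%:R :> R.
  rewrite ler_nat mid_Nk (leq_trans _ tT)//.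
  by case: (cnt t); rewrite ?addn1 ?addn0 ?ltnS// (leq_trans (s_Nk t)).
have hq0 : q 0 = (Delta1 ^+ 2)^-1 by [].
have D0 : 0 < Delta1 ^+ 2 by rewrite exprn_gt0.
apply: (batch_doubling _ D0 _ hT32); first exact: exprn_ge0.
by apply: lt_le_trans hN; rewrite -hq0.
Qed.

Lemma nres_le t : (t <= T)%N -> (nres t)%:R <= 2 * ln (T%:R : R).
Proof.
move=> tT; have h := nres_T tT.
have h2 : (nres t)%:R * ln 2 <= ln (T%:R : R).
  rewrite mulr_natl -lnXn// ler_ln ?posrE ?exprn_gt0//.
  by apply: lt_le_trans h; rewrite exprn_gt0.
have : (nres t)%:R * 2^-1 <= (nres t)%:R * ln (2 : R) by rewrite ler_wpM2l// ln2_ge_half.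
move: (ln (T%:R : R)) h2 => l {h}; move: ((nres t)%:R : R) (_ * ln 2) => a b; lra.
Qed.

Hypothesis hetaE : sg * Num.sqrt (d%:R * ln ((1 + T%:R * Bx ^+ 2 / lam) * T%:R ^+ 2)) + Num.sqrt lam * Btheta <= eta.

(** Without exploration every context has norm at most [Delta / eta], and the confidence radius is
    at most [eta]: the product is [Delta]. *)
Let conf t : ~~ bad t -> ~~ expl t -> forall i j, `|Uhat lam (s t) (xs t) i j - U t i j| <= bDelta (s t).
Proof.
move=> hb he i j; rewrite /Uhat /Utrue -ipBl.
apply: (le_trans (thetahat_conf hlam _ _ (htheta i))).
have hw : wnorm lam (bData (s t) i) (xs t j) <= bDelta (s t) / eta.
  rewrite leNgt; apply: contra he => hw; apply/set0Pn; exists (i, j).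
  by rewrite inE.
have hS : Num.sqrt (iform lam (bData (s t) i) (resid (theta i) (bData (s t) i)) (resid (theta i) (bData (s t) i)))
   <= sg * Num.sqrt (d%:R * ln ((1 + T%:R * Bx ^+ 2 / lam) * T%:R ^+ 2)).
  move: hb; rewrite negb_exists => /forallP/(_ i); rewrite /conf_fail -leNgt => h.
  by rewrite -[sg](ger0_norm hsg) -sqrtr_sqr -sqrtrM ?sqr_ge0// ler_wsqrtr.
apply: (@le_trans _ _ (eta * (bDelta (s t) / eta))).
  apply: ler_pM => //; rewrite ?sqrtr_ge0//.
    rewrite addr_ge0 ?sqrtr_ge0// mulr_ge0 ?sqrtr_ge0//.
    by apply: le_trans (htheta i); rewrite sqrtr_ge0.
  by apply: le_trans hetaE; rewrite lerD2r.
by rewrite mulrC mulfVK ?gt_eqF.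
Qed.

Definition anomalies t : R := (\sum_(r < t) (near r + bad r))%:R.
Local Notation H := anomalies.

Let HS t : H t.+1 = H t + (near t)%:R + (bad t)%:R.
Proof. by rewrite /anomalies (sum_ordS (fun r => near r + bad r)%N) !natrD addrA. Qed.

Let H0 t : 0 <= H t.
Proof. by rewrite ler0n. Qed.

Let cnt_near t : bDelta (s t) <= tau -> (cnt t)%:R <= (near t)%:R + (bad t)%:R :> R.
Proof.
move=> hD; rewrite -natrD ler_nat; case: (boolP (cnt t)) => //= /andP[he hg].
case: (boolP (bad t)) => hb; first by rewrite addn1.
rewrite addn0 lt0b; have [i [j [j' [jj' hle]]]] := gapcond_close_true hg (conf hb he).
apply/close_pairP; exists i, j, j'; split=> //; rewrite ipBr.
by apply: (le_trans hle); rewrite ler_pM2l.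
Qed.

Let Nk_H t : bDelta (s t) <= tau -> (bNk (s t))%:R <= H t.
Proof.
elim: t => [_|t IH]; first by rewrite /anomalies big_ord0.
rewrite sS; case: (res t) => /= [_|]; first by rewrite H0.
rewrite midD mid_Nk natrD HS => hD; have := IH hD; have := cnt_near hD; lra.
Qed.

(** Only a reset raises [q]. If [Delta > tau], the doubled value is at most [2 / tau ^ 2]. Otherwise
    the whole batch was run at this gap, so its counted rounds are all anomalies and exceed
    [3 * ln T / 16 * q]; this gives [2 * q <= 32 / (3 * ln T) * H]. *)
Let q_le t : q t <= q 0 + 2 / tau ^+ 2 + 32 / (3 * ln (T%:R : R)) * H t.
Proof.
have c0 : 0 <= 32 / (3 * ln (T%:R : R)) by rewrite divr_ge0// mulr_ge0// ltW.
have t0 : 0 < tau ^+ 2 by rewrite exprn_gt0.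
elim: t => [|t IH].
  rewrite -addrA lerDl. apply: addr_ge0; [by rewrite divr_ge0 ?ltW|by rewrite mulr_ge0].
have HSge : H t <= H t.+1 by rewrite HS -addrA lerDl addr_ge0.
have {HSge}HSge : 32 / (3 * ln (T%:R : R)) * H t <= 32 / (3 * ln (T%:R : R)) * H t.+1.
  by rewrite ler_wpM2l.
rewrite qS; have := resE t; case: (res t) => [/esym h|_]; last by lra.
have [hD|hD] := leP (bDelta (s t)) tau; last first.
  have : q t <= (tau ^+ 2)^-1.
    rewrite lef_pV2 ?posrE ?exprn_gt0// ler_sqr ?nnegrE ?ltW//.
  have := q_gt0 0; have : 0 <= 32 / (3 * ln (T%:R : R)) * H t.+1 by rewrite mulr_ge0.
  lra.
have h2 : (bNk (mid t))%:R <= H t.+1.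
  by rewrite mid_Nk natrD HS; have := Nk_H hD; have := cnt_near hD; lra.
have h3 : 2 * q t <= 32 / (3 * ln (T%:R : R)) * H t.+1.
  rewrite mulrAC ler_pdivlMr ?mulr_gt0//; move: (lt_le_trans h h2); lra.
have := q_gt0 0; have : 0 < 2 / tau ^+ 2 by rewrite divr_gt0.
lra.
Qed.

Let U_le t i j : `|U t i j| <= 2^-1.
Proof.
apply: (le_trans (ip_vnorm _ _)).
apply: (@le_trans _ _ (Btheta * Bx)); last by move: hBy; lra.
by apply: ler_pM; rewrite ?sqrtr_ge0.
Qed.

Let mval_le t i m : `|mval (U t) i m| <= 2^-1.
Proof. by rewrite /mval; case: (m i) => [j|]; [exact: U_le|rewrite normr0]. Qed.

Lemma Ustar_le t i : `|Ustar rk (U t) i| <= 2^-1.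
Proof.
rewrite /Ustar; case: pickP => [m0 _|_]; last by rewrite normr0.
elim/big_ind: _ => [|a b ha hb|m _]; [exact: mval_le| |exact: mval_le].
by rewrite /Num.max; case: ifP.
Qed.

Lemma regret_abs t i m : `|Ustar rk (U t) i - mval (U t) i m| <= 1.
Proof.
apply: (le_trans (ler_normB _ _)); have := Ustar_le t i; have := mval_le t i m; lra.
Qed.

Let regret_le t i : Ustar rk (U t) i - mval (U t) i (ch t) <= (expl t)%:R + (cnt t)%:R + (bad t)%:R.
Proof.
have h1 : Ustar rk (U t) i - mval (U t) i (ch t) <= 1.
  by have := regret_abs t i (ch t); rewrite ler_norml => /andP[].
have n0 (b : bool) : 0 <= b%:R :> R by exact: ler0n.
have := n0 (expl t); have := n0 (cnt t); have := n0 (bad t) => b0 c0 e0.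
move: h1; case: (boolP (expl t)) => [_|he]; first by rewrite /= mulr1n => h1; lra.
case: (boolP (bad t)) => [_|hb]; first by rewrite /= ?mulr0n ?mulr1n => h1; lra.
case: (boolP (cnt t)) => [_|hc]; first by rewrite /= ?mulr0n ?mulr1n => h1; lra.
move=> _.
have hg : ~~ gapcond lam (s t) (xs t) by move: hc; rewrite /cnt he.
rewrite !addr0 subr_le0 /barb_match /Defs.choose.
rewrite -/(expl t) (negbTE he).
apply: Ustar_GS => //; exact: (Ngapcond_agree hg (conf hb he)).
Qed.

(** Completed batches and the current one are each bounded through the same cap on [q]; hence
    [2 * eta ^ 2] and [3 / 8], twice [3 / 16]. *)
Lemma path_regret i :
  \sum_(t < T) (Ustar rk (U t) i - mval (U t) i (ch t)) <=
  let q := (Delta1 ^+ 2)^-1 + 2 / tau ^+ 2 + 32 / (3 * ln (T%:R : R)) * H T in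
  Q * (2 * ln (T%:R : R) + 1 + 2 * eta ^+ 2 * q) + 2 * ln (T%:R : R) + 3 * ln (T%:R : R) / 8 * q + H T.
Proof.
set qT := _ + _ + _ => /=.
have hq : q T <= qT by exact: q_le.
apply: (@le_trans _ _ ((\sum_(r < T) expl r)%:R + (\sum_(r < T) cnt r)%:R + H T)).
  rewrite /anomalies !natr_sum -!big_split /=; apply: ler_sum => t _.
  apply: (le_trans (regret_le t i)); rewrite natrD.
  by have : 0 <= (near t)%:R :> R by []; lra.
have h1 := expl_count (leqnn T); have h2 := cnt_count T; have h3 := nres_le (leqnn T).
have h4 := s_NkR T; have hq0 := q_gt0 0.
have Q0 : 0 <= Q by rewrite mulrn_wge0.
have h5 : (\sum_i size (bData (s T) i))%:R <= Q * (1 + eta ^+ 2 * q T).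
  rewrite natr_sum /Q mulrnAl -[in X in _ *+ X](card_ord N) -sumr_const.
  apply: ler_sum => i' _; have [hB hX] := state_data T i'.
  have := data_size_le hlam (divr_gt0 (Delta_gt0 T) heta) hB hX (state_size T i').
  by rewrite expr_div_n invf_div /q.
have e0 : 0 <= eta ^+ 2 by rewrite sqr_ge0.
have h6 : Q * ((nres T)%:R + eta ^+ 2 * (q T - q 0)) <= Q * (2 * ln (T%:R : R) + eta ^+ 2 * qT).
  apply: ler_wpM2l => //; apply: lerD => //; apply: ler_wpM2l => //; lra.
have h7 : Q * (1 + eta ^+ 2 * q T) <= Q * (1 + eta ^+ 2 * qT).
  by apply: ler_wpM2l => //; rewrite lerD2l ler_wpM2l.
have h8 : 3 * ln (T%:R : R) / 16 * (q T - q 0) <= 3 * ln (T%:R : R) / 16 * qT.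
  by apply: ler_wpM2l; [rewrite !mulr_ge0 ?ltW|lra].
have h9 : 3 * ln (T%:R : R) / 16 * q T <= 3 * ln (T%:R : R) / 16 * qT.
  by apply: ler_wpM2l => //; rewrite !mulr_ge0 ?ltW.
lra.
Qed.

End Path.

(** * Noise and the self-normalized supermartingale *)

Lemma expR_le_2x (R : realType) (x : R) : 0 <= x -> x <= 2^-1 -> expR x <= 1 + 2 * x.
Proof.
move=> x0 x1; have h1 : 1 - x <= expR (- x) by have := expR_ge1Dx (- x).
have h2 : expR x * (1 - x) <= 1.
  by rewrite -[leRHS](expRxMexpNx_1 x) ler_wpM2l ?expR_ge0.
have x2 : 0 < 1 - x by lra.
rewrite -(ler_pM2r x2); apply: (le_trans h2).
have : 0 <= x * (1 - 2 * x) by rewrite mulr_ge0//; lra.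
by lra.
Qed.

(** Splits a quantity of the played arm over fixed arms, so that facts about one arm on an event of
    the history can be used. *)
Lemma option_case_patch (R : realType) K (O : Type) (g : O -> option 'I_K) (f : 'I_K -> O -> R) w :
  (if g w is Some j then f j w else 0)%:E =
  (\sum_(j < K) ((fun w => (f j w)%:E) \_ [set w | g w = Some j]) w)%E.
Proof.
case e : (g w) => [j|].
  rewrite (bigD1 j)//= big1 ?adde0 => [|k kj]; rewrite patchE.
    by rewrite mem_set.
  by rewrite memNset//= e => -[ejk]; rewrite ejk eqxx in kj.
by rewrite big1// => j _; rewrite patchE memNset//= e.
Qed.

Section Stochastic.
Variables (R : realType) (N K d : nat) (rk : 'I_K -> 'I_N -> nat).
Variable theta : 'I_N -> 'rV[R]_d.
Variables (dO : measure_display) (O : measurableType dO) (P : probability O R).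
Variables (X : nat -> O -> 'I_K -> 'rV[R]_d) (E : nat -> O -> 'I_N -> 'I_K -> R).
Hypothesis hXmeas : forall t j k, measurable_fun setT (fun w => X t w j ord0 k).
Hypothesis hEmeas : forall t i j, measurable_fun setT (fun w => E t w i j).
Variables (T : nat) (lam eta Delta1 : R) (mcm : {set 'I_N * 'I_K} -> matching N K).
Hypotheses (hlam : 0 < lam).

Local Notation xs w := (fun t => X t w).
Local Notation es w := (fun t => E t w).
Local Notation s t w := (bstate_at rk T lam eta mcm Delta1 theta (xs w) (es w) t).
Local Notation ch t w := (barb_match rk T lam eta mcm Delta1 theta (xs w) (es w) t).
Local Notation mid t w := (midstate_at rk T lam eta mcm Delta1 theta (xs w) (es w) t).
Local Notation res t w := (reset_at rk T lam eta mcm Delta1 theta (xs w) (es w) t).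

Definition hist_gen t : set (set O) := [set A | exists2 q, @idx_hist N K d t q &
  exists2 B : set R, measurable B & A = allc X E q @^-1` B].
Local Notation Om t := (g_sigma_algebraType (hist_gen t)).

Lemma hist_sub t : <<s hist_gen t>> `<=` (measurable : set (set O)).
Proof.
apply: smallest_sub; first exact: sigma_algebra_measurable.
move=> _ [q _ [B mB ->]]; rewrite -[X in measurable X]setTI.
case: q => q; first exact: hXmeas.
exact: hEmeas.
Qed.

Lemma mmx_X t j : mmx (fun w => X t w j).
Proof. by move=> i k; rewrite (ord1 i). Qed.

Lemma hist_X t r j : (r <= t)%N -> mmx (fun w : Om t => X r w j).
Proof.
move=> rt i k; rewrite (ord1 i) => _ B mB; rewrite setTI; apply: sub_sigma_algebra.
by exists (inl (r, j, k)) => //; exists B.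
Qed.

Lemma hist_E t r i j : (r < t)%N -> measurable_fun setT (fun w : Om t => E r w i j).
Proof.
move=> rt _ B mB; rewrite setTI; apply: sub_sigma_algebra.
by exists (inr (r, i, j)) => //; exists B.
Qed.

Lemma hist_state t : mstate lam (fun w : Om t => s t w).
Proof.
apply: mstate_at => // r *; first by apply: hist_X; exact: ltnW.
exact: hist_E.
Qed.

Lemma mstate_all t : mstate lam (fun w : O => s t w).
Proof. by apply: mstate_at => // *; exact: mmx_X. Qed.

Lemma hist_match t : mdisc (fun w : Om t => ch t w).
Proof. by apply: mdisc_choose => //; [exact: hist_state|move=> j; exact: hist_X]. Qed.

Lemma mdisc_hist (A : Type) t (f : O -> A) : mdisc (f : Om t -> A) -> mdisc (f : O -> A).
Proof. by move=> mf v; apply: (@hist_sub t); exact: mf. Qed.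

Lemma mdisc_match t : mdisc (fun w : O => ch t w).
Proof. exact: (mdisc_hist (@hist_match t)). Qed.

Lemma mdisc_reset t : mdisc (fun w : O => res t w).
Proof.
apply: mdisc_newbatch; apply: mstate_mid => //; first exact: mstate_all.
by move=> j; exact: mmx_X.
Qed.

(** * Centering of the noise and the supermartingale step *)

Section Noise.
Variable sg : R.
Hypothesis hEsubg : forall t i j (u : R) (A : set O), <<s hist_gen t>> A ->
   (\int[P]_(w in A) (expR (u * E t w i j))%:E <= (expR (u ^+ 2 * sg ^+ 2 / 2))%:E * P A)%E.

Lemma integrable_noise t i j : P.-integrable setT (fun w => (E t w i j)%:E).
Proof.
have m1 : measurable_fun setT (fun w => (expR (1 * E t w i j))%:E).
  by apply/measurable_EFinP; apply: measurableT_comp => //; exact: measurable_funM.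
have m2 : measurable_fun setT (fun w => (expR (-1 * E t w i j))%:E).
  by apply/measurable_EFinP; apply: measurableT_comp => //; exact: measurable_funM.
have hI u : (u = 1 \/ u = -1) -> measurable_fun setT (fun w => (expR (u * E t w i j))%:E) ->
   P.-integrable setT (fun w => (expR (u * E t w i j))%:E).
  move=> _ mu; apply/integrableP; split => //.
  under eq_integral do rewrite gee0_abs ?lee_fin ?expR_ge0//.
  have := @hEsubg t i j u _ (@measurableT _ (Om t)).
  by move=> /le_lt_trans; apply; rewrite probability_setT mule1 ltry.
have i1 := hI 1 (or_introl erefl) m1; have i2 := hI (-1) (or_intror erefl) m2.
apply: (le_integrable measurableT _ _ (integrableD measurableT i1 i2)).
  by apply/measurable_EFinP.
move=> w _; rewrite /= lee_fin mul1r mulN1r [leRHS]ger0_norm ?addr_ge0 ?expR_ge0//.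
have h1 := @expR_ge1Dx R (E t w i j); have h2 := @expR_ge1Dx R (- E t w i j).
have := @expR_gt0 R (E t w i j); have := @expR_gt0 R (- E t w i j).
by rewrite ler_norml => ? ?; apply/andP; split; lra.
Qed.

(** Centering follows from the exponential bound: [1 + x <= expR x] gives [u * I <= (expR (u ^ 2 *
    sg ^ 2 / 2) - 1) * P A] for every real [u]. The right side is quadratic near zero and the left
    linear, so [I = 0]. *)
Lemma noise_mean0 t i j A : <<s hist_gen t>> A -> (\int[P]_(w in A) (E t w i j)%:E = 0)%E.
Proof.
move=> hA; have mA : measurable A := hist_sub hA.
have iE : P.-integrable A (fun w => (E t w i j)%:E).
  by apply: (integrableS measurableT) => //; exact: integrable_noise.
have fE : (\int[P]_(w in A) (E t w i j)%:E)%E \is a fin_num by exact: integrable_fin_num.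
set I := (\int[P]_(w in A) (E t w i j)%:E)%E in fE *.
have PA1 : (P A <= 1)%E by exact: probability_le1.
have PAf : P A \is a fin_num by exact: fin_num_measure.
have key u : u * fine I + fine (P A) <= expR (u ^+ 2 * (sg ^+ 2 / 2)) * fine (P A).
  rewrite mulrA.
  have mexp : measurable_fun A (fun w => (expR (u * E t w i j))%:E).
    apply: measurable_funTS; apply/measurable_EFinP; apply: measurableT_comp => //.
    exact: measurable_funM.
  have iu : P.-integrable A (fun w => (expR (u * E t w i j))%:E).
    apply/integrableP; split => //.
    under eq_integral do rewrite gee0_abs ?lee_fin ?expR_ge0//.
    apply: le_lt_trans (@hEsubg t i j u _ hA) _.
    by rewrite -(fineK PAf) -EFinM ltry.
  have i1 : P.-integrable A (fun w => (u * E t w i j)%:E).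
    under eq_fun do rewrite EFinM; exact: integrableZl.
  have c1 : P.-integrable A (fun w => 1%:E) by exact: finite_measure_integrable_cst.
  have h : (\int[P]_(w in A) ((u * E t w i j)%:E + 1%:E) <= \int[P]_(w in A) (expR (u * E t w i j))%:E)%E.
    apply: le_integral => //; first exact: integrableD.
    by move=> w _; rewrite -EFinD lee_fin addrC expR_ge1Dx.
  move: h; rewrite integralD// => /le_trans/(_ (@hEsubg t i j u _ hA)).
  rewrite integral_cst// mul1e.
  under eq_integral do rewrite EFinM.
  by rewrite integralZl// -/I -lee_fin EFinD !EFinM !fineK.
suff : fine I = 0 by move=> h; rewrite -(fineK fE) h.
have p0 : 0 <= fine (P A) by rewrite fine_ge0.
have p1 : fine (P A) <= 1 by rewrite -lee_fin fineK.
apply/eqP; apply: contraT => ne.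
have I0 : 0 < fine I ^+ 2 by rewrite exprn_even_gt0.
have k0 : 0 <= sg ^+ 2 / 2 by rewrite divr_ge0 ?sqr_ge0.
move: (fine I) (fine (P A)) (sg ^+ 2 / 2) I0 k0 p0 p1 key => a p k I0 k0 p0 p1 key.
(* At [u = a / D] the left side is [a ^ 2 / D], while this [D] keeps the exponent below a quarter of
   that value and below [1 / 2]. The right side is then at most half of the left one. *)
pose D := 4 * (k + 1) * (a ^+ 2 + 1).
have k1 : 0 < k + 1 by lra.
have a1 : 0 < a ^+ 2 + 1 by lra.
have D0 : 0 < D by rewrite !mulr_gt0.
have ka : 0 <= k * a ^+ 2 by rewrite mulr_ge0// ltW.
have h1 : k / D <= 4^-1 by rewrite ler_pdivrMr// /D; lra.
have h2 : a ^+ 2 / D <= 4^-1 by rewrite ler_pdivrMr// /D; lra.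
have := key (a / D).
have xE : (a / D) ^+ 2 * k = k / D * (a ^+ 2 / D) by field; rewrite gt_eqF.
rewrite xE; set x := k / D * (a ^+ 2 / D).
have aD : 0 < a ^+ 2 / D by rewrite divr_gt0.
have x0 : 0 <= x by rewrite mulr_ge0 ?(ltW aD)// divr_ge0// ltW.
have x1 : x <= 4^-1 * (a ^+ 2 / D) by rewrite ler_wpM2r// ltW.
have hx := @expR_le_2x R x x0; move=> hk.
have h3 : (expR x - 1) * p <= (expR x - 1) * 1.
  by apply: ler_wpM2l => //; rewrite subr_ge0 -(expR0 R) ler_expR.
have h4 : expR x <= 1 + 2 * x by apply: hx; lra.
have h5 : a / D * a = a ^+ 2 / D by rewrite mulrAC expr2.
move: hk; rewrite h5; lra.
Qed.

Definition chosen_noise t i w : R := if ch t w i is Some j then E t w i j else 0.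

Let noiseE t i w : (chosen_noise t i w)%:E =
  (\sum_(j < K) ((fun w => (E t w i j)%:E) \_ [set w | ch t w i = Some j]) w)%E.
Proof. exact: (option_case_patch (fun w => ch t w i) (fun j w => E t w i j)). Qed.

Let hist_choice t i j : <<s hist_gen t>> [set w | ch t w i = Some j].
Proof. exact: (@mdisc_fun _ (Om t) _ _ _ (fun m : matching N K => m i) (@hist_match t)). Qed.

Let integrable_choice t i j :
  P.-integrable setT ((fun w => (E t w i j)%:E) \_ [set w | ch t w i = Some j]).
Proof.
have mA : measurable [set w | ch t w i = Some j] := hist_sub (@hist_choice t i j).
have [h _] := integrable_restrict P mA measurableT
  (fun w => (E t w i j)%:E).
by apply: h; rewrite setTI; apply: (integrableS measurableT) => //; exact: integrable_noise.
Qed.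

Lemma integrable_chosen_noise t i : P.-integrable setT (fun w => (chosen_noise t i w)%:E).
Proof.
under eq_fun do rewrite noiseE.
by apply: integrable_sum => // j _; exact: integrable_choice.
Qed.

Lemma integral_chosen_noise t i : (\int[P]_w (chosen_noise t i w)%:E = 0)%E.
Proof.
under eq_integral do rewrite noiseE.
rewrite integral_sum//; first by rewrite big1// => j _; rewrite -integral_mkcond; exact: noise_mean0.
Qed.

Hypotheses (sgp : 0 < sg) (heta : 0 < eta) (hDelta1 : 0 < Delta1) (hmcm : is_mcm mcm).

(** The arm whose observation is recorded, as opposed to the arm played: Gale-Shapley rounds add no
    data. *)
Let oc t i w : option 'I_K :=
  if explore_edges lam eta (s t w) (X t w) != finset.set0
  then mcm (explore_edges lam eta (s t w) (X t w)) i else None.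

Let mid_dataE t i w : bData (mid t w) i =
  if oc t i w is Some j then rcons (bData (s t w) i) (X t w j, ip (theta i) (X t w j) + E t w i j)
  else bData (s t w) i.
Proof.
rewrite /midstate_at /midstate /oc; case: ifP => // he /=.
case e : (mcm _ i) => [j|//].
by rewrite /barb_y /barb_match /Defs.choose he /obs e.
Qed.

Let hist_oc t i : mdisc (fun w : Om t => oc t i w).
Proof.
apply: mdisc_if; last exact: mdisc_cst.
  by apply: mdisc_explores => //; [exact: hist_state|move=> j; exact: hist_X].
have h := @mdisc_explore_edges _ _ (Om t) N K d lam hlam (fun w => s t w) (fun w => X t w) (hist_state t)
  (fun j => hist_X j (leqnn t)) eta.
exact: (@mdisc_fun _ (Om t) _ _ _ (fun A => mcm A i) h).
Qed.

Lemma measurable_selfnorm d' (Z : measurableType d') (D : Z -> seq ('rV[R]_d * R)) th :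
  mdata lam D -> measurable_fun setT (fun w => selfnorm lam sg th (D w)).
Proof.
move=> mD; apply: measurable_funM.
  apply: measurable_fun_sqrt; apply: measurable_funM => //; apply: measurable_funV.
  by apply: measurable_det; case: mD.
apply: measurableT_comp => //; apply: measurable_funM => //.
by apply: measurable_iform => //; apply: (@mmx_resid _ _ _ _ lam).
Qed.

(** The recorded arm is determined by the history, so the expectation splits over its values. On
    each piece the update ratio is the one of [quadratic_subgaussian], and where nothing is recorded
    the value is unchanged. *)
Lemma selfnorm_supermartingale t i :
  (\int[P]_w (selfnorm lam sg (theta i) (bData (mid t w) i))%:E <=
   \int[P]_w (selfnorm lam sg (theta i) (bData (s t w) i))%:E)%E.
Proof.
pose Psi w := selfnorm lam sg (theta i) (bData (s t w) i).
have Psi0 w : 0 <= Psi w by apply: selfnorm_ge0.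
have mdat : mdata lam (fun w : Om t => bData (s t w) i) by apply: ms_data; exact: hist_state.
have mPsi : measurable_fun [set: Om t] (Psi : Om t -> R) by apply: measurable_selfnorm.
have mPsiO : measurable_fun [set: O] Psi by apply: sub_measurable_fun mPsi; exact: hist_sub.
pose Z o w := if oc t i w == o then Psi w else 0.
have Z0 o w : 0 <= Z o w by rewrite /Z; case: ifP.
have mb o : mdisc (fun w : Om t => oc t i w == o).
  exact: (@mdisc_fun _ (Om t) _ _ _ (fun o' => o' == o) (@hist_oc t i)).
have mZ o : measurable_fun [set: Om t] (Z o : Om t -> R) by apply: measurable_fun_mdisc_if.
have mZO o : measurable_fun [set: O] (Z o) by apply: sub_measurable_fun (mZ o); exact: hist_sub.
have sumZ w : Psi w = \sum_o Z o w.
  rewrite (bigD1 (oc t i w))//= big1 ?addr0 /Z ?eqxx// => o; rewrite eq_sym => /negbTE ->.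
  by [].
pose D w := bData (s t w) i.
pose m j w := iform lam (D w) (resid (theta i) (D w)) (X t w j).
(* The mixture bound wants a positive [w] everywhere. On the event this is the exploration
   threshold; off it the weight [Z] vanishes and [1] is a harmless default. *)
pose v j w := if oc t i w == Some j then iform lam (D w) (X t w j) (X t w j) else 1.
pose step j w := expR ((2 * E t w i j * m j w + E t w i j ^+ 2 * v j w - m j w ^+ 2)
   / (2 * sg ^+ 2 * (1 + v j w))) / Num.sqrt (1 + v j w).
pose G o w := if o is Some j then Z o w * step j w else Z o w.
have v0 j w : 0 < v j w.
  rewrite /v; case: eqP => [|//]; rewrite /oc; case: ifP => // _ e.
  have [_ /(_ i j e) + _] := hmcm (explore_edges lam eta (s t w) (X t w)).
  rewrite inE /= wnormE => hlt; rewrite -sqrtr_gt0; apply: le_lt_trans hlt.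
  by rewrite divr_ge0 ?(ltW heta)// ltW// state_Delta_gt0.
have mX j : mmx (fun w : Om t => X t w j) by apply: hist_X.
have mres : mmx (fun w : Om t => resid (theta i) (D w)) by apply: (@mmx_resid _ _ _ _ lam).
have mm j : measurable_fun [set: Om t] (m j : Om t -> R) by apply: measurable_iform.
have mv j : measurable_fun [set: Om t] (v j : Om t -> R).
  by apply: measurable_fun_mdisc_if => //; apply: measurable_iform.
have GE w : selfnorm lam sg (theta i) (bData (mid t w) i) = \sum_o G o w.
  rewrite mid_dataE (bigD1 (oc t i w))//= big1 ?addr0 => [|o]; last first.
    by rewrite eq_sym /G /Z; case: o => [j|] /negbTE ->; rewrite ?mul0r.
  rewrite /G /Z eqxx; case e : (oc t i w) => [j|//].
  by rewrite selfnorm_rcons// /step /m /v e eqxx.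
have G0 o w : 0 <= G o w.
  by rewrite /G; case: o => [j|//]; rewrite mulr_ge0// divr_ge0 ?expR_ge0 ?sqrtr_ge0.
have subO (f : O -> R) : measurable_fun [set: Om t] (f : Om t -> R) -> measurable_fun [set: O] f.
  by move=> mf; apply: sub_measurable_fun mf; exact: hist_sub.
have mG o : measurable_fun [set: O] (G o).
  case: o => [j|]; last exact: mZO.
  have mvO : measurable_fun [set: O] (v j) by exact: subO.
  have mmO : measurable_fun [set: O] (m j) by exact: subO.
  have m1v : measurable_fun [set: O] (fun w => 1 + v j w) by exact: measurable_funD.
  apply: measurable_funM; first exact: mZO.
  apply: measurable_funM; last by apply: measurable_funV; exact: measurable_fun_sqrt.
  apply: measurableT_comp => //; apply: measurable_funM.
    apply: measurable_funB; last exact: measurable_funX.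
    apply: measurable_funD; last by apply: measurable_funM => //; exact: measurable_funX.
    by apply: measurable_funM => //; exact: measurable_funM.
  by apply: measurable_funV; exact: measurable_funM.
under eq_integral do rewrite GE -sumEFin.
under [leRHS]eq_integral do rewrite -/(Psi _) sumZ -sumEFin.
rewrite !ge0_integral_sum//.
- apply: lee_sum => -[j|] _; last by [].
  exact: (@quadratic_subgaussian R _ O P (hist_gen t) (@hist_sub t) sg (fun w => E t w i j) sgp
     (hEmeas t i j) (fun u A => @hEsubg t i j u A) (Z (Some j)) (m j) (v j)).
- by move=> o; apply/measurable_EFinP; exact: mZO.
- by move=> o w _; rewrite lee_fin.
- by move=> o; apply/measurable_EFinP; exact: mG.
- by move=> o w _; rewrite lee_fin.
Qed.

(** A reset replaces a nonnegative value by [1], so it adds at most [1], whatever made it happen. *)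
Lemma selfnorm_growth t i :
  (\int[P]_w (selfnorm lam sg (theta i) (bData (s t w) i))%:E <=
   1 + \int[P]_w ((nresets rk T lam eta mcm Delta1 theta (xs w) (es w) t)%:R)%:E)%E.
Proof.
have mpsi r : measurable_fun setT (fun w => (selfnorm lam sg (theta i) (bData (s r w) i))%:E).
  by apply/measurable_EFinP; apply: measurable_selfnorm; apply: ms_data; exact: mstate_all.
have mmid r : measurable_fun setT (fun w => (selfnorm lam sg (theta i) (bData (mid r w) i))%:E).
  apply/measurable_EFinP; apply: measurable_selfnorm; apply: ms_data.
  by apply: mstate_mid => //; [exact: mstate_all|move=> j; exact: mmx_X].
have mres r : measurable_fun setT (fun w => ((res r w)%:R : R)%:E).
  apply/measurable_EFinP; rewrite (_ : (fun w => _) = (fun w => if res r w then 1 else 0)).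
    by apply: measurable_fun_mdisc_if => //; exact: mdisc_reset.
  by apply/funext => w; case: (res r w).
have mnres r : measurable_fun setT (fun w => ((nresets rk T lam eta mcm Delta1 theta (xs w) (es w) r)%:R : R)%:E).
  under eq_fun do rewrite /nresets natr_sum -sumEFin.
  by apply: emeasurable_sum => r'; exact: mres.
elim: t => [|t IH].
  apply: (@le_trans _ _ 1%E); last by rewrite leeDl// integral_ge0// => w _; rewrite lee_fin.
  have e1 : (\int[P]_w (cst 1%:E w) = 1)%E.
    by rewrite integral_cst// mul1e; exact: probability_setT.
  rewrite le_eqVlt; apply/orP; left; apply/eqP; rewrite -[RHS]e1.
  by apply: eq_integral => w _ /=; rewrite selfnorm_nil.
have h w : selfnorm lam sg (theta i) (bData (s t.+1 w) i) <=
   selfnorm lam sg (theta i) (bData (mid t w) i) + (res t w)%:R.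
  rewrite /= -/(mid t w) updateE -/(mid t w) /=.
  have -> : newbatch T (mid t w) = res t w by [].
  case: (res t w) => /=; last by rewrite addr0.
  have := selfnorm_ge0 lam sg (theta i) (bData (mid t w) i); rewrite selfnorm_nil//.
  by move: (selfnorm _ _ _ _) => z z0; lra.
apply: (@le_trans _ _ (\int[P]_w ((selfnorm lam sg (theta i) (bData (mid t w) i))%:E + ((res t w)%:R)%:E))%E).
  apply: ge0_le_integral => //.
  - by move=> w _; rewrite lee_fin selfnorm_ge0.
  - by apply: emeasurable_funD.
  - by move=> w _; rewrite -EFinD lee_fin.
rewrite ge0_integralD//; last by move=> w _; rewrite lee_fin selfnorm_ge0.
apply: (le_trans (leeD2r _ (le_trans (selfnorm_supermartingale t i) IH))).
rewrite -addeA leeD2l// -ge0_integralD//.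
rewrite le_eqVlt; apply/orP; left; apply/eqP; apply: eq_integral => w _.
by rewrite -EFinD -natrD /nresets (sum_ordS (fun r => res r w)).
Qed.

End Noise.
End Stochastic.

(** * Expected regret *)

Lemma bform_dim0 (R : realType) d (V : 'M[R]_d) u v : d = 0%N -> bform V u v = 0.
Proof.
move=> d0; rewrite /bform mxE big1// => k _.
by have := ltn_ord k; rewrite [X in (_ < X)%N]d0.
Qed.

(** A strict inequality survives a small enlargement of [a]; used to approach the noise level [sig]
    by larger ones. *)
Lemma sqr_perturb (R : realType) (a C z : R) : 0 <= a -> 0 <= C -> a ^+ 2 * C < z ->
  exists n : nat, (a + n.+1%:R^-1) ^+ 2 * C < z.
Proof.
move=> a0 C0 hz; pose g := z - a ^+ 2 * C; have g0 : 0 < g by rewrite subr_gt0.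
pose M := (2 * a + 1) * C + 1; have M0 : 0 < M by rewrite ltr_wpDl// mulr_ge0// addr_ge0// mulr_ge0.
exists (Num.truncn (M / g)); set n := Num.truncn _.
have hn : M / g < n.+1%:R by exact: truncnS_gt.
have h0 : 0 < n.+1%:R^-1 :> R by rewrite invr_gt0.
have h1 : n.+1%:R^-1 <= 1 :> R by rewrite invf_le1 ?ler1n.
have hM : M * n.+1%:R^-1 < g by rewrite ltr_pdivrMr// mulrC -ltr_pdivrMr.
move: (n.+1%:R^-1 : R) h0 h1 hM => h h0 h1 hM.
have h2 : h * h * C <= h * 1 * C by rewrite ler_wpM2r// ler_wpM2l// ltW.
rewrite /M /g in hM *; lra.
Qed.

Lemma obs_mval (R : realType) N K d (theta : 'I_N -> 'rV[R]_d) (x : 'I_K -> 'rV[R]_d) e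
    (m : matching N K) i :
  obs theta x e m i = mval (Utrue theta x) i m + (if m i is Some j then e i j else 0).
Proof. by rewrite /obs /mval; case: (m i) => [j|] //; rewrite addr0. Qed.

Section Expectation.
Variables (R : realType) (N K d : nat) (rk : 'I_K -> 'I_N -> nat).
Variables (theta : 'I_N -> 'rV[R]_d) (Bx : R).
Variables (dO : measure_display) (O : measurableType dO) (P : probability O R).
Variables (X : nat -> O -> 'I_K -> 'rV[R]_d) (E : nat -> O -> 'I_N -> 'I_K -> R).
Hypothesis hXmeas : forall t j k, measurable_fun setT (fun w => X t w j ord0 k).
Hypothesis hEmeas : forall t i j, measurable_fun setT (fun w => E t w i j).
Variables (T : nat) (lam eta Delta1 sig : R) (mcm : {set 'I_N * 'I_K} -> matching N K).
Hypotheses (hlam : 0 < lam) (hsig : 0 <= sig).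
Hypothesis hEsubg : forall t i j (u : R) (A : set O), <<s hist_gen X E t>> A ->
   (\int[P]_(w in A) (expR (u * E t w i j))%:E <= (expR (u ^+ 2 * sig ^+ 2 / 2))%:E * P A)%E.
Local Notation xs w := (fun t => X t w).
Local Notation es w := (fun t => E t w).
Local Notation s t w := (bstate_at rk T lam eta mcm Delta1 theta (xs w) (es w) t).

Definition good : set O := [set w | forall t j, vnorm (X t w j) <= Bx].

Lemma measurable_good : measurable good.
Proof.
rewrite (_ : good = \bigcap_t \bigcap_(j in [set: 'I_K]) [set w | vnorm (X t w j) <= Bx]).
  apply: bigcapT_measurable => t; apply: fin_bigcap_measurable => [|j _].
    exact: finite_finset.
  apply: measurable_bool; apply: mdisc_le => //; apply: measurable_fun_sqrt.
  by apply: measurable_ip; exact: mmx_X.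
apply/seteqP; split=> [w h t _ j _|w h t j]; first exact: h.
exact: (h t I j I).
Qed.

Hypothesis hgood : P (~` good) = 0%E.
Variables (Btheta : R) (htheta : forall i, vnorm (theta i) <= Btheta) (hBy : 2 * Btheta * Bx <= 1).

Definition regsum i w : R := \sum_(t < T)
  (Ustar rk (Utrue theta (X t w)) i
   - mval (Utrue theta (X t w)) i (barb_match rk T lam eta mcm Delta1 theta (xs w) (es w) t)).

Lemma measurable_regsum i : measurable_fun setT (regsum i).
Proof.
have mU t i' j : measurable_fun setT (fun w => Utrue theta (X t w) i' j).
  by apply: measurable_ip; [exact: mmx_cst|exact: mmx_X].
apply: measurable_sum => t; apply: measurable_funB; first exact: measurable_Ustar.
by apply: measurable_mval => //; exact: mdisc_match.
Qed.

(* The noise of the played arms has mean zero, so the regret only involves the utilities. *)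
Lemma expected_regret_le i (B : O -> R) : P.-integrable setT (EFin \o B) ->
  (forall w, 0 <= B w) -> (forall w, good w -> regsum i w <= B w) ->
  (\int[P]_w (\sum_(t < T) (Ustar rk (Utrue theta (X t w)) i
     - barb_y rk T lam eta mcm Delta1 theta (xs w) (es w) t i))%:E <= \int[P]_w (B w)%:E)%E.
Proof.
move=> iB B0 hB.
pose nz w : R := \sum_(t < T) chosen_noise rk theta X E T lam eta Delta1 mcm t i w.
have inz : P.-integrable setT (EFin \o nz).
  rewrite (_ : EFin \o nz = fun w => (\sum_(t < T) (chosen_noise rk theta X E T lam eta Delta1 mcm t i w)%:E)%E).
    apply: integrable_sum => // t _; exact: (integrable_chosen_noise rk theta hXmeas hEmeas T eta Delta1 mcm hlam hEsubg).
  by apply/funext => w; rewrite /= sumEFin.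
have int_nz : (\int[P]_w (nz w)%:E = 0)%E.
  under eq_integral do rewrite -sumEFin.
  rewrite integral_sum//.
    by rewrite big1// => t _; exact: (integral_chosen_noise rk theta hXmeas hEmeas T eta Delta1 mcm hlam hEsubg).
  move=> t; exact: (integrable_chosen_noise rk theta hXmeas hEmeas T eta Delta1 mcm hlam hEsubg).
have mnz : measurable_fun setT nz by apply/measurable_EFinP; exact: measurable_int inz.
(* Outside [good] the contexts need not be bounded; the cut there makes [g] bounded by [T] and
   changes only a null set. *)
pose g w : R := regsum i w * \1_good w.
have mg : measurable_fun setT g.
  by apply: measurable_funM; [exact: measurable_regsum|exact: measurable_indic measurable_good].
have gE w : good w -> g w = regsum i w by move=> h; rewrite /g indicE mem_set// mulr1.
have gE0 w : ~ good w -> g w = 0 by move=> h; rewrite /g indicE memNset// mulr0.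
have gT w : `|g w| <= T%:R.
  have [h|h] := pselect (good w); last by rewrite gE0// normr0.
  rewrite gE// (le_trans (ler_norm_sum _ _ _))//.
  apply: (@le_trans _ _ (\sum_(t < T) 1)); last by rewrite sumr_const card_ord.
  apply: ler_sum => t _; exact: (regret_abs rk htheta hBy h).
have ig : P.-integrable setT (EFin \o g).
  apply: (@le_integrable _ _ _ _ _ measurableT _ (cst T%:R%:E)).
  - exact/measurable_EFinP.
  - by move=> w _; rewrite /= lee_fin (le_trans (gT w))// ler_norm.
  - exact: finite_measure_integrable_cst.
rewrite (@ae_eq_integral _ _ _ _ setT (fun w => (g w)%:E - (nz w)%:E)%E)//.
- rewrite integralB_EFin// int_nz sube0; apply: le_integral => //.
  move=> w _; rewrite lee_fin; have [h|h] := pselect (good w); last by rewrite gE0.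
  by rewrite gE// hB.
- apply/measurable_EFinP; rewrite (_ : (fun w => _) = (fun w => regsum i w - nz w)).
    by apply: measurable_funB => //; exact: measurable_regsum.
  apply/funext => w; rewrite /regsum /nz -sumrB; apply: eq_bigr => t _.
  by rewrite /barb_y obs_mval opprD addrA.
- by apply/measurable_EFinP; exact: measurable_funB.
exists (~` good); split=> //; first by apply: measurableC; exact: measurable_good.
move=> w /= h1 h2; apply: h1 => _; rewrite gE// -EFinB; congr EFin.
rewrite /regsum /nz -sumrB; apply: eq_bigr => t _.
by rewrite /barb_y obs_mval opprD addrA.
Qed.

Hypotheses (heta : 0 < eta) (hDelta1 : 0 < Delta1) (hmcm : is_mcm mcm).
Hypotheses (hlnT : 1 <= ln (T%:R : R)) (hT32 : 32 * Delta1 ^+ 2 / 3 <= ln (T%:R : R)).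

Definition bad_event (sg : R) t i : set O :=
  [set w | good w /\ conf_fail T lam theta Bx sg (bData (s t w) i) i].

Lemma measurable_bad_event sg t i : measurable (bad_event sg t i).
Proof.
apply: measurableI; first exact: measurable_good.
apply: (@measurable_bool _ O); apply: mdisc_lt => //.
have mD : mdata lam (fun w : O => bData (s t w) i) by apply: ms_data; exact: mstate_all.
by apply: measurable_iform => //; exact: (@mmx_resid _ _ _ _ lam).
Qed.

Let T1 : (0 < T)%N.
Proof. by rewrite lt0n; apply/eqP => T0; move: hlnT; rewrite T0 ln0// ler10. Qed.

(** Markov's inequality: [selfnorm] is at least [T] on the event, and its expectation is at most one
    plus the bound [2 * ln T] on resets. The strict [sig < sg] makes the variance proxy positive. *)
Lemma bad_event_prob_gt0 sg t i : sig < sg -> (t <= T)%N ->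
  (P (bad_event sg t i) <= ((1 + 2 * ln T%:R) / T%:R)%:E)%E.
Proof.
move=> sigsg tT; have sg0 : 0 < sg by apply: le_lt_trans sigsg.
have TR : 0 < T%:R :> R by rewrite ltr0n.
have l0 : 0 <= ln (T%:R : R) by apply: le_trans hlnT.
(* In dimension zero both sides of [conf_fail] vanish and the event is empty; [selfnorm_large]
   covers the rest. *)
have [d0|d0] := posnP d.
  rewrite (_ : bad_event _ _ _ = set0) ?measure0 ?lee_fin ?divr_ge0 ?addr_ge0 ?mulr_ge0//.
  apply/seteqP; split=> // w [_]; rewrite /conf_fail /iform bform_dim0//.
  by rewrite (_ : d%:R = 0) ?mul0r ?mulr0 ?ltxx// d0.
have hsub t' i' j' (u : R) (A : set O) : <<s hist_gen X E t'>> A ->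
   (\int[P]_(w in A) (expR (u * E t' w i' j'))%:E <= (expR (u ^+ 2 * sg ^+ 2 / 2))%:E * P A)%E.
  move=> hA; apply: (le_trans (@hEsubg _ _ _ _ _ hA)).
  rewrite lee_wpmul2r// lee_fin ler_expR ler_wpM2r// ler_wpM2l ?sqr_ge0//.
  by rewrite ler_sqr ?nnegrE// ltW.
have hmc : forall t i, measurable_fun setT (fun w => (selfnorm lam sg (theta i) (bData (s t w) i))%:E).
  move=> t' i'; apply/measurable_EFinP; apply: measurable_selfnorm => //.
  by apply: ms_data; exact: mstate_all.
have mB := measurable_bad_event sg t i.
have h1 : (T%:R%:E * P (bad_event sg t i) <= \int[P]_w (selfnorm lam sg (theta i) (bData (s t w) i))%:E)%E.
  rewrite -(setIT (bad_event sg t i)) -integral_indic// -ge0_integralZl_EFin//; last first.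
    by apply/measurable_EFinP; exact: measurable_indic.
  apply: ge0_le_integral => //.
  - apply/measurable_EFinP; apply: measurable_funM => //; exact: measurable_indic.
  move=> w _; rewrite -EFinM lee_fin indicE.
  case: (boolP (w \in _)) => [/set_mem [hg hb]|_]; last by rewrite mulr0 selfnorm_ge0.
  rewrite mulr1; have [hB _] := state_data rk T hlam heta hmcm theta hDelta1 (es w) hg t i.
  apply: (selfnorm_large hlam sg0 T1 d0 hB) => //.
  by apply: leq_trans tT; exact: state_size.
have h2 := selfnorm_growth rk theta hXmeas hEmeas T hlam hsub sg0 heta hDelta1 hmcm t i.
have h3 : (\int[P]_w ((nresets rk T lam eta mcm Delta1 theta (xs w) (es w) t)%:R)%:E <= (2 * ln T%:R)%:E)%E.
  have e1 : (\int[P]_w (cst (2 * ln (T%:R : R))%:E w) = (2 * ln (T%:R : R))%:E)%E.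
    by rewrite integral_cst// -[RHS]mule1; congr (_ * _)%E; exact: probability_setT.
  rewrite -e1; apply: ge0_le_integral => //.
  - apply/measurable_EFinP; under eq_fun do rewrite /nresets natr_sum.
    apply: measurable_sum => r; rewrite (_ : (fun w => _) = (fun w =>
        if reset_at rk T lam eta mcm Delta1 theta (xs w) (es w) r then 1 else 0)).
      by apply: measurable_fun_mdisc_if => //; exact: mdisc_reset.
    by apply/funext => w; case: reset_at.
  by move=> w _; rewrite /= lee_fin; exact: nres_le.
have h4 : (T%:R%:E * P (bad_event sg t i) <= (1 + 2 * ln T%:R)%:E)%E.
  apply: (le_trans h1); apply: (le_trans h2); rewrite EFinD; exact: leeD2l.
have Pf : P (bad_event sg t i) \is a fin_num by exact: fin_num_measure.
by move: h4; rewrite -(fineK Pf) -EFinM !lee_fin ler_pdivlMr// mulrC.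
Qed.

(** The level [sig] may be zero. The events at levels [sig + 1 / (n + 1)] increase to the event at
    [sig], and continuity from below passes the bound to the limit. *)
Lemma bad_event_prob t i : (t <= T)%N ->
  (P (bad_event sig t i) <= ((1 + 2 * ln T%:R) / T%:R)%:E)%E.
Proof.
move=> tT; pose sgn n := sig + n.+1%:R^-1.
have sgnP n : sig < sgn n by rewrite ltrDl invr_gt0.
have U : bad_event sig t i = \bigcup_n bad_event (sgn n) t i.
  have TR : 1 <= T%:R :> R by rewrite ler1n.
  have C0 : 0 <= d%:R * ln ((1 + T%:R * Bx ^+ 2 / lam) * T%:R ^+ 2).
    rewrite mulr_ge0// ln_ge0// mulr_ege1 ?exprn_ege1// lerDl divr_ge0 ?(ltW hlam)//.
    by rewrite mulr_ge0 ?ler0n// exprn_even_ge0.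
  apply/seteqP; split=> w; last first.
    move=> [n _ [hg hb]]; split=> //; apply: le_lt_trans hb.
    by rewrite ler_wpM2r// ler_sqr ?nnegrE ?(le_trans hsig)// ltW.
  move=> [hg]; rewrite /conf_fail; set z := iform _ _ _ _; set C := d%:R * _ in C0 *.
  move=> hb.
  by have [n hn] := sqr_perturb hsig C0 hb; exists n.
rewrite U; have mU : measurable (\bigcup_n bad_event (sgn n) t i).
  by apply: bigcup_measurable => n _; exact: measurable_bad_event.
have nd : {homo (fun n => bad_event (sgn n) t i) : n m / (n <= m)%N >-> (n <= m)%O}.
  move=> n m nm; apply/subsetPset => w [hg hb]; split=> //; apply: le_lt_trans hb.
  have TR : 1 <= T%:R :> R by rewrite ler1n.
  have C0 : 0 <= d%:R * ln ((1 + T%:R * Bx ^+ 2 / lam) * T%:R ^+ 2).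
    rewrite mulr_ge0// ln_ge0// mulr_ege1 ?exprn_ege1// lerDl divr_ge0 ?(ltW hlam)//.
    by rewrite mulr_ge0 ?ler0n// exprn_even_ge0.
  rewrite ler_wpM2r// ler_sqr ?nnegrE ?(le_trans hsig) ?(ltW (sgnP _))//.
  by rewrite lerD2l lef_pV2 ?posrE// ler_nat.
have h := @nondecreasing_cvg_mu _ _ _ P (fun n => bad_event (sgn n) t i)
  (fun n => measurable_bad_event (sgn n) t i) mU nd.
rewrite -(cvg_lim _ h)//; apply: lime_le; first by apply/cvg_ex; eexists; exact: h.
by apply: nearW => n; exact: bad_event_prob_gt0.
Qed.

Hypotheses (hKN : (N <= K)%N) (hrk : forall j, injective (rk j)).
Hypothesis hetaE : sig * Num.sqrt (d%:R * ln ((1 + T%:R * Bx ^+ 2 / lam) * T%:R ^+ 2))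
  + Num.sqrt lam * Btheta <= eta.
Variables (tau p : R).
Hypotheses (htau : 0 < tau).
Hypothesis hnear : forall t, (P [set w | close_pair theta (4 * tau) (X t w)] <= p%:E)%E.

(** [A] collects the coefficient of the cap on [q] in [path_regret]. The pathwise bound being affine
    in the anomalies, only their expectation enters: [p] per round for near ties, and
    [(1 + 2 * l) / T] per round and player for confidence failures. *)
Lemma expected_regret i :
  let l := ln (T%:R : R) in
  let Q := d%:R * ln (1 + T%:R * Bx ^+ 2 / lam) *+ N in
  let A := 2 * Q * eta ^+ 2 + 3 * l / 8 in
  (\int[P]_w (\sum_(t < T) (Ustar rk (Utrue theta (X t w)) i
     - barb_y rk T lam eta mcm Delta1 theta (xs w) (es w) t i))%:E <=
   (Q * (2 * l + 1) + 2 * l + A * ((Delta1 ^+ 2)^-1 + 2 / tau ^+ 2)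
    + (A * (32 / (3 * l)) + 1) * (T%:R * p + N%:R * (1 + 2 * l)))%:E)%E.
Proof.
lazy zeta; set l := ln (T%:R : R); set Q := d%:R * ln (1 + T%:R * Bx ^+ 2 / lam) *+ N.
set A := 2 * Q * eta ^+ 2 + 3 * l / 8; have l1 : 1 <= l by [].
have l0 : 0 < l by apply: lt_le_trans l1.
have Q0 : 0 <= Q.
  rewrite mulrn_wge0// mulr_ge0// ln_ge0// lerDl divr_ge0 ?(ltW hlam)//.
  by rewrite mulr_ge0 ?ler0n// exprn_even_ge0.
have Qe : 0 <= Q * eta ^+ 2 by rewrite mulr_ge0 ?sqr_ge0.
have A0 : 0 <= A by rewrite /A; lra.
pose near t : set O := [set w | close_pair theta (4 * tau) (X t w)].
pose K1 := Q * (2 * l + 1) + 2 * l + A * ((Delta1 ^+ 2)^-1 + 2 / tau ^+ 2).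
pose K2 := A * (32 / (3 * l)) + 1.
have K10 : 0 <= K1.
  have Ql : 0 <= Q * l by rewrite mulr_ge0// ltW.
  have Aq : 0 <= A * ((Delta1 ^+ 2)^-1 + 2 / tau ^+ 2).
    by rewrite mulr_ge0// addr_ge0 ?invr_ge0 ?divr_ge0 ?exprn_ge0// ltW.
  rewrite /K1; lra.
have K20 : 0 <= K2 by rewrite addr_ge0// mulr_ge0// divr_ge0// mulr_ge0// ltW.
pose H w : R := \sum_(t < T) (\1_(near t) w + \sum_(i < N) \1_(bad_event sig t i) w).
have ind0 (S : set O) w : 0 <= \1_S w :> R by rewrite indicE.
have H0 w : 0 <= H w by apply: sumr_ge0 => t _; rewrite addr_ge0 ?sumr_ge0.
have mnear t : measurable (near t).
  by apply: measurable_bool; apply: mdisc_close_pair => j; exact: mmx_X.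
have mI (S : set O) : measurable S -> measurable_fun setT (fun w => (\1_S w : R)%:E).
  by move=> mS; apply/measurable_EFinP; exact: measurable_indic.
have iI (S : set O) : measurable S -> P.-integrable setT (fun w => (\1_S w : R)%:E).
  move=> mS; apply: (@le_integrable _ _ _ _ _ measurableT _ (cst 1%:E)); first exact: mI.
    by move=> w _; rewrite /= lee_fin normr1 indicE; case: (_ \in _); rewrite ?normr1 ?normr0.
  exact: finite_measure_integrable_cst.
have mbad t i' : measurable (bad_event sig t i') by exact: measurable_bad_event.
have HE w : (H w)%:E = (\sum_(t < T) ((\1_(near t) w)%:E + \sum_(i < N) (\1_(bad_event sig t i) w)%:E))%E.
  by rewrite /H -sumEFin; apply: eq_bigr => t _; rewrite EFinD sumEFin.
have iH : P.-integrable setT (EFin \o H).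
  rewrite (_ : EFin \o H = fun w => (\sum_(t < T) ((\1_(near t) w)%:E + \sum_(i < N) (\1_(bad_event sig t i) w)%:E))%E).
    apply: integrable_sum => // t _; apply: integrableD => //; first exact: iI.
    by apply: integrable_sum => // i' _; exact: iI.
  by apply/funext => w /=; exact: HE.
have intH : (\int[P]_w (H w)%:E <= (T%:R * p + N%:R * (1 + 2 * l))%:E)%E.
  under eq_integral do rewrite HE.
  rewrite ge0_integral_sum//; last 2 first.
  - by move=> t; apply: emeasurable_funD; [exact: mI|apply: emeasurable_sum => i'; exact: mI].
  - by move=> t w _; rewrite adde_ge0 ?sume_ge0// => *; rewrite lee_fin.
  apply: (@le_trans _ _ (\sum_(t < T) (p + N%:R * ((1 + 2 * l) / T%:R))%:E)%E).
    apply: lee_sum => t _; rewrite ge0_integralD//; last 3 first.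
    - exact: mI.
    - by move=> w _; rewrite sume_ge0// => *; rewrite lee_fin.
    - by apply: emeasurable_sum => i'; exact: mI.
    rewrite integral_indic// setIT EFinD leeD//; first exact: hnear.
    rewrite ge0_integral_sum//; last by move=> i'; exact: mI.
    rewrite (_ : (N%:R * ((1 + 2 * l) / T%:R))%:E = \sum_(i < N) ((1 + 2 * l) / T%:R)%:E)%E; last first.
      by rewrite sumEFin sumr_const card_ord mulr_natl.
    apply: lee_sum => i' _; rewrite integral_indic// setIT.
    by apply: bad_event_prob => //; exact: ltnW (ltn_ord t).
  rewrite sumEFin sumr_const card_ord lee_fin -mulr_natl mulrDr.
  have TR : T%:R != 0 :> R by rewrite pnatr_eq0 -lt0n.
  by rewrite le_eqVlt; apply/orP; left; apply/eqP; field.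
have iB : P.-integrable setT (fun w => (K1 + K2 * H w)%:E).
  under eq_fun do rewrite EFinD EFinM.
  by apply: integrableD => //; [exact: finite_measure_integrable_cst|exact: integrableZl].
have hreg := expected_regret_le (B := fun w => K1 + K2 * H w) iB.
apply: (le_trans (hreg i _ _)).
- by move=> w; rewrite addr_ge0 ?mulr_ge0.
- move=> w hg.
  have h := path_regret hKN hrk hlam heta hmcm hDelta1 htheta hBy hsig (es w) hg hlnT htau hT32 hetaE i.
  apply: (le_trans h) => /=; rewrite -/l -/Q.
  set h' := anomalies _ _ _ _ _ _ _ _ _ _ _ _ _.
  have hh : h' <= H w.
    rewrite /h' /anomalies natr_sum /H; apply: ler_sum => t _; rewrite natrD; apply: lerD.
      by rewrite indicE /near_tie; case: (boolP (close_pair _ _ _)) => hc; [rewrite mem_set|rewrite ler0n].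
    rewrite /bad_round; case: (boolP [exists i, _]) => [/existsP [i' hi']|_]; last first.
      by apply: sumr_ge0.
    rewrite (bigD1 i')//= {1}indicE mem_set// lerDl.
    by apply: sumr_ge0.
  have : (A * (32 / (3 * l)) + 1) * h' <= K2 * H w by rewrite ler_wpM2l.
  rewrite /K1 /A; lra.
under eq_integral do rewrite EFinD EFinM.
rewrite integralD//; [|exact: finite_measure_integrable_cst|exact: integrableZl].
have e1 : (\int[P]_w (cst K1%:E w) = K1%:E)%E.
  by rewrite integral_cst// -[RHS]mule1; congr (_ * _)%E; exact: probability_setT.
rewrite integralZl// (_ : (\int[P]_x K1%:E = K1%:E)%E); last exact: e1.
rewrite [leRHS](_ : _ = K1%:E + K2%:E * (T%:R * p + N%:R * (1 + 2 * l))%:E)%E//.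
by apply: leeD2l => //; apply: lee_wpmul2l => //; rewrite lee_fin.
Qed.

End Expectation.

(** * Rates *)

(** Bookkeeping with [S] for [T ^ (2 / 3)], [e] for [eta ^ 2], [D] for the initial [q] and [n] for
    the number of players. Since [S] and [l] are at least [1], every term is absorbed into
    [S * l ^ 3]. *)
Lemma rate_bound (R : realFieldType) (l S Q e D c n cQ ce : R) :
  1 <= l -> 1 <= S -> 0 <= Q -> Q <= cQ * l -> 0 <= e -> e <= ce * l -> 0 <= D -> 0 <= c -> 0 <= n ->
  let A := 2 * Q * e + 3 * l / 8 in
  let cA := 2 * cQ * ce + 1 in
  Q * (2 * l + 1) + 2 * l + A * (D + 2 * S) + (A * (32 / (3 * l)) + 1) * (4 * c * S + n * (1 + 2 * l))
  <= (3 * cQ + 2 + cA * (D + 2) + (11 * cA + 1) * (4 * c + 3 * n)) * S * l ^+ 3.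
Proof.
move=> l1 S1 Q0 hQ e0 he D0 c0 n0 /=.
have l0 : 0 < l by lra.
set A := _ + 3 * l / 8; set cA := 2 * cQ * ce + 1.
have cQ0 : 0 <= cQ by rewrite -(pmulr_lge0 _ l0) (le_trans Q0).
have ce0 : 0 <= ce by rewrite -(pmulr_lge0 _ l0) (le_trans e0).
have cA1 : 1 <= cA by rewrite lerDr !mulr_ge0.
have ll : l <= l ^+ 2 by rewrite expr2 ler_peMl// ltW.
have l2 : 1 <= l ^+ 2 by rewrite (le_trans l1).
have lll : l ^+ 2 <= l ^+ 3 by rewrite exprS ler_peMl// ltW// (lt_le_trans _ l2).
have hA : A <= cA * l ^+ 2.
  have h : Q * e <= (cQ * l) * (ce * l) by apply: ler_pM.
  rewrite /A /cA; lra.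
have Qe0 : 0 <= Q * e by rewrite mulr_ge0.
have A0 : 0 <= A by rewrite /A; lra.
have S0 : 0 < S by lra.
have Sl (x : R) : 0 <= x -> x <= x * S by move=> x0; rewrite ler_peMr.
have t1 : Q * (2 * l + 1) + 2 * l <= (3 * cQ + 2) * S * l ^+ 3.
  have h1 : Q * (2 * l + 1) <= (cQ * l) * (3 * l) by apply: ler_pM => //; lra.
  apply: (@le_trans _ _ ((3 * cQ + 2) * l ^+ 2)).
    have : 2 * l <= 2 * l ^+ 2 by lra.
    lra.
  rewrite mulrAC; apply: (@le_trans _ _ ((3 * cQ + 2) * l ^+ 3)).
    by rewrite ler_wpM2l//; lra.
  by apply: Sl; rewrite mulr_ge0 ?exprn_ge0 ?(ltW l0)//; lra.
have t2 : A * (D + 2 * S) <= cA * (D + 2) * S * l ^+ 3.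
  have h1 : D + 2 * S <= (D + 2) * S by have := Sl D D0; lra.
  have h0 : 0 <= D + 2 * S by lra.
  have h2 : A * (D + 2 * S) <= (cA * l ^+ 2) * ((D + 2) * S) by apply: ler_pM.
  apply: (le_trans h2); rewrite [leLHS](_ : _ = cA * (D + 2) * S * l ^+ 2); last by ring.
  by rewrite ler_wpM2l// !mulr_ge0 ?(ltW S0)//; lra.
have t3 : (A * (32 / (3 * l)) + 1) * (4 * c * S + n * (1 + 2 * l)) <= (11 * cA + 1) * (4 * c + 3 * n) * S * l ^+ 3.
  have h1 : A * (32 / (3 * l)) <= 11 * cA * l.
    have : A * (32 / (3 * l)) <= cA * l ^+ 2 * (32 / (3 * l)).
      by rewrite ler_wpM2r// divr_ge0// mulr_ge0// ltW.
    have -> : cA * l ^+ 2 * (32 / (3 * l)) = 32 / 3 * (cA * l) by field; rewrite gt_eqF.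
    have : 0 <= cA * l by rewrite mulr_ge0 ?ltW//; lra.
    lra.
  have h2 : A * (32 / (3 * l)) + 1 <= (11 * cA + 1) * l ^+ 2.
    have h3 : 11 * cA * l <= 11 * cA * l ^+ 2 by rewrite ler_wpM2l//; lra.
    lra.
  have h4 : 4 * c * S + n * (1 + 2 * l) <= (4 * c + 3 * n) * S * l.
    have a1 : c * S <= c * S * l by rewrite ler_peMr// mulr_ge0// ltW.
    have a2 : n * (1 + 2 * l) <= n * (3 * l) by rewrite ler_wpM2l//; lra.
    have a3 : n * l <= n * l * S by apply: Sl; rewrite mulr_ge0// ltW.
    lra.
  have h5 : 0 <= A * (32 / (3 * l)) + 1 by rewrite addr_ge0// mulr_ge0// divr_ge0// mulr_ge0// ltW.
  have h6 : 0 <= 4 * c * S + n * (1 + 2 * l).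
    by rewrite addr_ge0// ?mulr_ge0// ?(ltW S0)//; lra.
  apply: (le_trans (ler_pM h5 h6 h2 h4)).
  by rewrite le_eqVlt; apply/orP; left; apply/eqP; ring.
lra.
Qed.

Lemma ln_confidence (R : realType) (B lam : R) (T : nat) : 0 < lam -> (0 < T)%N ->
  ln (1 + T%:R * B ^+ 2 / lam) <= ln T%:R + ln (1 + B ^+ 2 / lam).
Proof.
move=> hlam T0; have TR : 1 <= T%:R :> R by rewrite ler1n.
have TR0 : 0 < T%:R :> R by rewrite ltr0n.
have b0 : 0 <= B ^+ 2 / lam by rewrite divr_ge0 ?sqr_ge0// ltW.
have Tb0 : 0 <= T%:R * B ^+ 2 / lam by rewrite -mulrA mulr_ge0// ltW.
rewrite -lnM ?posrE ?ltr_pwDl// ler_ln ?posrE ?mulr_gt0 ?ltr_pwDl//.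
by rewrite mulrDr mulr1 -mulrA lerD2r.
Qed.

Unset Implicit Arguments.

Theorem theorem3p2
  (R : realType) (N K d : nat) (hKN : (N <= K)%N)
  (* arm preferences: strict rankings *)
  (rk : 'I_K -> 'I_N -> nat) (hrk : forall j, injective (rk j))
  (* unknown player parameters and bounds *)
  (theta : 'I_N -> 'rV[R]_d) (Btheta Bx : R)
  (htheta : forall i, vnorm (theta i) <= Btheta)
  (hBy : 2 * Btheta * Bx <= 1)
  (* probability space, contexts X t, noise E t *)
  (dO : measure_display) (O : measurableType dO) (P : probability O R)
  (X : nat -> O -> 'I_K -> 'rV[R]_d) (E : nat -> O -> 'I_N -> 'I_K -> R)
  (sig : R) (hsig : 0 <= sig)
  (hXmeas : forall t j k, measurable_fun setT (fun w => X t w j ord0 k))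
  (hEmeas : forall t i j, measurable_fun setT (fun w => E t w i j))
  (hXbound : forall t j, {ae P, forall w, vnorm (X t w j) <= Bx})
  (* contexts: the tuple of round t is independent of the past and
     identically distributed across rounds *)
  (hXindep : forall t, indep2 P
       (sig_gen (@idx_ctx_at N K d t) (allc X E))
       (sig_gen (@idx_ctx_lt N K d t) (allc X E)))
  (hXident : forall t (B : 'I_K -> 'I_d -> set R),
       (forall j k, measurable (B j k)) ->
       P [set w | forall j k, B j k (X t w j ord0 k)] =
       P [set w | forall j k, B j k (X 0%N w j ord0 k)])
  (* noise: i.i.d. and conditionally sig-subgaussian given the past *)
  (hEindep : mutindep P (fun q : nat * 'I_N * 'I_K =>
       sig_gen [set q] (fun q w => E q.1.1 w q.1.2 q.2)))
  (hEident : forall t t' i i' j j' (B : set R), measurable B ->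
       P (E t ^~ i ^~ j @^-1` B) = P (E t' ^~ i' ^~ j' @^-1` B))
  (hEsubg : forall t i j (s : R) (A : set O),
       sig_gen (@idx_hist N K d t) (allc X E) A ->
       (\int[P]_(w in A) (expR (s * E t w i j))%:E <=
          (expR (s ^+ 2 * sig ^+ 2 / 2))%:E * P A)%E)
  (* distribution of the minimum difference: F(D) <= c D for D <= D0 *)
  (Delta0 c : R) (hDelta0 : 0 < Delta0) (hc : 0 < c)
  (hF : forall D, 0 < D -> D <= Delta0 ->
       (P [set w | exists i j j', j != j' /\
            (`| ip (theta i) (X 0%N w j - X 0%N w j') | <= D)%R] <= (c * D)%:E)%E)
  (* algorithm inputs *)
  (Delta1 lam : R) (hDelta1 : 0 < Delta1) (hlam : 0 < lam)
  (mcm : {set 'I_N * 'I_K} -> matching N K) (hmcm : is_mcm mcm) :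
  exists (C : R) (p : nat) (T0 : nat),
    forall T : nat, (T0 <= T)%N -> forall i : 'I_N,
      let eta := sig * Num.sqrt (d%:R * ln ((1 + T%:R * Bx ^+ 2 / lam) * T%:R ^+ 2))
                 + Num.sqrt lam * Btheta in
      (\int[P]_w
         (\sum_(t < T)
            (Ustar rk (Utrue theta (X t w)) i
             - barb_y rk T lam eta mcm Delta1 theta (fun t => X t w)
                 (fun t => E t w) t i))%:E
       <= (C * T%:R `^ (2 / 3) * ln (T%:R) ^+ p)%:E)%E.
Proof.
(* [cQ] and [ce] are chosen so that [Q <= cQ * l] and [eta ^ 2 <= ce * l]. The [3 + b] bounds
   [ln (1 + T * Bx ^ 2 / lam) + 2 * ln T], and the factors [2] come from squaring the two-term sum
   [eta]. *)
pose b := ln (1 + Bx ^+ 2 / lam).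
pose cQ := N%:R * (d%:R * (1 + b)) : R.
pose ce := 2 * (sig ^+ 2 * (d%:R * (3 + b))) + 2 * (lam * Btheta ^+ 2).
pose cA := 2 * cQ * ce + 1.
pose D := (Delta1 ^+ 2)^-1.
(* [T >= expR M] gives both [ln T >= 1] and the doubling condition on [Delta1]. The summand
   [(4 / Delta0) ^ 3] below puts [4 * tau] in the range of [hF]. *)
pose M := 1 + 32 * Delta1 ^+ 2 / 3.
exists (3 * cQ + 2 + cA * (D + 2) + (11 * cA + 1) * (4 * c + 3 * N%:R)), 3%N,
  (Num.truncn (expR M + (4 / Delta0) ^+ 3)).+1.
move=> T hT i; lazy zeta.
set eta := sig * Num.sqrt (d%:R * ln ((1 + T%:R * Bx ^+ 2 / lam) * T%:R ^+ 2)) + Num.sqrt lam * Btheta.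
have TM : expR M + (4 / Delta0) ^+ 3 <= T%:R.
  by rewrite ltW// (lt_le_trans (truncnS_gt _))// ler_nat.
have d30 : 0 <= (4 / Delta0) ^+ 3 by rewrite exprn_ge0// divr_ge0// ltW.
have TR0 : 0 < T%:R :> R by apply: lt_le_trans TM; rewrite ltr_pwDl ?expR_gt0.
have T0 : (0 < T)%N by rewrite -(ltr0n R).
have TR1 : 1 <= T%:R :> R by rewrite ler1n.
pose l := ln (T%:R : R).
have hM : M <= l.
  rewrite -(expRK M) ler_ln ?posrE ?expR_gt0//; apply: le_trans TM.
  by rewrite lerDl.
have D32 : 0 <= 32 * Delta1 ^+ 2 / 3 by rewrite divr_ge0// mulr_ge0// sqr_ge0.
have l1 : 1 <= l by rewrite (le_trans _ hM)// lerDl.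
have hT32 : 32 * Delta1 ^+ 2 / 3 <= l by rewrite (le_trans _ hM)// lerDr.
have l0 : 0 <= l by apply: le_trans l1.
have hb0 : 0 <= Bx ^+ 2 / lam by rewrite divr_ge0 ?sqr_ge0// ltW.
have b0 : 0 <= b by rewrite ln_ge0// lerDl.
have Bt0 : 0 <= Btheta by apply: le_trans (htheta i); rewrite sqrtr_ge0.
have conf0 : 0 <= ln (1 + T%:R * Bx ^+ 2 / lam).
  by rewrite ln_ge0// lerDl -mulrA mulr_ge0.
have conf1 : ln (1 + T%:R * Bx ^+ 2 / lam) <= (1 + b) * l.
  apply: (le_trans (ln_confidence Bx hlam T0)); rewrite -/l -/b.
  have : b * 1 <= b * l by rewrite ler_wpM2l.
  lra.
have eta0 : 0 <= eta by rewrite addr_ge0// mulr_ge0// sqrtr_ge0.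
set r := T%:R `^ 3^-1 : R.
have r0 : 0 < r by rewrite powR_gt0.
have r3 : r ^+ 3 = T%:R.
  by rewrite -powR_mulrn ?(ltW r0)// -powRrM mulVf ?pnatr_eq0// powRr1 ?(ltW TR0).
have r2 : r ^+ 2 = T%:R `^ (2 / 3).
  by rewrite -powR_mulrn ?(ltW r0)// -powRrM mulrC.
have r1 : 1 <= r.
  rewrite leNgt; apply/negP => rl; move: TR1; rewrite -r3 leNgt.
  by rewrite exprn_ilt1 ?(ltW r0).
have hX : P (~` good Bx X) = 0%E.
  apply/negligibleP; first by apply: measurableC; exact: measurable_good.
  apply: ae_foralln => t; exact: filter_forall.
have sub t' i' j' (u : R) (A : set O) : <<s hist_gen X E t'>> A ->
   (\int[P]_(w in A) (expR (u * E t' w i' j'))%:E <= (expR (u ^+ 2 * sig ^+ 2 / 2))%:E * P A)%E.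
  exact: hEsubg.
have rhs0 : 0 <= (3 * cQ + 2 + cA * (D + 2) + (11 * cA + 1) * (4 * c + 3 * N%:R)) * T%:R `^ (2 / 3) * l ^+ 3.
  have cQ0 : 0 <= cQ by rewrite !mulr_ge0// addr_ge0.
  have ce0 : 0 <= ce by rewrite addr_ge0// mulr_ge0// mulr_ge0 ?sqr_ge0 ?(ltW hlam)// mulr_ge0// addr_ge0.
  have cA0 : 0 <= cA.
    by have h := mulr_ge0 cQ0 ce0; rewrite /cA -mulrA addr_ge0// mulr_ge0.
  have D0 : 0 <= D by rewrite /D invr_ge0 sqr_ge0.
  apply: mulr_ge0; last exact: exprn_ge0.
  apply: mulr_ge0; last exact: powR_ge0.
  have ? : 0 <= cA * (D + 2) by rewrite mulr_ge0// addr_ge0.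
  have ? : 0 <= (11 * cA + 1) * (4 * c + 3 * N%:R).
    by rewrite mulr_ge0// addr_ge0// mulr_ge0// ltW.
  lra.
(* Exploration thresholds divide by [eta]. If it vanishes, so does [Btheta], hence every utility is
   zero and there is no regret to bound. *)
have [e0|en0] := eqVneq eta 0.
  have th0 i' : theta i' = 0.
    apply/eqP; apply: contraT => /ip_gt0; rewrite -sqrtr_gt0 => hlt.
    have : 0 < eta; last by rewrite e0 ltxx.
    have hB : 0 < Btheta by apply: lt_le_trans (htheta i').
    by rewrite ltr_wpDl ?mulr_ge0 ?sqrtr_ge0// mulr_gt0// sqrtr_gt0.
  have U0 x i' j : Utrue theta x i' j = 0 by rewrite /Utrue th0 ip0l.
  have m0 x i' m : mval (Utrue theta x) i' m = 0.
    by rewrite /mval; case: (m i') => [j|//]; exact: U0.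
  have Us0 x : Ustar rk (Utrue theta x) i = 0.
    rewrite /Ustar; case: pickP => // m _.
    elim/big_ind: _ => [|u v -> ->|m' _]; [exact: m0| |exact: m0].
    by rewrite maxxx.
  apply: (@le_trans _ _ (\int[P]_w (cst 0 w)%:E)%E).
    apply: (expected_regret_le hXmeas hEmeas hlam sub hX htheta hBy) => //.
      exact: finite_measure_integrable_cst.
    move=> w _; rewrite /regsum big1// => t _.
    by rewrite Us0 m0 subrr.
  by rewrite integral0_eq// lee_fin.
have etap : 0 < eta by rewrite lt_neqAle eq_sym en0.
have tau0 : 0 < r^-1 by rewrite invr_gt0.
have hnear t : (P [set w | close_pair theta (4 * r^-1) (X t w)] <= (c * (4 * r^-1))%:E)%E.
  (* The assumption on near ties concerns round [0]; equality of laws carries it to every round. *)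
  rewrite (@rectangle_law R K d dO O P (X t) (X 0%N) (close_pair theta (4 * r^-1))).
  - rewrite [X in P X](_ : _ = [set w | exists i j j', j != j' /\
      (`| ip (theta i) (X 0%N w j - X 0%N w j') | <= 4 * r^-1)]).
      apply: hF; first by rewrite mulr_gt0.
      rewrite ler_pdivrMr// mulrC -ler_pdivrMr//.
      rewrite -(@ler_pXn2r _ 3) ?nnegrE ?divr_ge0 ?(ltW hDelta0) ?(ltW r0)//.
      by rewrite r3 (le_trans _ TM)// lerDr expR_ge0.
    by apply/seteqP; split=> w /close_pairP.
  - by move=> j; exact: mmx_X.
  - by move=> j; exact: mmx_X.
  - exact: hXident.
  - by move=> *; exact: mdisc_close_pair.
have h := expected_regret hXmeas hEmeas hlam hsig sub hX htheta hBy etap hDelta1 hmcm l1 hT32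
  hKN hrk (lexx eta) tau0 hnear i.
apply: (le_trans h); rewrite lee_fin -/l.
have -> : 2 / r^-1 ^+ 2 = 2 * T%:R `^ (2 / 3) by rewrite exprVn invrK r2.
have -> : T%:R * (c * (4 * r^-1)) = 4 * c * T%:R `^ (2 / 3).
  by rewrite -r2 -r3; field; rewrite gt_eqF.
apply: rate_bound => //.
- by rewrite -r2 exprn_ege1.
- by rewrite mulrn_wge0// mulr_ge0.
- rewrite (_ : cQ * l = N%:R * (d%:R * ((1 + b) * l))); last by rewrite /cQ; ring.
  by rewrite -[_ *+ N]mulr_natl ler_wpM2l// ler_wpM2l.
- exact: sqr_ge0.
- set C := d%:R * ln ((1 + T%:R * Bx ^+ 2 / lam) * T%:R ^+ 2).
  have hC : C <= d%:R * ((3 + b) * l).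
    rewrite ler_wpM2l// lnM ?posrE ?exprn_gt0 ?lamR_gt0// lnXn// -/l.
    by move: conf1; move: (ln _) => z hz; rewrite mulr2n; lra.
  have C0 : 0 <= C.
    rewrite mulr_ge0// lnM ?posrE ?exprn_gt0 ?lamR_gt0// lnXn// -/l.
    by rewrite addr_ge0// mulrn_wge0.
  have h1 : eta ^+ 2 <= 2 * (sig ^+ 2 * C) + 2 * (lam * Btheta ^+ 2).
    have -> : sig ^+ 2 * C = (sig * Num.sqrt C) ^+ 2 by rewrite exprMn sqr_sqrtr.
    have -> : lam * Btheta ^+ 2 = (Num.sqrt lam * Btheta) ^+ 2 by rewrite exprMn sqr_sqrtr ?ltW.
    rewrite /eta -/C; set x := sig * _; set y := Num.sqrt lam * _.
    have := sqr_ge0 (x - y); lra.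
  apply: (le_trans h1).
  have h2 : sig ^+ 2 * C <= sig ^+ 2 * (d%:R * ((3 + b) * l)) by rewrite ler_wpM2l ?sqr_ge0.
  have h3 : lam * Btheta ^+ 2 <= lam * Btheta ^+ 2 * l.
    by rewrite ler_peMr// mulr_ge0 ?sqr_ge0 ?ltW.
  rewrite /ce; lra.
- by rewrite invr_ge0 sqr_ge0.
- exact: ltW.
Qed.
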